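(* For $k\geq 3$, the algebra $$\mathbb{C}\left[f_{k,2}^{[j]},f_{k,4}^{[j]},\dots,G_2,G_4,\dots,\theta_{2\ell+1,2k-1}^{[j]}\right]_{\ell=0,\dots,k-2;\ j=0,\dots,k-2}$$ (generated by the derivatives of order $0,\dots,k-2$ of all $f_{k,2n}$, all Eisenstein series $G_{2n}$, and the derivatives of order $0,\dots,k-2$ of $\theta_{2\ell+1,2k-1}$ for $0\le\ell\le k-2$) is closed under $D=\frac{1}{2\pi i}\frac{\partial}{\partial\tau}$.
   Context: $\tau\in\mathbb{H}$, $q=e^{2\pi i\tau}$, $\zeta=e^{2\pi iz}$, $(a)_n=\prod_{m=0}^{n-1}(1-aq^m)$. $G_k(\tau)=-\frac{B_k}{2k}+\sum_{n\ge1}\sigma_{k-1}(n)q^n$ for even $k\ge2$ ($B_k$ Bernoulli numbers). $\theta_{a,b}(\tau)=\sum_{n\in\mathbb{Z}}(-1)^nq^{(bn^2+an)/2}$ and $h^{[j]}$ denotes the $j$-th derivative in $\tau$ (for $\theta$ normalized as $(\frac{1}{\pi i}\partial_\tau)^j$; the normalization does not affect the generated $\mathbb{C}$-algebra). For $k\ge3$, $FG_k(\zeta,q)=\sum_{n_{k-1}\geq\dots\geq n_1\geq 1}\frac{q^{n_1^2+\dots+n_{k-1}^2}}{(q)_{n_{k-1}-n_{k-2}}\cdots(q)_{n_2-n_1}(\zeta q)_{n_1}(\zeta^{-1}q)_{n_1}}$, and $f_{k,j}$ are defined by $$FG_k(\zeta,q)+\frac{\theta_{1,2k-1}(\tau)}{(q)_\infty}=\frac{\sin(\pi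 z)}{\pi z(q)_\infty}\exp\left(2\sum_{j\ge1}f_{k,j}(\tau)\frac{(2\pi iz)^j}{j!}\right).$$ *)

(* Defs.v *)
From HB Require Import structures.
From mathcomp Require Import all_boot all_order all_algebra.
From mathcomp Require Import complex.
From mathcomp Require Import all_classical all_reals all_analysis.

Set Implicit Arguments.
Unset Strict Implicit.
Unset Printing Implicit Defensive.

Import Order.TTheory GRing.Theory Num.Theory numFieldNormedType.Exports.

Local Open Scope ring_scope.
Local Open Scope complex_scope.
Local Open Scope classical_set_scope.

(* R[i], typed so that it inherits the topology and the normed module
   structure that every numClosedFieldType carries; [derive1] and [derivable]
   at this type are then complex differentiation. *)
Definition C (R : realType) : numClosedFieldType := R[i].

Section ComplexFunctions.
Variable R : realType.
Implicit Types (z tau : C R).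

Definition upper_half_plane : set (C R) := [set tau | 0 < complex.Im tau].

Definition cI : C R := 'i%C.
Definition cpi : C R := (pi : R)%:C.

Definition cexp z : C R :=
  (expR (complex.Re z))%:C * (cos (complex.Im z) +i* sin (complex.Im z)).

Definition csin z : C R := (cexp (cI * z) - cexp (- (cI * z))) / (2 * cI).

(* e^{2 pi i z}: this is q for z = tau, and zeta for the elliptic variable z *)
Definition e2pi z : C R := cexp (2 * cpi * cI * z).

End ComplexFunctions.

Section QSeries.
Variable R : realType.
Implicit Types (q zeta a z tau : C R).

Definition qpoch q a (n : nat) : C R := \prod_(m < n) (1 - a * q ^+ m).

Definition qpoch_inf q a : C R := limn (qpoch q a).

(* [:: B_0; ...; B_(n-1)], from \sum_(j <= m) 'C(m+1, j) B_j = (m == 0) *)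
Fixpoint bernoulli_seq (n : nat) : seq rat :=
  if n is m.+1 then
    let s := bernoulli_seq m in
    rcons s ((m == 0%N)%:R - (\sum_(j < m) 'C(m.+1, j)%:R * s`_j) / m.+1%:R)
  else [::].

Definition bernoulli (n : nat) : rat := (bernoulli_seq n.+1)`_n.

Definition sigma (e n : nat) : nat := (\sum_(d <- divisors n) d ^ e)%N.

Definition eisenstein (k : nat) tau : C R :=
  - ratr (bernoulli k) / (2 * k)%:R
  + \big[+%R/0]_(1 <= n <oo) ((sigma k.-1 n)%:R * e2pi tau ^+ n).

(* (-1)^n q^((b n^2 + a n)/2); the power of q is e^{2 pi i tau (b n^2 + a n)/2},
   so no parity condition on a and b is needed. *)
Definition theta_term (a b : nat) tau (n : int) : C R :=
  (-1) ^ n * e2pi ((b%:Z * n ^+ 2 + a%:Z * n)%:~R / 2 * tau).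

Definition theta (a b : nat) tau : C R :=
  limn (fun N => \sum_(n < N.+1) theta_term a b tau n%:Z
                 + \sum_(n < N) theta_term a b tau (- n.+1%:Z)).

(* The summand at s = [:: n_1; ...; n_(k-1)]. *)
Definition FG_term q zeta (s : seq nat) : C R :=
  q ^+ (\sum_(m <- s) m ^ 2)%N /
  ((\prod_(i < (size s).-1) qpoch q q (nth 0%N s i.+1 - nth 0%N s i))
   * qpoch q (zeta * q) (head 0%N s) * qpoch q (zeta^-1 * q) (head 0%N s)).

(* [path leq 1 s] says 1 <= n_1 <= ... <= n_(k-1); the N-th partial sum keeps
   the finitely many tuples with n_(k-1) < N. *)
Definition FG (k : nat) q zeta : C R :=
  limn (fun N => \sum_(t : (k.-1).-tuple 'I_N | path leq 1%N (map val t))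
                    FG_term q zeta (map val t)).

Definition FG_exponent_term (f : nat -> C R -> C R) tau z (j : nat) : C R :=
  f j tau * (2 * cpi R * cI R * z) ^+ j / j`!%:R.

(* f j is f_{k,j} on the upper half plane, for every j >= 1; the identity is
   one of analytic functions of z around 0. *)
Definition FG_coefficients (k : nat) (f : nat -> C R -> C R) : Prop :=
  forall tau, upper_half_plane tau -> \forall z \near (0 : C R)^',
    let q := e2pi tau in
    cvgn (fun N => \sum_(1 <= j < N) FG_exponent_term f tau z j) /\
    FG k q (e2pi z) + theta 1 (2 * k - 1) tau / qpoch_inf q q
    = csin (cpi R * z) / (cpi R * z * qpoch_inf q q)
      * cexp (2 * \big[+%R/0]_(1 <= j <oo) (FG_exponent_term f tau z j)).

End QSeries.

Section Algebra.
Variable R : realType.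
Implicit Types (G A : set (C R -> C R)).

(* A function on the upper half plane is represented by any function on C that
   extends it, so subalgebras are saturated for equality on that domain. *)
Definition is_subalgebra A : Prop :=
  [/\ forall c, A (cst c),
      forall g h, A g -> A h -> A (g \+ h),
      forall g h, A g -> A h -> A (g \* h) &
      forall g h, (forall tau, upper_half_plane tau -> g tau = h tau) ->
        A g -> A h].

Definition generated_algebra G : set (C R -> C R) := smallest is_subalgebra G.

Definition D (g : C R -> C R) : C R -> C R :=
  fun tau => (2 * cpi R * cI R)^-1 * derive1 g tau.

(* [derive1] is total: differentiability has to be required for D g to be
   meaningful. *)
Definition closed_under_D A : Prop :=
  forall g, A g ->
    (forall tau, upper_half_plane tau -> derivable g tau 1) /\ A (D g).

Definition theta_derivative (a b j : nat) : C R -> C R :=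
  fun tau => (cpi R * cI R) ^- j * derive1n j (theta a b) tau.

Definition generators (k : nat) (f : nat -> C R -> C R) : set (C R -> C R) :=
  [set derive1n p.2 (f (2 * p.1)%N)
    | p in [set p : nat * nat | (1 <= p.1)%N /\ (p.2 <= k - 2)%N]]
  `|` [set eisenstein (2 * n) | n in [set n | (1 <= n)%N]]
  `|` [set theta_derivative (2 * p.1 + 1) (2 * k - 1) p.2
        | p in [set p : nat * nat | (p.1 <= k - 2)%N /\ (p.2 <= k - 2)%N]].

End Algebra.

(* Main.v *)
(* Write b = 2k - 1. A Bailey chain turns FG_k into a sum over s of rank type whose
   Fourier expansion in zeta shows that exp(2 sum_j f_{k,j} x^j / j!) equals
   x / (2 sinh(x/2)) - 2x sum_{j odd} rho_j x^j / j!, where the rho_j are the rank sums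
   sum_{h >= 0, n >= 1} (-1)^n q^(n mu + b n^2 / 2) mu^j with mu = h + 1/2. Hence an
   algebra contains the first m derivatives of all f_{k,2n} iff it contains those of
   all rho_j, and it suffices to express the derivatives of order k - 1 of the theta
   functions and of the rho_j through lower ones.
   Put u(z) = (q z; q)_oo^(-b). Its square moments sum_{r,s} u_r u_s (r - s)^l are
   a common factor times polynomials in Eisenstein series, since log u has moments
   given by Lambert series. The coefficients of (z; q)_oo^(-b) are values of an even
   polynomial of degree b - 1 = 2(k - 1) convolved with u, so pairing them with u
   gives a partial theta series whose weights are such moments. Reading this identity
   at -M and M - b yields a linear differential equation of order k - 1 for theta,
   with coefficients in the ring of Eisenstein series and constant leading coefficient;
   summing it over h, with odd powers of mu as weights, yields the analogous equation
   linking the rho_j. The Eisenstein ring itself is stable under D because the same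
   pairing for (q z; q)_oo produces sum_m (-1)^m (2m+1)^i q^(m(m+1)/2), on which D
   raises i by 2. *)

Require Import Defs.
From mathcomp Require Import all_boot all_order all_algebra.
From mathcomp Require Import all_classical all_reals all_analysis.
From HB Require Import structures.
From mathcomp Require Import complex.
From mathcomp Require Import zify ring lra.

Set Implicit Arguments.
Unset Strict Implicit.
Unset Printing Implicit Defensive.

Import Order.TTheory GRing.Theory Num.Theory numFieldNormedType.Exports.
Local Open Scope ring_scope.

(** * Formal power series *)

(** Nothing is assumed about the regularity of the f_{k,j} in tau, so they must be recognised as
    power series in q before they can be differentiated. The closure itself is proved for formal
    series and for any subalgebra that contains the Eisenstein series. The pairings are the Laurent
    coefficients of (z; q)_oo^(-b) (q/z; q)_oo^(-b) in the annulus |q| < |z| < 1. The symmetry z ->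
    q/z relates the coefficients of z^M and z^(-M), and moving past the pole of order b at z = 1
    costs a polynomial in M of degree b - 1; iterating both gives the partial theta series. The
    order is k - 1 rather than 2(k - 1) because exponents are quadratic: after completing the
    square, one derivation is worth two powers of the linear form, and parity kills the odd powers.
    The half-integral shifts are what gives all polynomials involved a parity. The factor common to
    the square moments is a q-series with constant term 1 that is not known to lie in the algebra,
    so each relation is divided by it before use. *)

Record fps (A : Type) := Fps { fcoef :> nat -> A }.

HB.instance Definition _ (A : Type) := gen_eqMixin (fps A).
HB.instance Definition _ (A : Type) := gen_choiceMixin (fps A).

Lemma fpsP (A : Type) (f g : fps A) : (forall n, f n = g n) -> f = g.
Proof. by case: f g => f [g] /= /funext ->. Qed.

Section FpsRing.
Variable A : comNzRingType.
Implicit Types f g h : fps A.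

Definition fps0 : fps A := Fps (fun _ => 0).
Definition fps1 : fps A := Fps (fun n => (n == 0%N)%:R).
Definition fps_opp f := Fps (fun n => - f n).
Definition fps_add f g := Fps (fun n => f n + g n).
Definition fps_mul f g := Fps (fun n => \sum_(i < n.+1) f i * g (n - i)%N).

(** A coefficient of a product only sees truncations, so associativity and commutativity are
    inherited from polynomials. *)
Let trunc n f : {poly A} := \poly_(i < n.+1) f i.

Let truncE n f i : (i <= n)%N -> (trunc n f)`_i = f i.
Proof. by move=> le_in; rewrite coef_poly ltnS le_in. Qed.

Let trunc_mul n f g i : (i <= n)%N -> fps_mul f g i = (trunc n f * trunc n g)`_i.
Proof.
move=> le_in; rewrite coefM; apply: eq_bigr => j _.
by rewrite !truncE //; have := ltn_ord j; lia.
Qed.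

Fact fps_addA : associative fps_add.
Proof. by move=> f g h; apply: fpsP => n /=; rewrite addrA. Qed.
Fact fps_addC : commutative fps_add.
Proof. by move=> f g; apply: fpsP => n /=; rewrite addrC. Qed.
Fact fps_add0 : left_id fps0 fps_add.
Proof. by move=> f; apply: fpsP => n /=; rewrite add0r. Qed.
Fact fps_addN : left_inverse fps0 fps_opp fps_add.
Proof. by move=> f; apply: fpsP => n /=; rewrite addNr. Qed.

HB.instance Definition _ :=
  GRing.isZmodule.Build (fps A) fps_addA fps_addC fps_add0 fps_addN.

Fact fps_mulC : commutative fps_mul.
Proof. by move=> f g; apply: fpsP => n; rewrite !(trunc_mul _ _ (leqnn n)) mulrC. Qed.
Fact fps_mulA : associative fps_mul.
Proof.
move=> f g h; apply: fpsP => n /=.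
transitivity ((trunc n f * (trunc n g * trunc n h))`_n).
  rewrite coefM; apply: eq_bigr => i _.
  by rewrite -!trunc_mul ?leq_subr // truncE // -ltnS.
rewrite mulrA coefM; apply: eq_bigr => i _.
by rewrite -!trunc_mul -1?ltnS // truncE ?leq_subr.
Qed.
Fact fps_mul1 : left_id fps1 fps_mul.
Proof.
move=> f; apply: fpsP => n /=; rewrite big_ord_recl /= mul1r subn0 big1 ?addr0 //.
by move=> i _; rewrite mul0r.
Qed.
Fact fps_mulDl : left_distributive fps_mul fps_add.
Proof.
move=> f g h; apply: fpsP => n /=; rewrite -big_split /=; apply: eq_bigr => i _.
by rewrite mulrDl.
Qed.
Fact fps_1_neq0 : fps1 != 0 :> fps A.
Proof. by apply/eqP => /(congr1 (fun f : fps A => f 0%N)) /= /eqP; rewrite oner_eq0. Qed.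

HB.instance Definition _ := GRing.Zmodule_isComNzRing.Build (fps A)
  fps_mulA fps_mulC fps_mul1 fps_mulDl fps_1_neq0.

Lemma fcoefD f g n : (f + g) n = f n + g n. Proof. by []. Qed.
Lemma fcoefN f n : (- f) n = - f n. Proof. by []. Qed.
Lemma fcoefB f g n : (f - g) n = f n - g n. Proof. by []. Qed.
Lemma fcoef0 n : (0 : fps A) n = 0. Proof. by []. Qed.
Lemma fcoef1 n : (1 : fps A) n = (n == 0%N)%:R. Proof. by []. Qed.
Lemma fcoefM f g n : (f * g) n = \sum_(i < n.+1) f i * g (n - i)%N.
Proof. by []. Qed.
Lemma fcoefM0 f g : (f * g) 0%N = f 0%N * g 0%N.
Proof. by rewrite fcoefM big_ord1 subn0. Qed.
Lemma fcoef_sum (I : Type) (r : seq I) (P : pred I) (F : I -> fps A) n :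
  (\sum_(i <- r | P i) F i) n = \sum_(i <- r | P i) F i n.
Proof. by elim/big_rec2: _ => //= i y1 y2 _ <-. Qed.
Lemma fcoefMn f m n : (f *+ m) n = f n *+ m.
Proof. by elim: m => // m IHm; rewrite !mulrS fcoefD IHm. Qed.
Lemma fcoefX0 f m : (f ^+ m) 0%N = f 0%N ^+ m.
Proof. by elim: m => // m IHm; rewrite !exprS fcoefM0 IHm. Qed.

Definition fC (c : A) : fps A := Fps (fun n => if n is 0 then c else 0).

Lemma fC_is_zmod_morphism : zmod_morphism fC.
Proof. by move=> c d; apply: fpsP => -[|n]; rewrite fcoefB //= subr0. Qed.
Lemma fcoefCM c f n : (fC c * f) n = c * f n.
Proof.
rewrite fcoefM big_ord_recl /= subn0 big1 ?addr0 // => i _.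
by rewrite mul0r.
Qed.
Lemma fC_is_monoid_morphism : monoid_morphism fC.
Proof.
split; first by apply: fpsP => -[].
by move=> c d; apply: fpsP => -[|n]; rewrite fcoefCM //= mulr0.
Qed.
HB.instance Definition _ := GRing.isZmodMorphism.Build A (fps A) fC fC_is_zmod_morphism.
HB.instance Definition _ := GRing.isMonoidMorphism.Build A (fps A) fC fC_is_monoid_morphism.

Lemma fcoefC c n : fC c n = c *+ (n == 0%N).
Proof. by case: n. Qed.

Lemma fC_signM n c : fC ((-1) ^+ n * c) = (-1) ^+ n * fC c.
Proof. by rewrite rmorphM rmorphXn rmorphN rmorph1. Qed.

Definition fX : fps A := Fps (fun n => (n == 1%N)%:R).

Lemma fcoefXM f n : (fX * f) n = if n is n'.+1 then f n' else 0.
Proof.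
case: n => [|n]; first by rewrite fcoefM0 mul0r.
rewrite fcoefM big_ord_recl mul0r add0r big_ord_recl /= mul1r subSS subn0.
by rewrite big1 ?addr0 // => i _; rewrite mul0r.
Qed.

Lemma fcoefXnM f m n : (fX ^+ m * f) n = if (n < m)%N then 0 else f (n - m)%N.
Proof.
elim: m n => [|m IHm] n; first by rewrite expr0 mul1r subn0.
by rewrite exprS -mulrA fcoefXM; case: n => [|n] //; rewrite IHm ltnS subSS.
Qed.

Lemma fcoefXn m n : (fX ^+ m) n = (n == m)%:R.
Proof.
rewrite -[_ ^+ m]mulr1 fcoefXnM fcoef1.
by case: ltnP => [/ltn_eqF -> //|le_mn]; rewrite subn_eq0 eqn_leq le_mn andbT.
Qed.

(* The Euler derivation [t d/dt]. *)
Definition eu f : fps A := Fps (fun n => f n *+ n).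

Lemma eu_is_zmod_morphism : zmod_morphism eu.
Proof. by move=> f g; apply: fpsP => n /=; rewrite mulrnBl. Qed.
HB.instance Definition _ := GRing.isZmodMorphism.Build (fps A) (fps A) eu eu_is_zmod_morphism.

Lemma euM f g : eu (f * g) = eu f * g + f * eu g.
Proof.
apply: fpsP => n; rewrite fcoefD !fcoefM /= -sumrMnl -big_split /=.
apply: eq_bigr => i _; rewrite mulrnAl mulrnAr -mulrnDr subnKC //.
by rewrite -ltnS.
Qed.
Lemma euC c : eu (fC c) = 0.
Proof. by apply: fpsP => -[|n] //=; rewrite mul0rn. Qed.
Lemma eu1 : eu 1 = 0.
Proof. by rewrite -(rmorph1 fC) euC. Qed.
Lemma euCM c f : eu (fC c * f) = fC c * eu f.
Proof. by rewrite euM euC mul0r add0r. Qed.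
Lemma euX f m : eu (f ^+ m) = (f ^+ m.-1 * eu f) *+ m.
Proof.
elim: m => [|m IHm]; first by rewrite expr0 eu1.
rewrite exprS euM {}IHm /= mulrS; congr (_ + _); first by rewrite mulrC.
by case: m => [|m]; rewrite ?mulr0 // mulrnAr mulrA exprS.
Qed.

Definition sc (c : A) f : fps A := Fps (fun n => c ^+ n * f n).

Lemma sc_is_zmod_morphism c : zmod_morphism (sc c).
Proof. by move=> f g; apply: fpsP => n /=; rewrite mulrBr. Qed.
Lemma sc_is_monoid_morphism c : monoid_morphism (sc c).
Proof.
split; first by apply: fpsP => -[|n] /=; rewrite ?mulr1 // mulr0.
move=> f g; apply: fpsP => n; rewrite fcoefM /= mulr_sumr.
apply: eq_bigr => i _; have le_in : (i <= n)%N by rewrite -ltnS.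
by rewrite mulrACA -exprD subnKC.
Qed.
HB.instance Definition _ c := GRing.isZmodMorphism.Build (fps A) (fps A) (sc c) (sc_is_zmod_morphism c).
HB.instance Definition _ c := GRing.isMonoidMorphism.Build (fps A) (fps A) (sc c) (sc_is_monoid_morphism c).

Lemma fcoef_sc c f n : sc c f n = c ^+ n * f n. Proof. by []. Qed.
Lemma fcoef_eu f n : eu f n = f n *+ n. Proof. by []. Qed.

Lemma eu_sc c f : eu (sc c f) = sc c (eu f).
Proof. by apply: fpsP => n /=; rewrite mulrnAr. Qed.

(** The coefficients of [g] are killed one by one from below. Over any base ring, this cancellation
    stands in for division by a normalising series. *)
Lemma fps_reg f g : f 0%N = 1 -> f * g = 0 -> g = 0.
Proof.
move=> f0 fg0; apply: fpsP => n; elim/ltn_ind: n => n IHn.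
have := congr1 (fun h : fps A => h n) fg0; rewrite fcoefM big_ord_recl f0 mul1r subn0.
rewrite big1 ?addr0 // => i _; rewrite IHn ?mulr0 //.
by rewrite lift0 subnSK ?ltn_ord // leq_subr.
Qed.

Lemma fps_regI f g h : f 0%N = 1 -> f * g = f * h -> g = h.
Proof.
by move=> f0 fg; apply/subr0_eq/(fps_reg f0); rewrite mulrBr fg subrr.
Qed.

Definition vge m f := forall n, (n < m)%N -> f n = 0.

Lemma vge0 f : vge 0 f. Proof. by []. Qed.
Lemma vgeM m n f g : vge m f -> vge n g -> vge (m + n) (f * g).
Proof.
move=> vf vg i lt_i; rewrite fcoefM big1 // => j _.
have [lt_jm|le_mj] := ltnP j m; first by rewrite vf ?mul0r.
by rewrite vg ?mulr0 //; have := ltn_ord j; lia.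
Qed.
Lemma vgeMl m f g : vge m f -> vge m (f * g).
Proof. by move=> vf; rewrite -[m]addn0; apply: vgeM. Qed.
Lemma vgeMr m f g : vge m g -> vge m (f * g).
Proof. by move=> vg; rewrite mulrC; apply: vgeMl. Qed.
Lemma vge_le m n f : (n <= m)%N -> vge m f -> vge n f.
Proof. by move=> le_nm vf i lt_in; rewrite vf // (leq_trans lt_in). Qed.
Lemma vgeXn m f : vge m (fX ^+ m * f).
Proof. by move=> n lt_nm; rewrite fcoefXnM lt_nm. Qed.
Lemma vge_Xn n m : (n <= m)%N -> vge n (fX ^+ m).
Proof. by move=> le_nm i lt_in; rewrite fcoefXn ltn_eqF // (leq_trans lt_in). Qed.
Lemma vge_sum m (I : Type) (r : seq I) (P : pred I) (F : I -> fps A) :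
  (forall i, P i -> vge m (F i)) -> vge m (\sum_(i <- r | P i) F i).
Proof. by move=> vF n lt_nm; rewrite fcoef_sum big1 // => i Pi; rewrite vF. Qed.

(* Sum of a locally finite family: the coefficient of order [n] only involves the
   first [n.+1] members. *)
Definition lsum (F : nat -> fps A) : fps A := Fps (fun n => \sum_(i < n.+1) F i n).
Definition lfin (F : nat -> fps A) := forall i, vge i (F i).

Lemma fcoef_lsum F n : lsum F n = \sum_(i < n.+1) F i n. Proof. by []. Qed.

Lemma lsumE F N n : lfin F -> (n < N)%N -> lsum F n = \sum_(i < N) F i n.
Proof.
move=> lF lt_nN /=; rewrite -(subnKC lt_nN) big_split_ord /= [X in _ = _ + X]big1 ?addr0 //.
by move=> i _; rewrite lF //= ltnS leq_addr.
Qed.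

Lemma eq_lsum F G : (forall i, F i = G i) -> lsum F = lsum G.
Proof. by move=> FG; congr lsum; apply/funext. Qed.

Lemma lsumD F G : lsum (fun i => F i + G i) = lsum F + lsum G.
Proof. by apply: fpsP => n /=; rewrite -big_split. Qed.
Lemma lsumN F : lsum (fun i => - F i) = - lsum F.
Proof. by apply: fpsP => n /=; rewrite -sumrN. Qed.
Lemma lsum0 : lsum (fun=> 0) = 0.
Proof. by apply: fpsP => n /=; rewrite big1. Qed.
Lemma lsum_sum (I : Type) (r : seq I) (P : pred I) (F : I -> nat -> fps A) :
  lsum (fun i => \sum_(j <- r | P j) F j i) = \sum_(j <- r | P j) lsum (F j).
Proof.
apply: fpsP => n; rewrite fcoef_sum /= exchange_big /=.
by apply: eq_bigr => i _; rewrite fcoef_sum.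
Qed.
Lemma lsum_eu F : lsum (fun i => eu (F i)) = eu (lsum F).
Proof. by apply: fpsP => n /=; rewrite sumrMnl. Qed.

Lemma lsumMl f F : lfin F -> lsum (fun i => f * F i) = f * lsum F.
Proof.
move=> lF; apply: fpsP => n; rewrite fcoefM.
under [RHS]eq_bigr => i _ do
  rewrite (@lsumE F n.+1) ?ltnS ?leq_subr // mulr_sumr.
by rewrite exchange_big.
Qed.

Lemma lsum_recl F : lfin F -> lsum F = F 0%N + lsum (fun i => F i.+1).
Proof.
move=> lF; apply: fpsP => n; rewrite fcoefD (@lsumE F n.+2) // big_ord_recl /=.
by [].
Qed.

Lemma lsum_split m F : lfin F -> lsum F = \sum_(i < m) F i + lsum (fun i => F (m + i)%N).
Proof.
move=> lF; apply: fpsP => n; rewrite fcoefD (@lsumE F (m + n.+1)) ?addnS ?ltnS ?leq_addl //.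
by rewrite -addnS big_split_ord /= fcoef_sum.
Qed.

Lemma vge_lsum m F : (forall i, vge m (F i)) -> vge m (lsum F).
Proof. by move=> vF n lt_nm /=; rewrite big1 // => i _; rewrite vF. Qed.

Lemma lsum_exchange (F : nat -> nat -> fps A) :
  lsum (fun i => lsum (F i)) = lsum (fun j => lsum (F^~ j)).
Proof. by apply: fpsP => n /=; rewrite exchange_big. Qed.

Lemma lsum_cauchy F G : lfin F -> lfin G ->
  lsum (fun n => \sum_(i < n.+1) F i * G (n - i)%N) = lsum F * lsum G.
Proof.
move=> lF lG; apply: fpsP => n.
have -> : (lsum F * lsum G) n = \sum_(i < n.+1) \sum_(j < n.+1) (F i * G j) n.
  rewrite -lsumMl // fcoef_lsum [RHS]exchange_big; apply: eq_bigr => j _.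
  transitivity ((G j * lsum F) n); first by rewrite mulrC.
  by rewrite -lsumMl // fcoef_lsum; apply: eq_bigr => i _; rewrite mulrC.
(* By valuations [H] vanishes for i + j > n, so the square of the product and the triangle of the
   Cauchy sum carry the same total. *)
pose H i j : A := (F i * G j) n.
have vH i j : (n < i + j)%N -> H i j = 0 by move=> lt_n; apply: (vgeM (lF i) (lG j)).
transitivity (\sum_(m < n.+1) \sum_(i < n.+1 | (i <= m)%N) H i (m - i)%N).
  rewrite fcoef_lsum; apply: eq_bigr => m _; rewrite fcoef_sum.
  by rewrite (big_ord_widen n.+1 (fun i => H i (m - i)%N)) ?ltn_ord.
rewrite (exchange_big_dep predT) //=; apply: eq_bigr => i _.
rewrite [RHS](bigID (fun j : 'I_n.+1 => (i + j <= n)%N)) /= [X in _ = _ + X]big1 ?addr0; last first.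
  by move=> j; rewrite -ltnNge => /vH.
have le_in : (i <= n)%N by rewrite -ltnS.
rewrite -(big_mkord (fun m => i <= m)%N (fun m => H i (m - i)%N)).
rewrite -(big_mkord (fun j => i + j <= n)%N (fun j => H i j)).
rewrite (@big_cat_nat _ _ _ i) //= ?(leqW le_in) //.
rewrite [X in X + _]big_nat_cond [X in X + _]big_pred0 ?add0r; last first.
  by move=> m; apply/negbTE/negP => /andP[]; lia.
rewrite [RHS](@big_cat_nat _ _ _ (n.+1 - i)) ?leq_subr //=.
rewrite [X in _ = _ + X]big_nat_cond [X in _ = _ + X]big_pred0 ?addr0; last first.
  by move=> m; apply/negbTE/negP => /andP[]; lia.
rewrite -{1}[i : nat]add0n big_addn.
rewrite big_nat_cond [RHS]big_nat_cond; apply: eq_big => [m|m _]; last by rewrite addnK.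
by apply/idP/idP; lia.
Qed.

End FpsRing.
Arguments fC {A} c.

(** * Euler's q-exponentials *)

Section Zeta.
Variable K : numFieldType.
Notation Q := (fps K).
Notation q := (fX K).
Notation zeta := (fX Q).

(** The series 1/(1 - q^d) for d > 0. The factor [*+ (0 < d)] in [lambert] makes [lambert 0] vanish,
    so that [Lambert] has no constant term. *)
Definition geo d : Q := Fps (fun n => (d %| n)%:R).
Definition lambert d : Q := q ^+ d * geo d *+ (0 < d)%N.

Lemma geoE d : (0 < d)%N -> (1 - q ^+ d) * geo d = 1.
Proof.
move=> d_gt0; apply: fpsP => n; rewrite mulrBl mul1r fcoefB fcoefXnM fcoef1 /=.
have [lt_nd|le_dn] := ltnP n d.
  by rewrite subr0; case: n lt_nd => [|n] lt_nd; rewrite ?dvdn0 // gtnNdvd.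
rewrite dvdn_subl // subrr; case: n le_dn => //; rewrite leqn0 => /eqP d0.
by rewrite d0 in d_gt0.
Qed.

Lemma fcoef_lambert d n : lambert d n = ((d %| n)%N && (0 < n)%N && (0 < d)%N)%:R.
Proof.
rewrite /lambert; case: d => [|d]; first by rewrite mulr0n andbF.
rewrite mulr1n fcoefXnM /=; case: ltnP => [lt_nd|le_dn].
  by case: n lt_nd => [|n] lt_nd; rewrite ?andbF // gtnNdvd.
by rewrite dvdn_subl // (leq_trans _ le_dn) // !andbT.
Qed.

Lemma vge_lambert d : vge d (lambert d).
Proof.
move=> n lt_nd; rewrite fcoef_lambert; case: n lt_nd => [|n] lt_nd; rewrite ?andbF //.
by rewrite gtnNdvd.
Qed.

Lemma lambertE d : (0 < d)%N -> lambert d - q ^+ d * lambert d = q ^+ d.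
Proof.
move=> d_gt0; rewrite /lambert d_gt0 mulr1n.
rewrite -[X in X - _]mul1r -mulrBl mulrCA geoE ?mulr1 //.
Qed.

Definition ecoef s : Q := \prod_(i < s) geo i.+1.

Lemma ecoefS s : (1 - q ^+ s.+1) * ecoef s.+1 = ecoef s.
Proof. by rewrite /ecoef big_ord_recr /= mulrC -mulrA [geo _ * _]mulrC geoE // mulr1. Qed.

(* [1 / (zeta; q)_oo] by Euler's expansion; [eexpq] is its dilation [1 / (q zeta; q)_oo]. *)
Definition eexp : fps Q := Fps ecoef.
Definition eexpq : fps Q := sc q eexp.

Lemma eexpqE : eexpq = (1 - zeta) * eexp.
Proof.
apply: fpsP => n; rewrite mulrBl mul1r fcoefB fcoefXM /= .
case: n => [|n]; first by rewrite expr0 mul1r subr0.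
by rewrite -[in RHS](ecoefS n); ring.
Qed.

Lemma eexpq0 : eexpq 0%N = 1.
Proof. by rewrite /= /ecoef big_ord0 expr0 mulr1. Qed.

Lemma sc_fX (c : Q) : sc c zeta = fC c * zeta.
Proof.
apply: fpsP => n; rewrite fcoefCM /=.
by case: eqP => [->|]; rewrite ?mulr0 // expr1.
Qed.

Lemma sc_eexpq : sc q eexpq = (1 - fC q * zeta) * eexpq.
Proof. by rewrite {1}eexpqE rmorphM rmorphB rmorph1 /= sc_fX. Qed.

(** The coefficient of z^n in the equation reads (1 - q^n) f_n = q f_(n-1), so a solution is
    determined by its constant term. *)
Lemma sc_uniq (f : fps Q) : sc q f = (1 - fC q * zeta) * f -> f 0%N = 0 -> f = 0.
Proof.
move=> scf f0; apply: fpsP; elim=> [|n IHn]; first by [].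
have := congr1 (fun h : fps Q => h n.+1) scf.
rewrite mulrBl mul1r fcoefB -mulrA fcoefCM fcoefXM IHn mulr0 subr0 /= => /eqP.
rewrite -subr_eq0 -{2}[f n.+1]mul1r -mulrBl => /eqP /(congr1 -%R).
rewrite -mulNr opprB oppr0; apply: fps_reg.
by rewrite fcoefB fcoefXn subr0.
Qed.

(** The sum over m >= 1 of q^m z / (1 - q^m z), that is, the logarithmic derivative z d/dz of 1/(q
    z; q)_oo. *)
Definition Lambert : fps Q := Fps lambert.

Lemma sc_Lambert : (1 - fC q * zeta) * (Lambert - sc q Lambert) = fC q * zeta.
Proof.
pose h : fps Q := Fps (fun n => q ^+ n *+ (0 < n)%N).
have -> : Lambert - sc q Lambert = h.
  apply: fpsP => -[|n]; rewrite fcoefB /= ?mulr0n /lambert ?mulr0n ?mulr0 ?subr0 //.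
  by rewrite (@lambertE n.+1).
apply: fpsP => n; rewrite mulrBl mul1r fcoefB -mulrA !fcoefCM fcoefXM /=.
case: n => [|[|n]] /=; rewrite ?mulr0n ?mulr1n ?mulr0 ?subr0 ?expr1 ?mulr1 //.
by rewrite -exprS subrr.
Qed.

(** The difference of the two sides solves the q-difference equation of [eexpq] and has no constant
    term. *)
Lemma eu_eexpq : eu eexpq = Lambert * eexpq.
Proof.
apply/subr0_eq/sc_uniq; last first.
  by rewrite fcoefB fcoefM0 /= /lambert mulr0n mul0r subrr.
rewrite rmorphB rmorphM /= sc_eexpq -eu_sc sc_eexpq euM raddfB /= eu1 euCM /=.
have -> : eu zeta = zeta by apply: fpsP => -[|[|n]] //=; rewrite mul0rn.
have := sc_Lambert; set L := sc q Lambert; set y := fC q * zeta => scL.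
have -> : (0 - y) * eexpq + (1 - y) * eu eexpq - L * ((1 - y) * eexpq) =
  (1 - y) * (eu eexpq - Lambert * eexpq) + ((1 - y) * (Lambert - L) - y) * eexpq by ring.
by rewrite scL subrr mul0r addr0.
Qed.

Definition Ecoef s : Q := (-1) ^+ s * q ^+ 'C(s, 2) * ecoef s.
(* [(zeta; q)_oo] by Euler's other expansion. *)
Definition Eexp : fps Q := Fps Ecoef.
Definition Eexpq : fps Q := sc q Eexp.

Lemma EcoefS s : Ecoef s.+1 - q ^+ s.+1 * Ecoef s.+1 = - (q ^+ s * Ecoef s).
Proof.
rewrite -{1}[Ecoef _]mul1r -mulrBl {1}/Ecoef mulrCA ecoefS /Ecoef.
by rewrite (binS s) bin1 exprD exprS; ring.
Qed.

Lemma Eexp_Eexpq : Eexp = (1 - zeta) * Eexpq.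
Proof.
apply: fpsP => n; rewrite mulrBl mul1r fcoefB fcoefXM /=.
case: n => [|n]; first by rewrite expr0 mul1r subr0.
by apply/eqP; rewrite -subr_eq0 -(opprK (_ * Ecoef n)) -EcoefS; apply/eqP; ring.
Qed.

Lemma Eexpq0 : Eexpq 0%N = 1.
Proof. by rewrite /= /Ecoef bin0n /= expr0 expr0 !mul1r /ecoef big_ord0. Qed.

Lemma sc_Eexpq : Eexpq = (1 - fC q * zeta) * sc q Eexpq.
Proof. by rewrite {1}/Eexpq Eexp_Eexpq rmorphM rmorphB rmorph1 /= sc_fX. Qed.

(** The product is invariant under z -> q z, so only its constant term survives. *)
Lemma eexpq_Eexpq : eexpq * Eexpq = 1.
Proof.
have E : sc q (eexpq * Eexpq) = eexpq * Eexpq.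
  by rewrite rmorphM /= sc_eexpq {2}sc_Eexpq; ring.
apply: fpsP => -[|n]; first by rewrite fcoefM0 eexpq0 Eexpq0 mulr1.
have : q ^+ n.+1 * (eexpq * Eexpq) n.+1 = (eexpq * Eexpq) n.+1.
  exact: (congr1 (fun h : fps Q => h n.+1) E).
set x := (eexpq * Eexpq) n.+1 => /eqP; rewrite -subr_eq0 -{2}[x]mul1r -mulrBl => /eqP /(congr1 -%R).
rewrite -mulNr opprB oppr0; apply: fps_reg.
by rewrite fcoefB fcoefXn subr0.
Qed.

Lemma eu_Eexpq : eu Eexpq = - Lambert * Eexpq.
Proof.
have := congr1 (@eu Q) eexpq_Eexpq; rewrite euM eu1 eu_eexpq => /(congr1 ( *%R Eexpq)).
have := eexpq_Eexpq; move: (eu Eexpq) => x E.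
have -> : Eexpq * (Lambert * eexpq * Eexpq + eexpq * x) = Lambert * Eexpq * (eexpq * Eexpq) + x * (eexpq * Eexpq) by ring.
by rewrite E !mulr1 mulr0 addrC => /eqP; rewrite addr_eq0 mulNr => /eqP.
Qed.

Lemma vge_Eexpq m : vge m (Eexpq m). Proof. exact: vgeXn. Qed.

(** The coefficient of z^m in (q z; q)_oo (1/z; q)_oo. The next two lemmas are Jacobi's triple
    product, with [Ecorr 0] standing for 1/(q; q)_oo. *)
Definition Ecorr m : Q := lsum (fun s => Eexpq (m + s)%N * Eexp s).

(** This is the quasi-periodicity of the triple product under z -> q z: the recursion of (q z; q)_oo
    is applied to the first factor and, after a shift of s, that of (z; q)_oo to the second. *)
Lemma EcorrS m : Ecorr m.+1 = - q ^+ m.+1 * Ecorr m.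
Proof.
pose T s := Eexpq (m.+1 + s)%N * (q ^+ s * Eexp s).
have lT : lfin T.
  by move=> i; apply/vgeMl/(@vge_le _ (m.+1 + i)) => //; [lia|apply: vge_Eexpq].
have lG j : lfin (fun s => Eexpq (j + s)%N * Eexp s).
  by move=> i; apply/vgeMl/(@vge_le _ (j + i)) => //; [lia|apply: vge_Eexpq].
have EexpqS n : Eexpq n.+1 = q ^+ n.+1 * (Eexpq n.+1 - Eexpq n).
  have := congr1 (fun h : fps Q => h n.+1) sc_Eexpq.
  rewrite mulrBl mul1r fcoefB -mulrA fcoefCM fcoefXM => E; rewrite {1}E.
  by rewrite !fcoef_sc exprS; ring.
have E1 : Ecorr m.+1 = q ^+ m.+1 * (lsum T - lsum (fun s => Eexpq (m + s)%N * (q ^+ s * Eexp s))).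
  rewrite -lsumN -lsumD -lsumMl; last first.
    move=> i; apply: vge_le (leqnn _) _ => n lt_n; rewrite fcoefD fcoefN lT // sub0r.
    rewrite (@vgeMl _ (m + i)) ?oppr0 //; last by lia.
    exact: vge_Eexpq.
  by apply: eq_lsum => s; rewrite /T addSn {1}EexpqS !exprS exprD; ring.
rewrite E1 {E1}.
suff -> : lsum (fun s => Eexpq (m + s)%N * (q ^+ s * Eexp s)) = Ecorr m + lsum T by ring.
rewrite /Ecorr (lsum_recl (lG m)).
rewrite lsum_recl; last first.
  by move=> i; apply/vgeMl/(@vge_le _ (m + i)) => //; [lia|apply: vge_Eexpq].
rewrite expr0 mul1r -addrA; congr (_ + _); rewrite -lsumD; apply: eq_lsum => s.
rewrite /T addnS addSn -mulrDr; congr (_ * _).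
have E := EcoefS s; rewrite /=; apply/subr0_eq.
by rewrite -(subrr (Ecoef s.+1 - q ^+ s.+1 * Ecoef s.+1)) {1}E; ring.
Qed.

Lemma EcorrE m : Ecorr m = (-1) ^+ m * q ^+ 'C(m.+1, 2) * Ecorr 0.
Proof.
elim: m => [|m IHm]; first by rewrite bin_small // !expr0 !mul1r.
by rewrite EcorrS IHm (binS m.+1) bin1 exprD !exprS; ring.
Qed.

Definition geomz : fps Q := Fps (fun=> 1).

Lemma geomzE : (1 - zeta) * geomz = 1.
Proof.
apply: fpsP => -[|n]; rewrite mulrBl mul1r fcoefB fcoefXM /= ?subr0 //.
by rewrite subrr.
Qed.

Lemma geomz_exp B n : (geomz ^+ B.+1) n = ('C(n + B, B))%:R.
Proof.
elim: B n => [|B IHB] n; first by rewrite expr1 addn0 bin0.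
elim: n => [|n IHn]; first by rewrite fcoefX0 expr1n add0n binn.
have : geomz ^+ B.+2 - zeta * geomz ^+ B.+2 = geomz ^+ B.+1.
  by rewrite -{1}[_ ^+ _]mul1r -mulrBl [geomz ^+ B.+2]exprS mulrA geomzE mul1r.
move=> /(congr1 (fun h : fps Q => h n.+1)); rewrite fcoefB fcoefXM IHn IHB.
by move=> /eqP; rewrite subr_eq -natrD addnS addSn binS addnC addnS => /eqP ->.
Qed.

(** * The powers (z; q)_oo^(-b) and (q z; q)_oo^(-b) *)

Section Power.
Variable B : nat.
Notation b := B.+1.

Definition eexpn : fps Q := eexp ^+ b.
Definition eexpqn : fps Q := eexpq ^+ b.

Lemma eexpqnE : eexpqn = sc q eexpn. Proof. by rewrite /eexpqn /eexpq rmorphXn. Qed.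
Lemma eexpqn_coef s : eexpqn s = q ^+ s * eexpn s. Proof. by rewrite eexpqnE. Qed.
Lemma eexpn_eexpqn : eexpn = geomz ^+ b * eexpqn.
Proof. by rewrite /eexpn /eexpqn eexpqE exprMn mulrA -exprMn [geomz * _]mulrC geomzE expr1n mul1r. Qed.
Lemma eexpn_coef n : eexpn n = \sum_(r < n.+1) 'C(n - r + B, B)%:R * eexpqn r.
Proof.
have E : eexpn = eexpqn * geomz ^+ b by rewrite eexpn_eexpqn; exact: mulrC.
rewrite E fcoefM; apply: eq_bigr => i _.
apply: (etrans (congr1 ( *%R (eexpqn i)) (geomz_exp B (n - i)))); exact: mulrC.
Qed.
Lemma vge_eexpqn m : vge m (eexpqn m). Proof. by rewrite eexpqn_coef; apply: vgeXn. Qed.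
Lemma eexpqn0 : eexpqn 0%N = 1. Proof. by rewrite fcoefX0 eexpq0 expr1n. Qed.
Lemma eu_eexpqn : eu eexpqn = (Lambert *+ b) * eexpqn.
Proof. by rewrite /eexpqn euX eu_eexpq /= exprS mulrnAl; congr (_ *+ _); ring. Qed.
End Power.
End Zeta.

(** * Subalgebras and moments *)

Section Subalgebra.
Variable K : numFieldType.
Notation Q := (fps K).

Definition fsubalg (P : Q -> Prop) := [/\ forall c, P (fC c),
  forall f g, P f -> P g -> P (f + g) & forall f g, P f -> P g -> P (f * g)].

Section Closure.
Variable P : Q -> Prop.
Hypothesis PA : fsubalg P.

Lemma fsubalgC c : P (fC c). Proof. by case: PA => PC _ _; apply: PC. Qed.
Lemma fsubalg0 : P 0. Proof. by rewrite -(rmorph0 fC); apply: fsubalgC. Qed.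
Lemma fsubalg1 : P 1. Proof. by rewrite -(rmorph1 fC); apply: fsubalgC. Qed.
Lemma fsubalgD f g : P f -> P g -> P (f + g). Proof. by case: PA => _ PD _; apply: PD. Qed.
Lemma fsubalgM f g : P f -> P g -> P (f * g). Proof. by case: PA => _ _ PM; apply: PM. Qed.
Lemma fsubalgN f : P f -> P (- f).
Proof.
move=> Pf; have -> : - f = fC (-1) * f by rewrite rmorphN rmorph1 mulN1r.
by apply: fsubalgM => //; apply: fsubalgC.
Qed.
Lemma fsubalgB f g : P f -> P g -> P (f - g).
Proof. by move=> Pf Pg; apply: fsubalgD => //; apply: fsubalgN. Qed.
Lemma fsubalgDI f g : P (f + g) -> P g -> P f.
Proof. by move=> Pfg Pg; rewrite -(addrK g f); apply: fsubalgB. Qed.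
Lemma fsubalg_sum (I : Type) (r : seq I) (p : pred I) (F : I -> Q) :
  (forall i, p i -> P (F i)) -> P (\sum_(i <- r | p i) F i).
Proof. by move=> PF; elim/big_ind: _ => //; [apply: fsubalg0 | apply: fsubalgD]. Qed.
Lemma fsubalgMn f n : P f -> P (f *+ n).
Proof. by move=> Pf; rewrite -mulr_natr -(rmorph_nat fC); apply: fsubalgM => //; apply: fsubalgC. Qed.
Lemma fsubalgCM c f : P f -> P (fC c * f).
Proof. by move=> Pf; apply: fsubalgM => //; apply: fsubalgC. Qed.
Lemma fsubalgCMI c f : c != 0 -> P (fC c * f) -> P f.
Proof.
move=> c0 /(fsubalgCM c^-1); rewrite mulrA -rmorphM mulVf // rmorph1 mul1r //.
Qed.
Lemma fsubalgMnI n f : (0 < n)%N -> P (f *+ n) -> P f.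
Proof.
move=> n0; rewrite -mulr_natl -(rmorph_nat fC); apply: fsubalgCMI.
by rewrite pnatr_eq0 -lt0n.
Qed.

(** The recursion n E_n = c sum_i T_i E_(n-i) leaves the subalgebra only through the factor E_0,
    which is therefore kept apart. This is how square moments become a common factor times
    polynomials in Eisenstein series. *)
Lemma logder_coef (E T : fps Q) (c : K) :
  (forall n, P (T n)) -> T 0%N = 0 -> eu E = fC (fC c) * T * E ->
  exists e : nat -> Q, [/\ forall n, P (e n), e 0%N = 1 & forall n, E n = E 0%N * e n].
Proof.
move=> PT T0 dE.
have /choice[e He] : forall n, exists f, P f /\ E n = E 0%N * f.
  elim/ltn_ind => n; move: n => [|n] IHn; first by exists 1; rewrite mulr1; split=> //; apply: fsubalg1.
  have /choice[e He] : forall i : 'I_n.+1, exists f, P f /\ E i = E 0%N * f by move=> i; apply: IHn.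
  exists (fC (c / n.+1%:R) * \sum_(i < n.+1) T i.+1 * e (rev_ord i)); split.
    by apply: fsubalgCM; apply: fsubalg_sum => i _; apply: fsubalgM => //; case: (He (rev_ord i)).
  have := congr1 (fun h : fps Q => h n.+1) dE.
  rewrite fcoef_eu -mulrA fcoefCM fcoefM big_ord_recl T0 mul0r add0r => dEn.
  have -> : E n.+1 = fC n.+1%:R^-1 * (E n.+1 *+ n.+1).
    rewrite -[X in _ * X]mulr_natl -(rmorph_nat fC) mulrA -rmorphM mulVf ?pnatr_eq0 // rmorph1 mul1r //.
  rewrite dEn [LHS]mulrA -rmorphM [RHS]mulrCA [n.+1%:R^-1 * c]mulrC; congr (_ * _).
  rewrite mulr_sumr; apply: eq_bigr => i _.
  have [_] := He (rev_ord i); rewrite lift0 subSS [nat_of_ord (rev_ord i)]/= subSS => ->.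
  by ring.
exists (fun n => if n is 0 then 1 else e n); split=> // -[|n]; rewrite ?mulr1 //.
- exact: fsubalg1.
- by case: (He n.+1).
- by case: (He n.+1).
Qed.

End Closure.
End Subalgebra.

(** * Moments of coefficient sequences and the substitution z = e^t *)

Section Moments.
Variable K : numFieldType.
Notation Q := (fps K).
Notation q := (fX K).

(** The growth condition under which w(e^t) converges q-adically. *)
Definition vseq (w : fps Q) := forall s, vge s (w s).

Lemma vseqM w v : vseq w -> vseq v -> vseq (w * v).
Proof.
move=> vw vv s; rewrite fcoefM; apply: vge_sum => i _.
by apply: (@vge_le _ (i + (s - i))); [have := ltn_ord i; lia | apply: vgeM].
Qed.

Lemma lfin_conv (F G : nat -> Q) : lfin F -> lfin G ->
  lfin (fun n => \sum_(i < n.+1) F i * G (n - i)%N).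
Proof. by move=> lF lG s; apply: (@vseqM (Fps F) (Fps G)). Qed.

Definition mom (w : fps Q) i : Q := lsum (fun s => fC (s%:R ^+ i) * w s).
(** This is w(e^t) as a series in t; [egfM] and [eu_egf] are the product rule and the chain rule of
    that substitution. *)
Definition egf (w : fps Q) : fps Q := Fps (fun i => fC (i`!%:R^-1) * mom w i).

Lemma lfinC (F : nat -> Q) (c : nat -> Q) : lfin F -> lfin (fun i => c i * F i).
Proof. by move=> lF i; apply: vgeMr. Qed.

Lemma fact_neq0 n : n`!%:R != 0 :> K.
Proof. by rewrite pnatr_eq0 -lt0n fact_gt0. Qed.

Lemma egfM w v : vseq w -> vseq v -> egf (w * v) = egf w * egf v.
Proof.
move=> vw vv; apply: fpsP => n; rewrite fcoefM /=.
have -> : mom (w * v) n = \sum_(i < n.+1) fC 'C(n, i)%:R * (mom w (n - i) * mom v i).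
  have E i : fC 'C(n, i)%:R * (mom w (n - i) * mom v i) = lsum (fun s =>
      fC 'C(n, i)%:R * \sum_(j < s.+1) (fC (j%:R ^+ (n - i)) * w j) *
                                       (fC ((s - j)%N%:R ^+ i) * v (s - j)%N)).
    pose F j := fC (j%:R ^+ (n - i)) * w j; pose G j := fC (j%:R ^+ i) * v j.
    have lF : lfin F by apply: lfinC vw.
    have lG : lfin G by apply: lfinC vv.
    by rewrite (lsumMl _ (lfin_conv lF lG)) (lsum_cauchy lF lG).
  under eq_bigr => i _ do rewrite E.
  rewrite -lsum_sum; apply: eq_lsum => s; rewrite fcoefM.
  under [RHS]eq_bigr => i _ do rewrite mulr_sumr.
  rewrite mulr_sumr exchange_big /=; apply: eq_bigr => l _.
  have -> : s%:R = l%:R + (s - l)%N%:R :> K by rewrite -natrD subnKC // -ltnS.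
  rewrite exprDn rmorph_sum mulr_suml; apply: eq_bigr => i _ /=.
  by rewrite rmorphMn rmorphM rmorph_nat /= -mulr_natr; ring.
rewrite mulr_sumr (reindex_inj rev_ord_inj) /=; apply: eq_bigr => i _.
have le_in : (i <= n)%N by rewrite -ltnS.
rewrite subSS subKn // bin_sub // [LHS]mulrA -rmorphM.
transitivity (fC (i`!%:R^-1 / (n - i)`!%:R) * (mom w i * mom v (n - i))).
  congr (fC _ * _); rewrite -(bin_fact le_in) !natrM.
  have := fact_neq0 i; have := fact_neq0 (n - i).
  have : 'C(n, i)%:R != 0 :> K by rewrite pnatr_eq0 -lt0n bin_gt0.
  by move=> h1 h2 h3; field; rewrite h1 h2 h3.
by rewrite rmorphM /=; ring.
Qed.

Lemma eu_egf w : eu (egf w) = fX Q * egf (eu w).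
Proof.
apply: fpsP => -[|n]; rewrite fcoefXM fcoef_eu ?mulr0n //= /mom.
have -> : n`!%:R^-1 = n.+1`!%:R^-1 *+ n.+1 :> K.
  by rewrite -[RHS]mulr_natl factS natrM invfM mulrA mulfV ?mul1r ?pnatr_eq0.
rewrite raddfMn /= -mulrnAl.
congr (_ * _); apply: eq_lsum => s.
by rewrite -[w s *+ s]mulr_natl -(rmorph_nat fC) exprSr rmorphM /= mulrA.
Qed.

Variable w : fps Q.
Hypothesis vw : vseq w.

(** The product w(e^t) w(e^(-t)), the generating series of the square moments (see [mom2_exp]). *)
Definition egf2 : fps Q := egf w * sc (-1) (egf w).

(** The series t (L(e^t) - L(e^(-t))). Only odd moments of L survive; for L = [Lambert] they are
    Eisenstein series without their constant terms. *)
Definition Teven (L : fps Q) : fps Q := fX Q * (egf L - sc (-1) (egf L)).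

Lemma TevenE L i : Teven L i.+1 = fC ((1 - (-1) ^+ i) / i`!%:R) * mom L i.
Proof.
have -> : fC ((1 - (-1) ^+ i) / i`!%:R : K) = fC i`!%:R^-1 - (-1) ^+ i * fC i`!%:R^-1.
  by rewrite mulrBl mul1r rmorphB rmorphM rmorphXn rmorphN rmorph1.
by rewrite fcoefXM fcoefB fcoef_sc /=; ring.
Qed.
Lemma Teven0 L : Teven L 0%N = 0. Proof. exact: fcoefXM. Qed.

Lemma eu_egf2 L c : vseq L -> eu w = fC (fC c) * L * w ->
  eu egf2 = fC (fC c) * Teven L * egf2.
Proof.
move=> vL dw.
have egfC v : vseq v -> egf (fC (fC c) * v) = fC (fC c) * egf v.
  move=> vv; apply: fpsP => n; rewrite fcoefCM /= mulrCA; congr (_ * _).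
  rewrite /mom -lsumMl; last exact: lfinC.
  by apply: eq_lsum => s; rewrite fcoefCM; ring.
have dwe : eu (egf w) = fX Q * (fC (fC c) * (egf L * egf w)).
  by rewrite eu_egf dw -mulrA egfC ?egfM //; apply: vseqM.
rewrite /egf2 euM eu_sc dwe !rmorphM /= /Teven.
have -> : sc (-1) (fX Q) = - fX Q by rewrite sc_fX rmorphN rmorph1 mulN1r.
have -> : sc (-1) (fC (fC c)) = fC (fC c) :> fps Q.
  by apply: fpsP => -[|n] /=; rewrite ?mul1r ?mulr0.
ring.
Qed.
End Moments.

(** * Double sums weighted by products of two coefficients *)

Section DoubleMoments.
Variable K : numFieldType.
Notation Q := (fps K).
Notation q := (fX K).
Variable w : fps Q.
Hypothesis vw : vseq w.

Definition mom2 (F : nat -> nat -> K) : Q :=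
  lsum (fun r => lsum (fun s => fC (F r s) * (w r * w s))).

Lemma eq_mom2 F G : (forall r s, F r s = G r s) -> mom2 F = mom2 G.
Proof. by move=> FG; apply: eq_lsum => r; apply: eq_lsum => s; rewrite FG. Qed.

Lemma mom2D F G : mom2 (fun r s => F r s + G r s) = mom2 F + mom2 G.
Proof.
rewrite /mom2 -lsumD; apply: eq_lsum => r; rewrite -lsumD; apply: eq_lsum => s.
by rewrite rmorphD mulrDl.
Qed.

Lemma lfin_ww r (F : nat -> K) : lfin (fun s => fC (F s) * (w r * w s)).
Proof. by move=> s; apply/vgeMr/vgeMr. Qed.

Lemma lfin_mom2 (F : nat -> nat -> K) :
  lfin (fun r => lsum (fun s => fC (F r s) * (w r * w s))).
Proof. by move=> r; apply: vge_lsum => s; apply/vgeMr/vgeMl. Qed.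

Lemma mom2Z c F : mom2 (fun r s => c * F r s) = fC c * mom2 F.
Proof.
rewrite /mom2 -lsumMl; last exact: lfin_mom2.
apply: eq_lsum => r; rewrite -lsumMl; last exact: lfin_ww.
by apply: eq_lsum => s; rewrite rmorphM [RHS]mulrA.
Qed.

Lemma mom2_sum (I : Type) (x : seq I) (P : pred I) (F : I -> nat -> nat -> K) :
  mom2 (fun r s => \sum_(i <- x | P i) F i r s) = \sum_(i <- x | P i) mom2 (F i).
Proof.
rewrite /mom2 -lsum_sum; apply: eq_lsum => r; rewrite -lsum_sum; apply: eq_lsum => s.
by rewrite rmorph_sum mulr_suml.
Qed.

Lemma mom2_swap F : mom2 F = mom2 (fun r s => F s r).
Proof.
rewrite /mom2 lsum_exchange.
by apply: eq_lsum => r; apply: eq_lsum => s; rewrite [w s * _]mulrC.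
Qed.

Lemma momM i j : mom w i * mom w j = mom2 (fun r s => r%:R ^+ i * s%:R ^+ j).
Proof.
rewrite mulrC -lsumMl; last exact: lfinC.
apply: eq_lsum => r; rewrite mulrC -lsumMl; last exact: lfinC.
by apply: eq_lsum => s; rewrite rmorphM; ring.
Qed.

Lemma mom2_exp l : mom2 (fun r s => (r%:R - s%:R) ^+ l) = fC l`!%:R * egf2 w l.
Proof.
under eq_mom2 => r s do rewrite exprBn.
rewrite mom2_sum /egf2 mulrC [_ * fC _]mulrC [egf w * _]mulrC fcoefM mulr_sumr.
apply: eq_bigr => i _; have le_il : (i <= l)%N by rewrite -ltnS.
under eq_mom2 => r s do rewrite -mulr_natr mulrC !mulrA -[_ * _ * _]mulrA.
rewrite mom2Z -momM fcoef_sc /= -(bin_fact le_il) !natrM.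
transitivity (fC ('C(l, i)%:R * (-1) ^+ i) * (fC (i`!%:R / i`!%:R * ((l - i)`!%:R / (l - i)`!%:R))
   * (mom w (l - i) * mom w i))).
  by rewrite !divff ?fact_neq0 // mulr1 rmorph1 mul1r.
by rewrite !rmorphM rmorphXn rmorphN rmorph1 /=; ring.
Qed.

Definition mom2p (p : {poly K}) : Q := \sum_(i < size p) fC (p`_i * i`!%:R) * egf2 w i.

Lemma mom2_horner (p : {poly K}) : mom2 (fun r s => p.[r%:R - s%:R]) = mom2p p.
Proof.
under eq_mom2 => r s do rewrite horner_coef.
rewrite mom2_sum; apply: eq_bigr => i _.
by rewrite mom2Z mom2_exp mulrA rmorphM.
Qed.

End DoubleMoments.

(** * The polynomial of partial fraction coefficients *)

Section Varpi.
Variable K : numFieldType.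
Variable B : nat.
Notation b := B.+1.
Notation hb := (b%:R / 2 : K).

Lemma prod_binS n : \prod_(i < B) (n%:R + i.+1%:R) = ('C(n + B, B) * B`!)%:R :> K.
Proof.
elim: B => [|m IHm]; first by rewrite big_ord0 bin0 mul1n.
rewrite big_ord_recr /= IHm -natrD -natrM; congr (_%:R).
have E := mul_bin_diag (n + m).+1 m; rewrite addnS factS [RHS]mulnA.
by rewrite [X in _ = (X * _)%N]mulnC -E mulnAC [X in _ = (X * _)%N]mulnC.
Qed.

(** The polynomial n -> C(n + B, B), moved by b/2 so that its roots are symmetric about 0; it is
    even when B is. *)
Definition varpi : {poly K} :=
  B`!%:R^-1 *: \prod_(i < B) ('X + (i.+1%:R - hb)%:P).

Lemma varpiE h : varpi.[h] = B`!%:R^-1 * \prod_(i < B) (h - hb + i.+1%:R).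
Proof.
rewrite hornerZ horner_prod; congr (_ * _); apply: eq_bigr => i _.
by rewrite hornerD hornerX hornerC; ring.
Qed.

Lemma size_varpi : size varpi = b.
Proof.
rewrite size_scale ?invr_eq0 ?fact_neq0 //.
have -> : \prod_(i < B) ('X + (i.+1%:R - hb)%:P) = \prod_(i < B) ('X - (hb - i.+1%:R)%:P).
  by apply: eq_bigr => i _; rewrite -polyCN opprB.
by rewrite size_prod_XsubC /index_enum -enumT size_enum_ord.
Qed.

Lemma varpi_lead : varpi`_B = B`!%:R^-1.
Proof.
have -> : varpi`_B = lead_coef varpi by rewrite lead_coefE size_varpi.
rewrite lead_coefZ (_ : lead_coef _ = 1) ?mulr1 //; apply/monicP/monic_prod => i _.
by rewrite -(opprK (_ - hb)) polyCN monicXsubC.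
Qed.

Hypothesis evB : ~~ odd B.

Lemma varpiN h : varpi.[- h] = varpi.[h].
Proof.
rewrite !varpiE; congr (_ * _).
rewrite (reindex_inj rev_ord_inj) /=.
transitivity (\prod_(i < B) (- (h - hb + i.+1%:R))).
  apply: eq_bigr => i _; rewrite -subSn // subSS natrB //; first by rewrite -[b%:R]natr1; field.
  by rewrite ltnW.
by rewrite prodrN card_ord -signr_odd (negbTE evB) mul1r.
Qed.

Lemma varpi_odd i : odd i -> varpi`_i = 0.
Proof.
move=> oddi; have E : varpi \Po (- 'X) = varpi.
  apply/eqP; rewrite -subr_eq0; apply/eqP/polyP => j.
  set p := _ - _; suff -> : p = 0 by [].
  (* The difference vanishes at every integer, in particular at more points than its degree
     allows. *)
  apply: (@roots_geq_poly_eq0 _ p [seq n%:R | n <- iota 0 (size p)]).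
  - apply/allP => _ /mapP[n _ ->]; rewrite /root hornerD hornerN horner_comp.
    by rewrite !(hornerN, hornerX) varpiN subrr.
  - by rewrite map_inj_uniq ?iota_uniq // => m n /eqP; rewrite eqr_nat => /eqP.
  - by rewrite size_map size_iota.
have /(congr1 (fun p : {poly K} => p`_i)) := E.
have -> : (varpi \Po (- 'X))`_i = - varpi`_i.
  have [lt_i|le_i] := ltnP i (size varpi); last first.
    by rewrite E nth_default ?oppr0.
  rewrite coef_comp_poly (bigD1 (Ordinal lt_i)) //= big1 ?addr0 => [|j ne_ji].
    by rewrite exprNn -signr_odd oddi mulN1r coefN coefXn eqxx mulrN1.
  rewrite exprNn -signr_odd mulr_sign; have ne : (i == j :> nat) = false.
    by apply/negbTE; rewrite eq_sym; exact: ne_ji.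
  by case: (odd j); rewrite ?coefN coefXn ne ?oppr0 mulr0.
by move/eqP; rewrite eq_sym -addr_eq0 -mulr2n mulrn_eq0 => /eqP.
Qed.

(** With the next two lemmas: on shifted integers [varpi] is the binomial on one side, its mirror
    image on the other, and zero on the gap of B integers in between, where the roots lie. *)
Lemma varpi_ge x y : (y <= x)%N -> varpi.[x%:R - y%:R + hb] = 'C(x - y + B, B)%:R.
Proof.
move=> le_yx; by rewrite varpiE -natrB // addrK prod_binS natrM mulrC mulfK ?fact_neq0.
Qed.

Lemma varpi_le x y : (x + b <= y)%N ->
  varpi.[x%:R - y%:R + hb] = 'C(y - (x + b) + B, B)%:R.
Proof.
move=> le_xy; rewrite -varpiN -varpi_ge //; congr (_.[_]).
by rewrite natrD; field.
Qed.

Lemma varpi_mid x y : (x < y)%N -> (y < x + b)%N -> varpi.[x%:R - y%:R + hb] = 0.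
Proof.
move=> lt_xy lt_yx; rewrite varpiE.
have lt_i : ((y - x).-1 < B)%N by move: lt_xy lt_yx; lia.
rewrite (bigD1 (Ordinal lt_i)) //= prednK ?subn_gt0 // natrB; last exact: ltnW.
by rewrite addrK addrC subrKA subrr mul0r mulr0.
Qed.

End Varpi.

Section QuadraticExponents.
Variable B : nat.
Notation b := B.+1.

(** The exponent accumulated after n uses of the step M -> M + b: the sum of M + b i over 1 <= i <=
    n. *)
Definition Gexp M n : nat := (n * M + b * 'C(n.+1, 2))%N.

Lemma GexpS M n : Gexp M n.+1 = (M + b * n.+1 + Gexp M n)%N.
Proof. by rewrite /Gexp (binS n.+1) bin1; lia. Qed.

Lemma leq_Gexp M n : (n <= Gexp M n)%N.
Proof. by elim: n => // n IHn; rewrite GexpS; lia. Qed.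

End QuadraticExponents.

(** * Pairings of (q z; q)_oo^(-b) with (z; q)_oo^(-b) as partial theta series *)

Section PartialFractions.
Variable K : numFieldType.
Notation Q := (fps K).
Notation q := (fX K).
Variable B : nat.
Hypothesis evB : ~~ odd B.
Notation b := B.+1.
Notation hb := (b%:R / 2 : K).
Notation vp := (varpi K B).

(** These stand for (q z; q)_oo^(-b) and (z; q)_oo^(-b); the hypotheses are the relations between
    their coefficients that the pairing argument uses. *)
Variables u a : fps Q.
Hypothesis vu : vseq u.
Hypothesis u0 : u 0%N = 1.
Hypothesis u_a : forall s, u s = q ^+ s * a s.
Hypothesis a_u : forall n, a n = \sum_(r < n.+1) 'C(n - r + B, B)%:R * u r.

Lemma lsum_fin m (F : nat -> Q) : lfin F -> (forall i, (m <= i)%N -> F i = 0) ->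
  lsum F = \sum_(i < m) F i.
Proof.
move=> lF F0; rewrite (lsum_split m lF) [X in _ + X](_ : _ = 0) ?addr0 //.
by rewrite -(lsum0 K); apply: eq_lsum => i; rewrite F0 // leq_addr.
Qed.

Lemma mom_coef0 : (mom u 0 : Q) 0%N = 1.
Proof. by rewrite fcoef_lsum big_ord1 fcoefCM u0 fcoef1 expr0 mul1r. Qed.

Lemma egf2_coef0 : egf2 u 0%N 0%N = 1.
Proof.
have E : egf u 0%N 0%N = 1.
  have -> : egf u 0%N = fC (0`!%:R^-1) * mom u 0 by [].
  by rewrite fact0 invr1 fcoefCM mom_coef0 mulr1.
by rewrite /egf2 fcoefM0 fcoef_sc expr0 mul1r fcoefM0 E mulr1.
Qed.

Lemma egf2_odd i : odd i -> egf2 u i = 0.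
Proof.
move=> oddi; have E : sc (-1) (egf2 u) = egf2 u.
  rewrite /egf2 rmorphM /= mulrC; congr (_ * _); apply: fpsP => n.
  by rewrite !fcoef_sc mulrA -exprMn mulrNN mulr1 expr1n mul1r.
have := congr1 (fun f : fps Q => f i) E; rewrite fcoef_sc -signr_odd oddi mulN1r.
move=> /eqP; rewrite eq_sym -addr_eq0 -mulr2n => /eqP E2; apply: fpsP => n.
have := congr1 (fun f : Q => f n) E2; rewrite fcoefMn => /eqP.
by rewrite mulrn_eq0 => /eqP.
Qed.

Definition Ppoly (c : K) : Q := mom2 u (fun r s => vp.[c + s%:R - r%:R]).

Definition Ppolyc l : Q :=
  \sum_(j < b | (l <= j)%N) fC (vp`_j * 'C(j, l)%:R * (j - l)`!%:R) * egf2 u (j - l)%N.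

Lemma PpolycE c : Ppoly c = \sum_(l < b) fC (c ^+ l) * Ppolyc l.
Proof.
have E j l : (l <= j)%N -> mom2 u (fun r s => c ^+ l * (s%:R - r%:R) ^+ (j - l)) =
    fC (c ^+ l) * (fC (j - l)`!%:R * egf2 u (j - l)%N).
  by move=> le_lj; rewrite mom2Z // mom2_swap // mom2_exp.
rewrite /Ppoly; under eq_mom2 => r s do rewrite horner_coef size_varpi.
rewrite mom2_sum; under [RHS]eq_bigr => l _ do rewrite mulr_sumr.
rewrite (exchange_big_dep predT) //=; apply: eq_bigr => j _.
rewrite mom2Z //; under eq_mom2 => r s do rewrite -addrA addrC exprDn.
rewrite mom2_sum (big_ord_widen_cond b predT
  (fun i => mom2 u (fun r s => (s%:R - r%:R) ^+ (j - i) * c ^+ i *+ 'C(j, i)))) //.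
rewrite mulr_sumr; apply: eq_big => // l; rewrite ltnS => le_lj.
have -> : mom2 u (fun r s => (s%:R - r%:R) ^+ (j - l) * c ^+ l *+ 'C(j, l)) =
   fC 'C(j, l)%:R * mom2 u (fun r s => c ^+ l * (s%:R - r%:R) ^+ (j - l)).
  by rewrite -mom2Z //; apply: eq_mom2 => r s; rewrite mulr_natl mulrC.
by rewrite E // !rmorphM /=; ring.
Qed.

(** For odd l, one of j and j - l is odd: either the coefficient of the even polynomial [vp] or the
    square moment vanishes. *)
Lemma Ppolyc_odd l : odd l -> Ppolyc l = 0.
Proof.
move=> oddl; apply: big1 => j le_lj; have [oddj|evj] := boolP (odd j).
  by rewrite varpi_odd // !mul0r rmorph0 mul0r.
by rewrite egf2_odd ?mulr0 // oddB // oddl addbT.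
Qed.

Lemma Ppolyc_lead : Ppolyc B = fC B`!%:R^-1 * egf2 u 0%N.
Proof.
rewrite /Ppolyc big_mkcond big_ord_recr /= leqnn big1 ?add0r.
  by rewrite varpi_lead binn subnn fact0 !mulr1.
by move=> i _; rewrite leqNgt ltn_ord.
Qed.

(** The coefficient of z^M in (z; q)_oo^(-b) (q/z; q)_oo^(-b), and [Gneg M] that of z^(-M); this
    becomes visible in [GposE] and [GnegE]. *)
Definition Gpos M : Q :=
  mom2 u (fun r s => if (r <= M + s)%N then 'C(M + s - r + B, B)%:R else 0).
Definition Gneg M : Q :=
  mom2 u (fun r s => if (r + M <= s)%N then 'C(s - (r + M) + B, B)%:R else 0).

(** The three regions of [varpi_ge], [varpi_mid] and [varpi_le] contribute the pairing at M,
    nothing, and the pairing at -(M + b). *)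
Lemma Ppoly_Gpos M : Ppoly (M%:R + hb) = Gpos M + Gneg (M + b).
Proof.
rewrite [Gneg (M + b)]mom2_swap // -mom2D; apply: eq_mom2 => r s.
have -> : M%:R + hb + s%:R - r%:R = (M + s)%N%:R - r%:R + hb by rewrite natrD; ring.
have [le_r|lt_r] := leqP r (M + s).
  by rewrite varpi_ge // ifF ?addr0 //; apply/negbTE; rewrite -ltnNge; lia.
have [le_s|lt_s] := leqP (s + (M + b)) r.
  by rewrite varpi_le ?add0r //; [congr ('C(_, _)%:R); lia | lia].
by rewrite varpi_mid ?addr0 //; lia.
Qed.

(** The same splitting at M - b. For 0 < M < b both outer regions give coefficients of negative
    powers, which makes a relation between two partial theta series possible. *)
Lemma Ppoly_Gneg M : (0 < M < b)%N -> Ppoly (M%:R - hb) = Gneg (b - M) + Gneg M.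
Proof.
move=> /andP[M_gt0 lt_Mb].
rewrite [Gneg M]mom2_swap // -mom2D; apply: eq_mom2 => r s.
have -> : M%:R - hb + s%:R - r%:R = (M + s)%N%:R - (r + b)%N%:R + hb.
  by rewrite !natrD; field.
have [le_r|lt_r] := leqP (r + (b - M)) s.
  rewrite varpi_ge; last by lia.
  rewrite ifF ?addr0; first by congr ('C(_, _)%:R); lia.
  by apply/negbTE; rewrite -ltnNge; lia.
have [le_s|lt_s] := leqP (s + M) r.
  by rewrite varpi_le ?add0r //; [congr ('C(_, _)%:R); lia | lia].
by rewrite varpi_mid ?addr0 //; lia.
Qed.

Lemma lsum_au n s :
  lsum (fun r => fC (if (r <= n)%N then 'C(n - r + B, B)%:R else 0) * (u r * u s)) = a n * u s.
Proof.
rewrite (@lsum_fin n.+1).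
- rewrite a_u mulr_suml; apply: eq_bigr => r _.
  by rewrite -ltnS ltn_ord rmorph_nat mulrA.
- by move=> i; apply/vgeMr/vgeMl.
- by move=> i lt_ni; rewrite leqNgt lt_ni rmorph0 mul0r.
Qed.

Lemma GposE M : Gpos M = lsum (fun s => a (M + s)%N * u s).
Proof.
rewrite /Gpos mom2_swap //; apply: eq_lsum => s; rewrite -lsum_au; apply: eq_lsum => r.
by rewrite [u s * _]mulrC.
Qed.

Lemma GnegE M : Gneg M = lsum (fun s => a s * u (M + s)%N).
Proof.
rewrite /Gneg mom2_swap //; set F := fun s => lsum (fun r =>
  fC (if (r + M <= s)%N then 'C(s - (r + M) + B, B)%:R else 0) * (u s * u r)).
have lF : lfin F by move=> s; apply: vge_lsum => r; apply/vgeMr/vgeMl.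
rewrite -[LHS]/(lsum F) (lsum_split M lF) big1 ?add0r => [|i _]; last first.
  rewrite /F -(lsum0 K); apply: eq_lsum => r.
  by rewrite ifF ?rmorph0 ?mul0r //; have := ltn_ord i; lia.
apply: eq_lsum => s; rewrite /F -lsum_au; apply: eq_lsum => r.
rewrite [u r * _]mulrC; congr (fC _ * _).
by rewrite [(r + M)%N]addnC leq_add2l; case: ifP => // _; rewrite subnDl.
Qed.

(** The symmetry z -> q/z, visible term by term because u_s = q^s a_s. *)
Lemma Gneg_Gpos M : Gneg M = q ^+ M * Gpos M.
Proof.
rewrite GnegE GposE -lsumMl; last by move=> s; apply: vgeMr.
by apply: eq_lsum => s; rewrite !u_a exprD; ring.
Qed.

Lemma Gpos_rec M : Gpos M = Ppoly (M%:R + hb) - q ^+ (M + b) * Gpos (M + b).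
Proof. by rewrite Ppoly_Gpos Gneg_Gpos addrK. Qed.

Lemma Gpos_sum M : Gpos M =
  lsum (fun n => (-1) ^+ n * q ^+ Gexp B M n * Ppoly ((M + b * n)%N%:R + hb)).
Proof.
pose F n := (-1) ^+ n * q ^+ Gexp B M n * Ppoly ((M + b * n)%N%:R + hb).
have lF : lfin F.
  move=> n; apply/vgeMl/vgeMr; exact/vge_Xn/leq_Gexp.
(* An n-fold iteration of [Gpos_rec]; the remainder has q-valuation at least n and so disappears in
   each fixed coefficient. *)
have E n : Gpos M = \sum_(i < n) F i + (-1) ^+ n * q ^+ Gexp B M n * Gpos (M + b * n).
  elim: n => [|n IHn].
    have G0 : Gexp B M 0 = 0%N by rewrite /Gexp (_ : 'C(1, 2) = 0%N) ?muln0.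
    by rewrite big_ord0 add0r G0 muln0 addn0 !expr0 !mul1r.
  rewrite {1}IHn big_ord_recr /= -addrA; congr (_ + _).
  by rewrite Gpos_rec /F GexpS -addnA -mulnSr !exprS !exprD; ring.
apply: fpsP => n; rewrite (E n.+1) fcoefD fcoef_sum fcoef_lsum.
rewrite [X in _ + X](_ : _ = 0) ?addr0 //.
apply: (@vgeMl _ n.+1) => //; apply: vgeMr; exact/vge_Xn/leq_Gexp.
Qed.

Lemma Gneg_sum M : Gneg M =
  lsum (fun n => (-1) ^+ n * q ^+ (M + Gexp B M n) * Ppoly ((M + b * n)%N%:R + hb)).
Proof.
rewrite Gneg_Gpos Gpos_sum -lsumMl; first by apply: eq_lsum => n; rewrite exprD; ring.
move=> n; apply/vgeMl/vgeMr; exact/vge_Xn/leq_Gexp.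
Qed.

End PartialFractions.

(** * Differential equations for theta functions and rank sums *)

Section Faulhaber.
Variable K : numFieldType.
Notation mu h := (h%:R + 2^-1 : K).

Lemma half_add : 2^-1 + 2^-1 = 1 :> K. Proof. by field. Qed.

(** Summing over the midpoints h + 1/2 of [h, h + 1] makes the telescoping difference of x^(c+1)
    symmetric, and this gives the summation polynomial a parity. *)
Lemma faulhaber c : exists p : {poly K},
  (forall t : nat, p.[t%:R] = \sum_(h < t) mu h ^+ c) /\
  (forall x, p.[- x] = (-1) ^+ c.+1 * p.[x]).
Proof.
elim/ltn_ind: c => c IHc.
have /choice[p Hp] : forall i : 'I_c, exists p : {poly K},
    (forall t : nat, p.[t%:R] = \sum_(h < t) mu h ^+ i) /\
    (forall x, p.[- x] = (-1) ^+ i.+1 * p.[x]) by move=> i; apply: IHc.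
(* The coefficient of mu^i in (mu + 1/2)^(c+1) - (mu - 1/2)^(c+1); it is zero unless c - i is
   even. *)
pose d (i : 'I_c) : K := 'C(c.+1, i)%:R * 2^-1 ^+ (c.+1 - i) * (1 - (-1) ^+ (c.+1 - i)).
exists (c.+1%:R^-1 *: ('X^(c.+1) - \sum_(i < c) d i *: p i)); split=> [t|x].
  have E h : mu h ^+ c *+ c.+1 =
      (h.+1%:R ^+ c.+1 - h%:R ^+ c.+1) - \sum_(i < c) d i * mu h ^+ i.
    have -> : h.+1%:R = 2^-1 + mu h by rewrite -natr1; field.
    have -> : h%:R ^+ c.+1 = (- 2^-1 + mu h) ^+ c.+1 by congr (_ ^+ _); ring.
    move: (mu h) => m; rewrite !exprDn -sumrB !big_ord_recr /= !subnn subSnn !expr0 !mul1r !expr1 binn !mulr1n subrr addr0.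
    rewrite binSn.
    have -> : \sum_(i < c) d i * m ^+ i =
      \sum_(i < c) (2^-1 ^+ (c.+1 - i) * m ^+ i *+ 'C(c.+1, i) -
                  (- 2^-1) ^+ (c.+1 - i) * m ^+ i *+ 'C(c.+1, i)).
      apply: eq_bigr => i _; rewrite /d [(- 2^-1) ^+ _]exprNn; ring.
    by rewrite mulNr mulNrn opprK -mulrnDl -mulrDl half_add mul1r; ring.
  rewrite hornerZ hornerD hornerN hornerXn horner_sum.
  have -> : t%:R ^+ c.+1 = \sum_(h < t) (h.+1%:R ^+ c.+1 - h%:R ^+ c.+1) :> K.
    rewrite -(big_mkord predT (fun h => h.+1%:R ^+ c.+1 - h%:R ^+ c.+1)).
    by rewrite telescope_sumr // expr0n subr0.
  under [X in _ * (_ - X)]eq_bigr => i _ do rewrite hornerZ (proj1 (Hp i)) mulr_sumr.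
  rewrite exchange_big -sumrB mulr_sumr; apply: eq_bigr => h _.
  by rewrite -E -[X in _ * X]mulr_natl mulrA mulVf ?mul1r ?pnatr_eq0.
rewrite !hornerZ !hornerD !hornerN !hornerXn !horner_sum [(- x) ^+ _]exprNn.
rewrite mulrCA; congr (_ * _); rewrite mulrBr; congr (_ - _).
rewrite mulr_sumr; apply: eq_bigr => i _; rewrite !hornerZ (proj2 (Hp i)) /d.
have le_ic : (i <= c)%N by rewrite ltnW.
rewrite -[(-1) ^+ (c.+1 - i)]signr_odd -[(-1) ^+ i.+1]signr_odd -[(-1) ^+ c.+1]signr_odd.
rewrite oddB ?(leqW le_ic) //=.
by case: (odd c); case: (odd i); rewrite /= ?expr0 ?expr1; ring.
Qed.

Variable B : nat.
Hypothesis evB : ~~ odd B.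
Notation vp := (varpi K B).

(** Expanding varpi(t - mu) leaves terms t^(l-i) times Faulhaber polynomials of parity i + j + 1.
    Only even l occur and j is odd, so the total parity l + j + 1 is even. *)
Lemma convolution_poly j : odd j -> exists p : {poly K},
  (forall t : nat, p.[t%:R] = \sum_(h < t) mu h ^+ j * vp.[t%:R - mu h]) /\
  (forall x, p.[- x] = p.[x]).
Proof.
move=> oddj; have /choice[F HF] := faulhaber.
exists (\sum_(l < B.+1) \sum_(i < l.+1)
  (vp`_l * (-1) ^+ i * 'C(l, i)%:R) *: ('X^(l - i) * F (i + j)%N)); split=> [t|x].
  rewrite horner_sum; under eq_bigr => l _ do rewrite horner_sum.
  under [RHS]eq_bigr => h _ do rewrite horner_coef size_varpi mulr_sumr.
  rewrite [RHS]exchange_big; apply: eq_bigr => l _ /=.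
  under [RHS]eq_bigr => h _ do rewrite exprBn !mulr_sumr.
  rewrite [RHS]exchange_big; apply: eq_bigr => i _ /=.
  rewrite hornerZ hornerM hornerXn (proj1 (HF _)) !mulr_sumr; apply: eq_bigr => h _.
  by rewrite exprD -mulr_natr; ring.
rewrite !horner_sum; apply: eq_bigr => l _; rewrite !horner_sum; apply: eq_bigr => i _.
rewrite !hornerZ !hornerM !hornerXn (proj2 (HF _)) [(- x) ^+ _]exprNn.
have [oddl|evl] := boolP (odd l); first by rewrite varpi_odd // !mul0r.
have le_il : (i <= l)%N by rewrite -ltnS.
rewrite -[(-1) ^+ (l - i)]signr_odd -[(-1) ^+ _.+1]signr_odd oddB //= oddD oddj (negbTE evl).
by case: (odd i); rewrite /= ?expr0 ?expr1; ring.
Qed.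
End Faulhaber.

(** * Linear differential equations satisfied by theta series and rank sums *)

Section DiffEqs.
Variable K : numFieldType.
Notation Q := (fps K).
Notation q := (fX K).
Variable B : nat.
Hypothesis evB : ~~ odd B.
Notation b := B.+1.
Notation k := B./2.+1.
Notation hb := (b%:R / 2 : K).
Notation vp := (varpi K B).
Notation mu h := (h%:R + 2^-1 : K).

Definition ptheta M l : Q := lsum (fun n =>
  fC ((-1) ^+ n.+1 * ((M + b * n)%N%:R + hb) ^+ l) * q ^+ (M + Gexp B M n)).

Lemma lfin_ptheta M l : lfin (fun n =>
  fC ((-1) ^+ n.+1 * ((M + b * n)%N%:R + hb) ^+ l) * q ^+ (M + Gexp B M n)).
Proof.
move=> n; apply: vgeMr; apply: vge_Xn.
by apply: leq_trans (leq_Gexp B M n) _; rewrite leq_addl.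
Qed.

Lemma vge_ptheta M l : vge M (ptheta M l).
Proof.
apply: vge_lsum => n; apply: vgeMr; apply: vge_Xn.
exact: leq_addr.
Qed.

Lemma eu_qX e : eu (q ^+ e) = q ^+ e *+ e.
Proof.
apply: fpsP => n; rewrite fcoef_eu fcoefMn fcoefXn; case: eqP => [->|] //.
by rewrite !mul0rn.
Qed.

(** Completing the square: 2b times the exponent is x^2 - (M - b/2)^2, where x = M + b n + b/2 is
    the linear form in the weight. *)
Lemma eu_ptheta M l : eu (ptheta M l) *+ (2 * b) = ptheta M l.+2 - fC ((M%:R - hb) ^+ 2) * ptheta M l.
Proof.
rewrite /ptheta -lsum_eu -lsumMl; last exact: lfin_ptheta.
rewrite -lsumN -lsumD -[LHS]mulr_natl -lsumMl; last first.
  by move=> n i lt_in; rewrite fcoef_eu lfin_ptheta ?mul0rn.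
apply: eq_lsum => n; set x := (M + b * n)%N%:R + hb; set e := (M + Gexp B M n)%N.
rewrite euCM eu_qX -[_ *+ e]mulr_natl.
have -> : (2 * b)%N%:R = fC (2 * b)%:R :> Q by rewrite rmorph_nat.
have -> : e%:R = fC e%:R :> Q by rewrite rmorph_nat.
have He : (2 * b)%:R * e%:R = x ^+ 2 - (M%:R - hb) ^+ 2.
  have -> : e%:R = n.+1%:R * (M%:R + b%:R * n%:R / 2) :> K.
    have -> : e = (n.+1 * M + b * 'C(n.+1, 2))%N by rewrite /e /Gexp mulSn addnA.
    have : ('C(n.+1, 2) * 2 = n.+1 * n)%N by rewrite bin2 /=; have := odd_double_half (n.+1 * n); rewrite oddM /= andNb; lia.
    move/(congr1 (fun i : nat => i%:R : K)); rewrite natrM => E.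
    have -> : (n.+1 * M + b * 'C(n.+1, 2))%:R = n.+1%:R * M%:R + b%:R * ('C(n.+1, 2)%:R * 2) / 2 :> K.
      by rewrite natrD !natrM; field.
    by rewrite E natrM; field.
  by rewrite /x natrM natrD natrM -[n.+1%:R]natr1; field.
transitivity (fC ((2 * b)%:R * e%:R) * (fC ((-1) ^+ n.+1 * x ^+ l) * q ^+ e)).
  by rewrite rmorphM /=; ring.
rewrite He rmorphB mulrBl; congr (_ - _).
by rewrite mulrA -rmorphM /=; congr (fC _ * _); rewrite !exprS; ring.
Qed.

(** The term of index 0 and the two halves of a theta series; for l = 0 it is theta_{b-2M,b}, see
    [theta_ev]. *)
Definition ctheta M l : Q := fC ((M%:R - hb) ^+ l) + ptheta (b - M) l + ptheta M l.

Lemma eu_ctheta M l : (M <= b)%N ->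
  eu (ctheta M l) *+ (2 * b) = ctheta M l.+2 - fC ((M%:R - hb) ^+ 2) * ctheta M l.
Proof.
move=> le_Mb; rewrite /ctheta !raddfD /= euC add0r mulrnDl !eu_ptheta.
have -> : ((b - M)%N%:R - hb) ^+ 2 = (M%:R - hb) ^+ 2 by rewrite natrB //; field.
have -> : fC ((M%:R - hb) ^+ l.+2) = fC ((M%:R - hb) ^+ 2) * fC ((M%:R - hb) ^+ l).
  by rewrite -rmorphM -exprD add2n.
by ring.
Qed.

Variables u a : fps Q.
Hypothesis vu : vseq u.
Hypothesis u0 : u 0%N = 1.
Hypothesis u_a : forall s, u s = q ^+ s * a s.
Hypothesis a_u : forall n, a n = \sum_(r < n.+1) 'C(n - r + B, B)%:R * u r.

Notation Ppolyc := (Ppolyc B u).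

Lemma Gneg_ptheta M : Gneg B u M = - \sum_(l < b) Ppolyc l * ptheta M l.
Proof.
rewrite (Gneg_sum evB vu u_a a_u).
transitivity (lsum (fun n => \sum_(l < b) (- Ppolyc l) *
   (fC ((-1) ^+ n.+1 * ((M + b * n)%N%:R + hb) ^+ l) * q ^+ (M + Gexp B M n)))).
  apply: eq_lsum => n; rewrite PpolycE // mulr_sumr; apply: eq_bigr => l _.
  by rewrite fC_signM exprS; ring.
rewrite lsum_sum -sumrN; apply: eq_bigr => l _.
by rewrite lsumMl ?mulNr //; apply: lfin_ptheta.
Qed.

(** In [Ppoly_Gneg] the two pairings become the halves of the theta series and the polynomial itself
    supplies the missing central term. *)
Lemma theta_ode M : (0 < M < b)%N -> \sum_(l < b) Ppolyc l * ctheta M l = 0.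
Proof.
move=> lt_M; have := Ppoly_Gneg evB u lt_M; rewrite !Gneg_ptheta PpolycE // => /eqP.
rewrite -subr_eq0 opprD !opprK => /eqP E; rewrite -[RHS]E addrA -!big_split /=.
by apply: eq_bigr => l _; rewrite /ctheta; ring.
Qed.

(** For l = 0 this is the rank sum rho_j. The index h + k is chosen because b/2 = k - 1/2, so that
    (h + k) - b/2 = mu h. *)
Definition rsum j l : Q := lsum (fun h => fC (mu h ^+ j) * ptheta (h + k) l).

Lemma lfin_rsum j l : lfin (fun h => fC (mu h ^+ j) * ptheta (h + k) l).
Proof. by move=> h; apply: vgeMr; apply: (vge_le _ (@vge_ptheta _ _)); rewrite leq_addr. Qed.

Lemma hbE h : (h + k)%N%:R - hb = mu h.
Proof.
have := odd_double_half B; rewrite (negbTE evB) add0n => /(congr1 (fun i => i%:R : K)).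
rewrite -mul2n natrM natrD -[k%:R]natr1 -[b%:R]natr1 => <-; by field.
Qed.

(** The constant of [eu_ptheta] is now mu h squared and moves into the weight, raising j by 2. Hence
    all odd j have to be handled together. *)
Lemma eu_rsum j l : eu (rsum j l) *+ (2 * b) = rsum j l.+2 - rsum j.+2 l.
Proof.
rewrite /rsum -lsum_eu -lsumN -lsumD -[LHS]mulr_natl -lsumMl; last first.
  by move=> n i lt_in; rewrite fcoef_eu lfin_rsum ?mul0rn.
apply: eq_lsum => h; rewrite euCM mulrCA mulr_natl eu_ptheta hbE mulrBr mulrA -rmorphM.
by rewrite -exprD addn2.
Qed.

Lemma sum_Gneg j : lsum (fun h => fC (mu h ^+ j) * Gneg B u (h + k)) = - \sum_(l < b) Ppolyc l * rsum j l.
Proof.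
transitivity (lsum (fun h => \sum_(l < b) (- Ppolyc l) * (fC (mu h ^+ j) * ptheta (h + k) l))).
  apply: eq_lsum => h; rewrite Gneg_ptheta mulrN mulr_sumr -sumrN; apply: eq_bigr => l _.
  by rewrite mulNr mulrCA.
rewrite lsum_sum -sumrN; apply: eq_bigr => l _.
by rewrite lsumMl ?mulNr //; apply: lfin_rsum.
Qed.

(** For fixed r and s, the binomials are the values varpi(s - r - mu h), which vanish for the other
    h < s - r; the sum over h is thus the convolution over h < s - r. *)
Lemma sum_Gneg_mom2 j (p : {poly K}) :
  (forall t : nat, p.[t%:R] = \sum_(h < t) mu h ^+ j * vp.[t%:R - mu h]) ->
  lsum (fun h => fC (mu h ^+ j) * Gneg B u (h + k)) =
  mom2 u (fun r s => if (r < s)%N then p.[s%:R - r%:R] else 0).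
Proof.
move=> pE; pose F h r s : K := if (r + (h + k) <= s)%N then 'C(s - (r + (h + k)) + B, B)%:R else 0.
transitivity (lsum (fun h => lsum (fun r => lsum (fun s =>
   fC (mu h ^+ j * F h r s) * (u r * u s))))).
  by apply: eq_lsum => h; rewrite -mom2Z.
rewrite lsum_exchange; apply: eq_lsum => r; rewrite lsum_exchange; apply: eq_lsum => s.
rewrite (@lsum_fin _ (s - r)).
- rewrite -mulr_suml -rmorph_sum; congr (fC _ * _).
  case: ltnP => [lt_rs|le_sr]; last first.
    by move: le_sr; rewrite -subn_eq0 => /eqP ->; rewrite big_ord0.
  rewrite -natrB ?pE; last exact: ltnW.
  apply: eq_bigr => h _; congr (_ * _); have := ltn_ord h.
  have -> : (s - r)%N%:R - mu h = s%:R - (r + (h + k))%N%:R + hb.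
    by rewrite -hbE natrB ?(ltnW lt_rs) // natrD; ring.
  move=> lt_h; rewrite /F; case: leqP => le_s; first by rewrite varpi_ge.
  rewrite varpi_mid //; have := odd_double_half B; rewrite (negbTE evB); lia.
- move=> h; rewrite /F; case: leqP => [le_s|_]; last by rewrite mulr0 rmorph0 mul0r.
  by apply/vgeMr/vgeMr; apply: (@vge_le _ s); [lia | apply: vu].
- by move=> h le_h; rewrite /F ifF ?mulr0 ?rmorph0 ?mul0r //; apply/negbTE; rewrite -ltnNge; lia.
Qed.

(** Evenness of p and p(0) = 0, an empty sum, turn twice the half sum over r < s into the full
    double sum, hence into square moments. *)
Lemma rank_pde j : odd j -> exists p : {poly K},
  \sum_(l < b) Ppolyc l * rsum j l *+ 2 = - mom2p u p.
Proof.
move=> /(convolution_poly K evB)[p [pE pN]]; exists p.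
have := sum_Gneg j; rewrite (sum_Gneg_mom2 pE) => E.
rewrite sumrMnl -[\sum_(l < b) _]opprK -E mulNrn; congr (- _).
rewrite mulr2n {1}mom2_swap -mom2D -(mom2_horner vu p); apply: eq_mom2 => r s.
case: ltngtP => [lt_rs|lt_sr|->].
- by rewrite addr0.
- by rewrite add0r -pN opprB.
- by have := pE 0%N; rewrite big_ord0 mulr0n subrr addr0 => ->.
Qed.
End DiffEqs.

(** * Derivatives of Eisenstein series *)

Section EisensteinDerivative.
Variable K : numFieldType.
Notation Q := (fps K).
Notation q := (fX K).
Notation mu h := (h%:R + 2^-1 : K).
Notation w := (Eexpq K).

Lemma vseq_Eexpq : vseq w. Proof. exact: vge_Eexpq. Qed.

Lemma vge_Eexpq_le s t : (s <= t)%N -> vge s (w t).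
Proof. by move=> le_st; apply: (@vge_le _ t) => //; apply: vseq_Eexpq. Qed.

(** The coefficient of z^t in (q z; q)_oo (q/z; q)_oo. *)
Definition Eshift t : Q := lsum (fun s => w (t + s)%N * w s).

Lemma lfin_Eshift t : lfin (fun s => w (t + s)%N * w s).
Proof. by move=> s; apply/vgeMr/vseq_Eexpq. Qed.

Lemma vge_Eshift t : vge t (Eshift t).
Proof. by apply: vge_lsum => s; apply/vgeMl/vge_Eexpq_le; rewrite leq_addr. Qed.

(** Coefficientwise form of (1/z; q)_oo = (1 - 1/z) (q/z; q)_oo. *)
Lemma Ecorr_Eshift m : Ecorr K m = Eshift m - Eshift m.+1.
Proof.
have EexpS s : Eexp K s.+1 = w s.+1 - w s.
  by rewrite {1}Eexp_Eexpq mulrBl mul1r fcoefB fcoefXM.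
have Eexp0 : Eexp K 0%N = w 0%N by rewrite Eexp_Eexpq mulrBl mul1r fcoefB fcoefXM subr0.
rewrite /Ecorr lsum_recl; last first.
  by move=> s; apply/vgeMl/vge_Eexpq_le; rewrite leq_addl.
rewrite [Eshift m]lsum_recl; last exact: lfin_Eshift.
rewrite Eexp0 -addrA; congr (_ + _); rewrite -lsumN -lsumD; apply: eq_lsum => s.
by rewrite EexpS addnS addSn mulrBr.
Qed.

Lemma mom2_even (F : K -> K) : (forall x, F (- x) = F x) ->
  mom2 w (fun r s => F (r%:R - s%:R)) =
  fC (F 0) * Eshift 0 + lsum (fun t => fC (F t.+1%:R) * Eshift t.+1) *+ 2.
Proof.
move=> FN.
(* The half r >= s with the diagonal for [c = false], and without it for [c = true]. *)
pose G (c : bool) := mom2 w (fun r s => if (s + c <= r)%N then F (r%:R - s%:R) else 0).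
have GE c : G c = lsum (fun t => fC (F (t + c)%N%:R) * Eshift (t + c)).
  rewrite /G mom2_swap.
  transitivity (lsum (fun s => lsum (fun t => fC (F (t + c)%N%:R) * (w (t + c + s)%N * w s)))).
    apply: eq_lsum => s.
    set H := fun r => fC (if (s + c <= r)%N then F (r%:R - s%:R) else 0) * (w s * w r).
    have lH : lfin H by move=> r; apply/vgeMr/vgeMr/vseq_Eexpq.
    rewrite -[LHS]/(lsum H) (lsum_split (s + c) lH) big1 ?add0r => [|r _]; last first.
      by rewrite /H leqNgt ltn_ord rmorph0 mul0r.
    apply: eq_lsum => t; rewrite /H leq_addr natrD (natrD _ t c) [w s * _]mulrC.
    rewrite (_ : (s + c + t)%N = (t + c + s)%N); last by lia.
    by congr (fC (F _) * _); rewrite natrD; ring.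
  rewrite lsum_exchange; apply: eq_lsum => t; rewrite -lsumMl //; exact: lfin_Eshift.
have -> : mom2 w (fun r s => F (r%:R - s%:R)) = G false + G true.
  rewrite /G [X in _ + X]mom2_swap.
  rewrite -mom2D; apply: eq_mom2 => r s; rewrite addn0 addn1.
  by case: ltnP => _; rewrite ?addr0 ?add0r // -FN opprB.
rewrite !GE [X in X + _]lsum_recl; last first.
  by move=> t; rewrite addn0; apply/vgeMr/vge_Eshift.
by rewrite mulr2n addrA; congr (_ + _ + _); apply: eq_lsum => t; rewrite ?addn0 ?addn1.
Qed.

(** For i = 1 this is half of Jacobi's series for (q; q)_oo^3. *)
Definition otheta i : Q := lsum (fun t => fC ((-1) ^+ t * mu t ^+ i) * q ^+ 'C(t.+1, 2)).

Lemma leq_bin2 t : (t <= 'C(t.+1, 2))%N.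
Proof. by rewrite binS bin1 leq_addl. Qed.

Lemma lfin_otheta i : lfin (fun t => fC ((-1) ^+ t * mu t ^+ i) * q ^+ 'C(t.+1, 2)).
Proof.
by move=> t; apply: vgeMr; apply: vge_Xn; apply: leq_bin2.
Qed.

Lemma eu_otheta i : eu (otheta i) *+ 2 = otheta i.+2 - fC 4^-1 * otheta i.
Proof.
rewrite /otheta -lsum_eu -lsumMl; last exact: lfin_otheta.
rewrite -lsumN -lsumD -[LHS]mulr_natl -lsumMl; last first.
  by move=> n j lt_jn; rewrite fcoef_eu lfin_otheta ?mul0rn.
apply: eq_lsum => t; rewrite euCM eu_qX -[_ *+ 'C(_, _)]mulr_natl.
have -> : 2%:R = fC 2%:R :> Q by rewrite rmorph_nat.
have -> : ('C(t.+1, 2))%:R = fC ('C(t.+1, 2))%:R :> Q by rewrite rmorph_nat.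
have E : 2%:R * ('C(t.+1, 2))%:R = mu t ^+ 2 - 4^-1.
  have : ('C(t.+1, 2) * 2 = t.+1 * t)%N.
    rewrite bin2 /=; have := odd_double_half (t.+1 * t); rewrite oddM /= andNb; lia.
  move/(congr1 (fun i : nat => i%:R : K)); rewrite !natrM mulrC => ->.
  by rewrite -[t.+1%:R]natr1; field.
transitivity (fC (2%:R * ('C(t.+1, 2))%:R) * (fC ((-1) ^+ t * mu t ^+ i) * q ^+ 'C(t.+1, 2))).
  by rewrite rmorphM /=; ring.
rewrite E rmorphB mulrBl; congr (_ - _).
by rewrite mulrA -rmorphM /=; congr (fC _ * _); rewrite !exprS; ring.
Qed.

Definition even_corr i : Q := mom2 w (fun r s =>
  (r%:R - s%:R + 2^-1) ^+ i - (r%:R - s%:R - 2^-1) ^+ i).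

(** Summation by parts moves the central difference from x^i to [Eshift], which becomes [Ecorr]; the
    triple product then makes it a theta term. *)
Lemma even_corr_otheta i : odd i -> even_corr i = (Ecorr K 0 * otheta i) *+ 2.
Proof.
move=> oddi; pose F (x : K) := (x + 2^-1) ^+ i - (x - 2^-1) ^+ i.
have FN x : F (- x) = F x.
  rewrite /F (_ : - x + 2^-1 = - (x - 2^-1)); last by ring.
  rewrite (_ : - x - 2^-1 = - (x + 2^-1)); last by ring.
  by rewrite [(- (x - 2^-1)) ^+ i]exprNn [(- (x + 2^-1)) ^+ i]exprNn -signr_odd oddi; ring.
rewrite -[even_corr i]/(mom2 w (fun r s => F (r%:R - s%:R))) mom2_even //.
have -> : Ecorr K 0 * otheta i = lsum (fun t => fC (mu t ^+ i) * Ecorr K t).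
  rewrite -lsumMl; last exact: lfin_otheta.
  by apply: eq_lsum => t; rewrite (EcorrE _ t) fC_signM; ring.
have lF1 : lfin (fun t => fC (mu t ^+ i) * Eshift t) by move=> t; apply/vgeMr/vge_Eshift.
have -> : lsum (fun t => fC (mu t ^+ i) * Ecorr K t) =
    lsum (fun t => fC (mu t ^+ i) * Eshift t) - lsum (fun t => fC (mu t ^+ i) * Eshift t.+1).
  by rewrite -lsumN -lsumD; apply: eq_lsum => t; rewrite Ecorr_Eshift mulrBr.
rewrite (lsum_recl lF1) -addrA mulrnDl -lsumN -lsumD; congr (_ + _ *+ 2).
  rewrite -[RHS]mulr_natl -(rmorph_nat fC) mulrA -rmorphM; congr (fC _ * _).
  by rewrite /F !add0r exprNn -signr_odd oddi; ring.
apply: eq_lsum => t; rewrite -mulrBl -rmorphB; congr (fC _ * _); rewrite /F.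
have -> : t.+1%:R - 2^-1 = mu t by rewrite -natr1; field.
by [].
Qed.

Lemma even_corr_egf2 i : even_corr i = \sum_(m < i.+1)
  fC ('C(i, m)%:R * (2^-1 ^+ m - (- 2^-1) ^+ m) * (i - m)`!%:R) * egf2 w (i - m)%N.
Proof.
rewrite /even_corr; under eq_mom2 => r s do rewrite !exprDn -sumrB.
rewrite mom2_sum; apply: eq_bigr => m _.
rewrite [in RHS]rmorphM /= -mulrA -mom2_exp; last exact: vseq_Eexpq.
rewrite -mom2Z; last exact: vseq_Eexpq.
by apply: eq_mom2 => r s; ring.
Qed.

Variable P : Q -> Prop.
Hypothesis PA : fsubalg P.
Hypothesis PS : forall i, odd i -> P (mom (Lambert K) i).

Lemma P_Teven n : P (Teven (Lambert K) n).
Proof.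
case: n => [|i]; first by rewrite Teven0; apply: fsubalg0.
rewrite TevenE; have [oddi|evi] := boolP (odd i).
  by apply: fsubalgCM => //; apply: PS.
by rewrite -signr_odd (negbTE evi) subrr mul0r rmorph0 mul0r; apply: fsubalg0.
Qed.

Lemma vseq_Lambert : vseq (Lambert K). Proof. exact: vge_lambert. Qed.

(** Triangular relations link the Lambert moments, the square moments [e] and the quotients [y] of
    theta series. Stability under the derivation is clear for [y], where it raises the index, and is
    carried back along these relations. *)
Lemma P_eu_Lambert i : odd i -> P (eu (mom (Lambert K) i)).
Proof.
have dE : eu (egf2 w) = fC (fC (-1)) * Teven (Lambert K) * egf2 w.
  apply: eu_egf2; do ?[exact: vseq_Eexpq | exact: vseq_Lambert].
  by rewrite eu_Eexpq !rmorphN !rmorph1 mulN1r mulNr.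
have [e [Pe e0 Ee]] := logder_coef PA P_Teven (Teven0 _) dE.
have E00 : egf2 w 0%N 0%N = 1 by apply: egf2_coef0; exact: Eexpq0.
pose sinhV i m : K := 'C(i, m)%:R * (2^-1 ^+ m - (- 2^-1) ^+ m) * (i - m)`!%:R.
pose y i : Q := \sum_(m < i.+1) fC (sinhV i m) * e (i - m)%N.
have YE j : even_corr j = egf2 w 0%N * y j.
  by rewrite even_corr_egf2 mulr_sumr; apply: eq_bigr => m _; rewrite Ee mulrCA.
have sinhV0 m : sinhV m 0%N = 0 by rewrite /sinhV !expr0 subrr mulr0 mul0r.
have kap1 n : sinhV n.+1 1%N = n.+1`!%:R.
  rewrite /sinhV bin1 !expr1 opprK subSS subn0 half_add mulr1 factS natrM; ring.
have y1 : y 1%N = 1.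
  by rewrite /y !big_ord_recl big_ord0 addr0 /= sinhV0 kap1 rmorph0 mul0r add0r e0 rmorph1 mulr1.
have E0 : egf2 w 0%N = (Ecorr K 0 * otheta 1) *+ 2 by rewrite -even_corr_otheta // YE y1 mulr1.
pose s1 := otheta 1 *+ 2.
have g0s1 : Ecorr K 0 * s1 = egf2 w 0%N by rewrite E0 mulrnAr.
have sy j : odd j -> otheta j *+ 2 = s1 * y j.
  move=> oddj; apply/subr0_eq/(@fps_reg _ (s1 * Ecorr K 0)).
    by rewrite mulrC g0s1.
  rewrite -mulrA mulrBr mulrnAr -even_corr_otheta // YE -g0s1.
  by ring.
have s1_0 : s1 0%N = 1.
  rewrite fcoefMn fcoef_lsum big_ord1 fcoefCM fcoefXn /= expr0 expr1 mul1r mulr1 add0r.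
  by rewrite mulr2n half_add.
have Py j : P (y j) by apply: fsubalg_sum => // m _; apply: fsubalgCM.
have Pdy j : odd j -> P (eu (y j)).
  move=> oddj.
  have E3 : eu s1 *+ 2 = s1 * (y 3 - fC 4^-1).
    by rewrite {1}/s1 raddfMn /= eu_otheta mulrnBl sy // /s1; ring.
  have Ej : (eu s1 * y j + s1 * eu (y j)) *+ 2 = s1 * (y j.+2 - fC 4^-1 * y j).
    have sy2 : otheta j.+2 *+ 2 = s1 * y j.+2 by rewrite sy //= negbK.
    rewrite -euM -sy // raddfMn /= eu_otheta mulrnBl sy2 -[X in _ - X]mulrnAr sy //; ring.
  (* Subtracting y_j times the equation of [s1] eliminates the derivative of the normalising theta
     series. *)
  have : eu (y j) *+ 2 = y j.+2 - y 3 * y j.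
    apply/subr0_eq/(fps_reg s1_0).
    have -> : s1 * (eu (y j) *+ 2 - (y j.+2 - y 3 * y j)) =
      ((eu s1 * y j + s1 * eu (y j)) *+ 2 - s1 * (y j.+2 - fC 4^-1 * y j)) -
      (eu s1 *+ 2 - s1 * (y 3 - fC 4^-1)) * y j by ring.
    by rewrite Ej E3 !subrr mul0r subr0.
  move=> E; apply: (@fsubalgMnI _ _ PA 2) => //; rewrite E.
  by apply: fsubalgB => //; apply: fsubalgM.
have e_odd n : odd n -> e n = 0.
  move=> oddn; apply: (fps_reg E00); rewrite -Ee egf2_odd //; exact: vseq_Eexpq.
(* Only e_m with m <= n enter y_(n+1), and e_n has the coefficient (n + 1)!. *)
have Pde n : P (eu (e n)).
  elim/ltn_ind: n => n IHn.
  have [oddn|evn] := boolP (odd n); first by rewrite e_odd // raddf0; apply: fsubalg0.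
  apply: (@fsubalgCMI _ _ PA n.+1`!%:R); first exact: fact_neq0.
  have := Pdy n.+1 evn; rewrite /y raddf_sum /= big_ord_recl big_ord_recl /=.
  rewrite sinhV0 kap1 rmorph0 mul0r raddf0 add0r euCM subSS subn0 => PE.
  apply: (fsubalgDI PA PE); apply: fsubalg_sum => // m _; rewrite euCM.
  by apply: fsubalgCM => //; apply: IHn; have := ltn_ord m; rewrite /bump /=; lia.
have eT n : e n *+ n = - \sum_(i < n.+1) Teven (Lambert K) i * e (n - i)%N.
  apply/subr0_eq/(fps_reg E00); rewrite mulrBr mulrnAr -Ee mulrN mulr_sumr opprK.
  have := congr1 (fun f : fps Q => f n) dE; rewrite fcoef_eu => ->.
  rewrite -mulrA fcoefCM rmorphN rmorph1 mulN1r fcoefM addrC; apply/eqP; rewrite subr_eq0; apply/eqP.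
  by apply: eq_bigr => m _; rewrite (Ee (n - m)%N) mulrCA.
(* By [eT], the n-th coefficient of [Teven] is -n e_n up to products of lower coefficients with the
   e_m. *)
have PdT n : P (eu (Teven (Lambert K) n)).
  elim/ltn_ind: n => n IHn.
  have -> : Teven (Lambert K) n = - (e n *+ n) - \sum_(m < n) Teven (Lambert K) m * e (n - m)%N.
    by rewrite eT big_ord_recr /= subnn e0 mulr1; ring.
  rewrite raddfB raddfN /= raddfMn /= raddf_sum /=.
  apply: fsubalgB => //; first by apply: fsubalgN => //; apply: fsubalgMn.
  apply: fsubalg_sum => // m _; rewrite euM.
  by apply: fsubalgD => //; apply: fsubalgM => //; [apply: IHn | apply: P_Teven].
move=> oddi; apply: (@fsubalgCMI _ _ PA ((1 - (-1) ^+ i) / i`!%:R)).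
  rewrite mulf_neq0 ?invr_eq0 ?fact_neq0 // -signr_odd oddi expr1 opprK.
  by rewrite (_ : 1 + 1 = 2%:R) // pnatr_eq0.
by rewrite -euCM -TevenE.
Qed.

End EisensteinDerivative.

(** * Closure at the level of formal series *)

Section IteratedDerivatives.
Variable K : numFieldType.
Notation Q := (fps K).
Variable P : Q -> Prop.
Hypothesis PA : fsubalg P.

Fixpoint Dclosed j (f : Q) : Prop := if j is j'.+1 then P f /\ Dclosed j' (eu f) else P f.

Lemma DclosedP j f : Dclosed j f <-> forall i, (i <= j)%N -> P (iter i (@eu K) f).
Proof.
elim: j f => [|j IHj] f; first by split=> [Pf [|i] //|/(_ 0%N)]; apply.
split=> [[Pf /IHj Pdf] [|i] // lt_ij|Pi]; first by rewrite iterSr; apply: Pdf.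
by split; [apply: (Pi 0%N) | apply/IHj => i le_ij; rewrite -iterSr; apply: Pi].
Qed.

Lemma Dclosed_le i j f : (i <= j)%N -> Dclosed j f -> Dclosed i f.
Proof. by move=> le_ij /DclosedP Pf; apply/DclosedP => l le_l; apply: Pf; apply: leq_trans le_ij. Qed.

Lemma Dclosed_subalg j : fsubalg (Dclosed j).
Proof.
elim: j => [|j IHj]; first exact: PA.
split=> [c|f g [Pf Pdf] [Pg Pdg]|f g [Pf Pdf] [Pg Pdg]] /=.
- by split; rewrite ?euC; [apply: fsubalgC | apply: fsubalg0].
- by split; rewrite ?raddfD /=; apply: fsubalgD.
- split; first exact: fsubalgM.
  by rewrite euM; apply: fsubalgD => //; apply: fsubalgM => //; apply: (@Dclosed_le _ j.+1).
Qed.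

Lemma DclosedSP j f : Dclosed j f -> P (iter j.+1 (@eu K) f) -> Dclosed j.+1 f.
Proof.
move=> /DclosedP Pf Pj; apply/DclosedP => i; rewrite leq_eqVlt => /predU1P[->//|].
by rewrite ltnS; apply: Pf.
Qed.

Section Ladder.
(** One scheme for both families: the upper index is half the power of the linear form, and [sigma]
    is the identity for theta series and the successor for rank sums. *)
Variables (n0 m : nat) (c : K) (X : nat -> nat -> Q) (sigma : nat -> nat).
Hypothesis m_gt0 : (0 < m)%N.
Hypothesis XS : forall j i, X j i.+1 = eu (X j i) *+ m + fC c * X (sigma j) i.
Hypothesis X0 : forall j, Dclosed n0 (X j 0%N).

Lemma ladder_le i j : (i <= n0)%N -> Dclosed (n0 - i) (X j i).
Proof.
elim: i j => [|i IHi] j le_i; first by rewrite subn0; apply: X0.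
rewrite XS; apply: fsubalgD; first exact: Dclosed_subalg.
  apply: fsubalgMn; first exact: Dclosed_subalg.
  have := IHi j (ltnW le_i); have -> : (n0 - i = (n0 - i.+1).+1)%N by lia.
  by case.
apply: fsubalgCM; first exact: Dclosed_subalg.
by apply: Dclosed_le (IHi _ (ltnW le_i)); lia.
Qed.

(** Up to terms that allow one more derivation than [ladder_le] grants, climbing a rung is m times
    the derivation. *)
Lemma ladder_lead i j : (i <= n0.+1)%N ->
  Dclosed (n0.+1 - i) (X j i - iter i (@eu K) (X j 0%N) *+ m ^ i).
Proof.
elim: i j => [|i IHi] j le_i; first by rewrite subrr; apply: fsubalg0; apply: Dclosed_subalg.
have := IHi j (ltnW le_i); have -> : (n0.+1 - i = (n0.+1 - i.+1).+1)%N by lia.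
case=> _; rewrite raddfB /= raddfMn /= -/(iter i.+1 _ _) => Pi.
have -> : X j i.+1 - iter i.+1 (@eu K) (X j 0%N) *+ m ^ i.+1 =
   (eu (X j i) - iter i.+1 (@eu K) (X j 0%N) *+ m ^ i) *+ m + fC c * X (sigma j) i.
  by rewrite XS mulrnBl -mulrnA expnSr; ring.
apply: fsubalgD; first exact: Dclosed_subalg.
  by apply: fsubalgMn => //; apply: Dclosed_subalg.
apply: fsubalgCM; first exact: Dclosed_subalg.
by rewrite subSS; apply: ladder_le.
Qed.

(** By [ladder_lead] the top rung is m^(n0+1) times the missing derivative modulo P; a relation
    expressing that rung through lower ones therefore yields the derivative. *)
Lemma ladder_top j : P (X j n0.+1) -> Dclosed n0.+1 (X j 0%N).
Proof.
move=> PX; apply: DclosedSP => //.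
apply: (@fsubalgMnI _ _ PA (m ^ n0.+1)); first by rewrite expn_gt0 m_gt0.
have := ladder_lead j (leqnn n0.+1); rewrite subnn /= -/(iter n0.+1 _ _) => PB.
rewrite -[X in P X](subKr (X j n0.+1)).
exact: (fsubalgB PA PX).
Qed.
End Ladder.
End IteratedDerivatives.

(** The hypotheses express h = exp(2 g) in differential form. *)
Lemma exp_fps_coef (A : comNzRingType) (h g : fps A) n : h 0%N = 1 -> eu h = eu g * h *+ 2 ->
  h n *+ n = (\sum_(i < n) g i *+ i * h (n - i)%N) *+ 2 + g n *+ n *+ 2.
Proof.
move=> h0 dh; have := congr1 (fun f : fps A => f n) dh; rewrite fcoef_eu => ->.
by rewrite fcoefMn fcoefM big_ord_recr /= subnn h0 mulr1 mulrnDl.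
Qed.

(** * One more derivative for theta series, rank sums and exponents *)

Section FormalClosure.
Variable K : numFieldType.
Notation Q := (fps K).
Variable P : Q -> Prop.
Hypothesis PA : fsubalg P.
Hypothesis PS : forall i, odd i -> P (mom (Lambert K) i).
(** Here k = n0 + 2: derivatives up to order n0 = k - 2 are given, the one of order n0 + 1 is to be
    found, and B = 2(k - 1). *)
Variable n0 : nat.
Notation B := (n0.+1).*2.
Notation b := B.+1.
Notation u := (eexpqn K B).

Let evB : ~~ odd B. Proof. by rewrite odd_double. Qed.
Let vu : vseq u. Proof. exact: vge_eexpqn. Qed.
Let u0 : u 0%N = 1. Proof. exact: eexpqn0. Qed.
Let u_a := @eexpqn_coef K B.
Let a_u := @eexpn_coef K B.
Let E00 : egf2 u 0%N 0%N = 1. Proof. exact: egf2_coef0. Qed.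

Lemma egf2_quotient : exists e : nat -> Q,
  [/\ forall n, P (e n), e 0%N = 1 & forall n, egf2 u n = egf2 u 0%N * e n].
Proof.
apply: (@logder_coef K P PA (egf2 u) (Teven (Lambert K)) b%:R).
- exact: P_Teven.
- exact: Teven0.
- apply: eu_egf2; do ?[exact: vu | exact: vseq_Lambert].
  by rewrite eu_eexpqn !rmorph_nat -[Lambert K *+ _]mulr_natl.
Qed.

(** After division by the common factor the coefficients of the differential equation lie in P and
    the leading one is a non-zero constant, so the equation can be solved for its top term. *)
Lemma Ppolyc_quotient : exists cc : nat -> Q,
  [/\ forall l, P (cc l), forall l, Ppolyc B u l = egf2 u 0%N * cc l,
      forall l, odd l -> cc l = 0 & cc B = fC B`!%:R^-1].
Proof.
have [e [Pe e0 Ee]] := egf2_quotient.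
pose cc l := \sum_(j < b | (l <= j)%N)
  fC ((varpi K B)`_j * 'C(j, l)%:R * (j - l)`!%:R) * e (j - l)%N.
have ccE l : Ppolyc B u l = egf2 u 0%N * cc l.
  by rewrite mulr_sumr; apply: eq_bigr => j _; rewrite (Ee (j - l)%N) mulrCA.
exists cc; split=> //.
- by move=> l; apply: fsubalg_sum => // j _; apply: fsubalgCM.
- by move=> l oddl; apply: (fps_reg E00); rewrite -ccE Ppolyc_odd.
- by apply: (fps_regI E00); rewrite -ccE Ppolyc_lead mulrC.
Qed.

Lemma ctheta_closed M : (0 < M < b)%N -> Dclosed P n0 (ctheta K B M 0) -> Dclosed P n0.+1 (ctheta K B M 0).
Proof.
move=> lt_M PT; have [cc [Pcc ccE cc_odd ccB]] := Ppolyc_quotient.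
have le_Mb : (M <= b)%N by case/andP: lt_M => _ /ltnW.
(* The odd powers have zero coefficient in the equation, so the rungs are the powers 2i; the top
   rung i = n0 + 1 is the power B. *)
pose X (j i : nat) := ctheta K B M i.*2.
have XS j i : X j i.+1 = eu (X j i) *+ (2 * b) + fC ((M%:R - b%:R / 2) ^+ 2) * X (id j) i.
  by rewrite eu_ctheta // subrK.
have X0 j : Dclosed P n0 (X j 0%N) by exact: PT.
have m_gt0 : (0 < 2 * b)%N by [].
apply: (@ladder_top K P PA n0 _ _ X id m_gt0 XS X0 0%N).
have := theta_ode evB vu u_a a_u lt_M.
under eq_bigr => l _ do rewrite ccE -mulrA.
rewrite -mulr_sumr => /(fps_reg E00); rewrite big_ord_recr /= ccB => /eqP.
rewrite addrC addr_eq0 => /eqP E.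
apply: (@fsubalgCMI _ _ PA B`!%:R^-1); first by rewrite invr_eq0 fact_neq0.
rewrite [fC _ * _]E; apply: fsubalgN => //; apply: fsubalg_sum => // l _.
have [oddl|evl] := boolP (odd l); first by rewrite cc_odd // mul0r; apply: fsubalg0.
apply: fsubalgM => //.
have le_l : (l./2 <= n0)%N by have := ltn_ord l; have := odd_double_half l; rewrite (negbTE evl); lia.
have /Dclosed_le -/(_ 0%N (leq0n _)) := @ladder_le K P PA n0 _ _ X id m_gt0 XS X0 l./2 0%N le_l.
by rewrite /X; have := odd_double_half l; rewrite (negbTE evl) add0n => ->.
Qed.

(** As for theta series, with two changes: the right-hand side is a combination of square moments,
    and the ladder moves to higher j, whence the hypothesis on all odd indices. *)
Lemma rsum_closed : (forall i, Dclosed P n0 (rsum K B i.*2.+1 0)) ->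
  forall i, Dclosed P n0.+1 (rsum K B i.*2.+1 0).
Proof.
move=> PR i; have [cc [Pcc ccE cc_odd ccB]] := Ppolyc_quotient.
have [e [Pe e0 Ee]] := egf2_quotient.
pose X j i := rsum K B j.*2.+1 i.*2.
have XS j l : X j l.+1 = eu (X j l) *+ (2 * b) + fC 1 * X j.+1 l.
  by rewrite eu_rsum // rmorph1 mul1r subrK.
have m_gt0 : (0 < 2 * b)%N by [].
apply: (@ladder_top K P PA n0 _ _ X S m_gt0 XS PR i).
have oddi : odd i.*2.+1 by rewrite /= odd_double.
have [p Hp] := rank_pde evB vu u_a a_u oddi.
have Plam : exists2 f, P f & mom2p u p = egf2 u 0%N * f.
  exists (\sum_(l < size p) fC (p`_l * l`!%:R) * e l).
    by apply: fsubalg_sum => // l _; apply: fsubalgCM.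
  by rewrite mulr_sumr; apply: eq_bigr => l _; rewrite (Ee l) mulrCA.
have [f Pf fE] := Plam; move: Hp; rewrite fE.
under eq_bigr => l _ do rewrite ccE -mulrA -mulrnAr.
rewrite -mulr_sumr -mulrN => /(fps_regI E00); rewrite big_ord_recr /= ccB => E.
apply: (@fsubalgCMI _ _ PA B`!%:R^-1); first by rewrite invr_eq0 fact_neq0.
apply: (@fsubalgMnI _ _ PA 2) => //.
have : P (- f) by apply: fsubalgN.
rewrite -E addrC => PE; apply: (fsubalgDI PA PE); apply: fsubalg_sum => // l _.
apply: fsubalgMn => //.
have [oddl|evl] := boolP (odd l); first by rewrite cc_odd // mul0r; apply: fsubalg0.
apply: fsubalgM => //.
have le_l : (l./2 <= n0)%N by have := ltn_ord l; have := odd_double_half l; rewrite (negbTE evl); lia.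
have /Dclosed_le -/(_ 0%N (leq0n _)) := @ladder_le K P PA n0 _ _ X S m_gt0 XS PR l./2 i le_l.
by rewrite /X; have := odd_double_half l; rewrite (negbTE evl) add0n => ->.
Qed.

(** * Passage between g and h = exp(2 g) *)

Section Exponential.
Variables (h g : fps Q) (kappa c : nat -> K).
Hypothesis h0 : h 0%N = 1.
Hypothesis g0 : g 0%N = 0.
Hypothesis h_odd : forall n, odd n -> h n = 0.
Hypothesis h_even : forall n, h n.*2.+2 = fC (kappa n) - fC (c n) * rsum K B n.*2.+1 0.
Hypothesis c_neq0 : forall n, c n != 0.
Hypothesis dh : eu h = eu g * h *+ 2.

Let exp_coef n := @exp_fps_coef _ h g n h0 dh.

Lemma g_odd n : odd n -> g n = 0.
Proof.
elim/ltn_ind: n => n IHn oddn; have := exp_coef n; rewrite h_odd // mul0rn big1 => [|i _].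
  move=> E; apply: fpsP => j; have := congr1 (fun f : Q => f j) E.
  rewrite fcoefD mul0rn !fcoef0 add0r !fcoefMn => /eqP; rewrite eq_sym !mulrn_eq0 /=.
  by case: n oddn {IHn E} => // n _ /eqP.
have [oddi|evi] := boolP (odd i); first by rewrite IHn // mul0rn mul0r.
by rewrite h_odd ?mulr0 // oddB ?oddn ?(negbTE evi) // ltnW.
Qed.

(** The recursion [exp_coef] is triangular in both directions: h_n is 2 g_n plus products of lower
    coefficients. *)
Lemma exp_closed (P' : Q -> Prop) : fsubalg P' ->
  (forall n, P' (g n)) <-> (forall n, P' (h n)).
Proof.
move=> PA'; split=> H n; elim/ltn_ind: n => n IHn; case: n IHn => [|n] IHn.
- by rewrite h0; apply: fsubalg1.
- apply: (@fsubalgMnI _ _ PA' n.+1) => //; rewrite exp_coef.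
  apply: fsubalgD => //; last by do 2 apply: fsubalgMn => //.
  apply: fsubalgMn => //; apply: fsubalg_sum => // i _.
  have [-> |i_gt0] := posnP i; first by rewrite mulr0n mul0r; apply: fsubalg0.
  by apply: fsubalgM => //; [apply: fsubalgMn | apply: IHn; lia].
- by rewrite g0; apply: fsubalg0.
- apply: (@fsubalgMnI _ _ PA' n.+1) => //; apply: (@fsubalgMnI _ _ PA' 2) => //.
  have := exp_coef n.+1; rewrite addrC => E.
  have : P' (h n.+1 *+ n.+1) by apply: fsubalgMn.
  rewrite E => PE; apply: (fsubalgDI PA' PE).
  apply: fsubalgMn => //; apply: fsubalg_sum => // i _; apply: fsubalgM => //.
  by apply: fsubalgMn => //; apply: IHn.
Qed.

(** The n0 derivatives pass from g to h and to the rank sums, the rank sums gain one, and the way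
    back to g preserves it. *)
Lemma g_closed : (forall n, (0 < n)%N -> Dclosed P n0 (g n.*2)) -> forall n, Dclosed P n0.+1 (g n).
Proof.
move=> Pg.
have PAn := Dclosed_subalg PA n0; have PAn1 := Dclosed_subalg PA n0.+1.
have Pgn n : Dclosed P n0 (g n).
  have [oddn|evn] := boolP (odd n); first by rewrite g_odd //; apply: fsubalg0.
  have := odd_double_half n; rewrite (negbTE evn) add0n => <-.
  case: (n./2) => [|i]; first by rewrite g0; apply: fsubalg0.
  exact: Pg.
have Ph := (exp_closed PAn).1 Pgn.
apply/(exp_closed PAn1) => n.
have [oddn|evn] := boolP (odd n); first by rewrite h_odd //; apply: fsubalg0.
have := odd_double_half n; rewrite (negbTE evn) add0n => <-.
case: (n./2) => [|i]; first by rewrite h0; apply: fsubalg1.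
rewrite doubleS h_even; apply: fsubalgB => //; first exact: fsubalgC.
apply: fsubalgCM => //; apply: rsum_closed => j.
apply: (@fsubalgCMI _ _ PAn (c j)) => //.
have -> : fC (c j) * rsum K B j.*2.+1 0 = fC (kappa j) - h j.*2.+2.
  by rewrite h_even opprB addrC subrK.
by apply: fsubalgB => //; apply: fsubalgC.
Qed.
End Exponential.
End FormalClosure.

(** * Complex sequences and series *)

Import Normc.

Lemma sum_ord_split (V : nmodType) (F : nat -> V) n m : (n <= m)%N ->
  \sum_(i < m) F i = \sum_(i < n) F i + \sum_(i < m - n) F (n + i)%N.
Proof. by move/subnKC => E; move: (m - n)%N E => d <-; rewrite big_split_ord. Qed.

Section Modulus.
Variable R : realType.
Implicit Types (x y z : C R) (u v : nat -> C R).

Definition cn x : R := normc (x : R[i]).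

Lemma cnE x : `|x| = (cn x)%:C%C. Proof. by []. Qed.
Lemma cn_ge0 x : 0 <= cn x.
Proof. by have := normr_ge0 x; rewrite cnE ler0c. Qed.
Lemma cnM x y : cn (x * y) = cn x * cn y. Proof. exact: normcM. Qed.
Lemma cnN x : cn (- x) = cn x. Proof. exact: normcN. Qed.
Lemma cnV x : cn x^-1 = (cn x)^-1. Proof. exact: normcV. Qed.
Lemma cnD x y : cn (x + y) <= cn x + cn y. Proof. exact: le_normcD. Qed.
Lemma cn0 : cn 0 = 0. Proof. exact: normc0. Qed.
Lemma cn1 : cn 1 = 1. Proof. exact: normc1. Qed.
Lemma cn_eq0 x : (cn x == 0) = (x == 0).
Proof. by apply/eqP/eqP => [/eq0_normc|->] //; apply: cn0. Qed.
Lemma cn_gt0 x : (0 < cn x) = (x != 0).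
Proof. by rewrite lt_def cn_ge0 andbT cn_eq0. Qed.
Lemma cnB x y : cn (x - y) <= cn x + cn y.
Proof. by apply: le_trans (cnD _ _) _; rewrite cnN. Qed.
Lemma cnC x y : cn (x - y) = cn (y - x).
Proof. by rewrite -cnN opprB. Qed.
Lemma cnX x n : cn (x ^+ n) = cn x ^+ n.
Proof. by elim: n => [|n IHn]; rewrite ?expr0 ?cn1 // !exprS cnM IHn. Qed.
Lemma cn_real (r : R) : cn r%:C%C = `|r|.
Proof. by rewrite /cn /= expr0n addr0 sqrtr_sqr. Qed.
Lemma cn_nat n : cn n%:R = n%:R.
Proof.
have -> : n%:R = (n%:R : R)%:C%C :> C R by rewrite rmorph_nat.
by rewrite cn_real ger0_norm.
Qed.
Lemma cn_sum (I : Type) (r : seq I) (P : pred I) (F : I -> C R) :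
  cn (\sum_(i <- r | P i) F i) <= \sum_(i <- r | P i) cn (F i).
Proof.
elim/big_rec2: _ => [|i y x _ le_xy]; first by rewrite cn0.
by apply: le_trans (cnD _ _) _; rewrite lerD2l.
Qed.
Lemma cn_Re x : `|complex.Re x| <= cn x.
Proof. by have := normc_ge_Re (x : R[i]); rewrite [X in _ <= X]cnE lecR. Qed.
Lemma cn_Im x : `|complex.Im x| <= cn x.
Proof.
case: x => a b; rewrite /cn /= -sqrtr_sqr; apply: ler_wsqrtr.
by rewrite lerDr sqr_ge0.
Qed.
Lemma cn_ReIm x : cn x <= `|complex.Re x| + `|complex.Im x|.
Proof.
case: x => a b; rewrite /cn /=.
have ab_ge0 : 0 <= `|a| + `|b| by rewrite addr_ge0.
rewrite -[leRHS]ger0_norm // -sqrtr_sqr; apply: ler_wsqrtr.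
by rewrite sqrrD !real_normK ?num_real // addrAC lerDl mulrn_wge0 // mulr_ge0.
Qed.

(** Convergence through the real-valued modulus keeps all estimates in R; [Cto_cvg] and [cvg_Cto]
    translate to filters. *)
Definition Cto u (l : C R) := forall e : R, 0 < e ->
  exists N, forall n, (N <= n)%N -> cn (u n - l) < e.

Lemma Cto_cvg u l : Cto u l -> (u @ \oo --> l)%classic.
Proof.
move=> ul; apply/cvgrPdist_lt => e e_gt0.
have /andP[/eqP Ie Re_gt0] : (complex.Im e == 0) && (0 < complex.Re e).
  by move: e_gt0; rewrite ltcE /= => /andP[-> ->].
have [N HN] := ul _ Re_gt0.
exists N => // n /= le_Nn; rewrite cnE cnC.
have -> : e = (complex.Re e)%:C%C by apply/eqP; rewrite eq_complex /= Ie !eqxx.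
by rewrite ltcR; apply: HN.
Qed.

Lemma cvg_Cto u l : (u @ \oo --> l)%classic -> Cto u l.
Proof.
move=> /cvgrPdist_lt ul e e_gt0.
have /ul[N _ HN] : 0 < e%:C%C :> C R by rewrite ltcR.
by exists N => n le_Nn; have := HN n le_Nn; rewrite /= cnE ltcR cnC.
Qed.

Lemma Cto_lim u l : Cto u l -> limn u = l.
Proof. by move/Cto_cvg/cvg_lim; apply. Qed.

Lemma Cto_unique u l l' : Cto u l -> Cto u l' -> l = l'.
Proof. by move=> /Cto_lim <- /Cto_lim <-. Qed.

Lemma eq_Cto u v l : (forall n, u n = v n) -> Cto u l -> Cto v l.
Proof. by move=> uv ul e /ul[N HN]; exists N => n /HN; rewrite uv. Qed.

Lemma Cto_cst l : Cto (fun=> l) l.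
Proof. by move=> e e_gt0; exists 0%N => n _; rewrite subrr cn0. Qed.

Lemma Cto_shift u l k : Cto (fun n => u (n + k)%N) l <-> Cto u l.
Proof.
split=> ul e /ul[N HN]; [exists (N + k)%N => n le_n | exists N => n le_n].
  by have := HN (n - k)%N; rewrite subnK; [apply; lia | lia].
by apply: HN; lia.
Qed.

Lemma CtoD u v l m : Cto u l -> Cto v m -> Cto (fun n => u n + v n) (l + m).
Proof.
move=> ul vm e e_gt0; have e2 : 0 < e / 2 by lra.
have [N HN] := ul _ e2; have [M HM] := vm _ e2.
exists (maxn N M) => n; rewrite geq_max => /andP[/HN lt1 /HM lt2].
rewrite opprD addrACA; apply: le_lt_trans (cnD _ _) _; lra.
Qed.

Lemma CtoMl u l c : Cto u l -> Cto (fun n => c * u n) (c * l).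
Proof.
move=> ul e e_gt0; have c1 : 0 < cn c + 1 by have := cn_ge0 c; lra.
have [N HN] := ul _ (divr_gt0 e_gt0 c1); exists N => n /HN.
rewrite -mulrBr cnM ltr_pdivlMr // => lt_e.
apply: le_lt_trans lt_e; rewrite mulrC ler_wpM2l ?cn_ge0 //; lra.
Qed.

Lemma CtoN u l : Cto u l -> Cto (fun n => - u n) (- l).
Proof. by move=> /(@CtoMl _ _ (-1)); rewrite mulN1r; apply: eq_Cto => n; rewrite mulN1r. Qed.

Lemma CtoB u v l m : Cto u l -> Cto v m -> Cto (fun n => u n - v n) (l - m).
Proof. by move=> ul vm; apply/CtoD/CtoN. Qed.

Lemma Cto_bounded u l : Cto u l -> exists M, forall n, cn (u n) <= M.
Proof.
move=> /(_ 1 ltr01)[N HN]; exists (\sum_(i < N) cn (u i) + (cn l + 1)) => n.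
have S_ge0 : 0 <= \sum_(i < N) cn (u i) by apply: sumr_ge0 => i _; apply: cn_ge0.
have [lt_nN|le_Nn] := ltnP n N.
  rewrite (bigD1 (Ordinal lt_nN)) //= -addrA lerDl.
  by apply: addr_ge0; [apply: sumr_ge0 => i _; apply: cn_ge0 | have := cn_ge0 l; lra].
have := HN n le_Nn; have : cn (u n) <= cn (u n - l) + cn l.
  by rewrite -{1}(subrK l (u n)) cnD.
by lra.
Qed.

Lemma CtoM u v l m : Cto u l -> Cto v m -> Cto (fun n => u n * v n) (l * m).
Proof.
move=> ul vm; have [M HM] := Cto_bounded ul.
have M_ge0 : 0 <= M by apply: le_trans (cn_ge0 (u 0%N)) (HM 0%N).
have H1 : Cto (fun n => u n * (v n - m)) 0.
  move=> e e_gt0; have M1 : 0 < M + 1 by lra.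
  have [N HN] := vm _ (divr_gt0 e_gt0 M1); exists N => n /HN.
  rewrite subr0 cnM ltr_pdivlMr // => lt_e; apply: le_lt_trans lt_e.
  by rewrite mulrC ler_wpM2l ?cn_ge0 //; have := HM n; lra.
have := CtoD H1 (CtoMl m ul); rewrite add0r mulrC.
by apply: eq_Cto => n; ring.
Qed.

Lemma Cto_sum (I : Type) (r : seq I) (P : pred I) (F : I -> nat -> C R) (L : I -> C R) :
  (forall i, P i -> Cto (F i) (L i)) ->
  Cto (fun n => \sum_(i <- r | P i) F i n) (\sum_(i <- r | P i) L i).
Proof.
move=> FL; elim: r => [|i r IHr].
  by rewrite big_nil; apply: eq_Cto (Cto_cst _) => n; rewrite big_nil.
rewrite big_cons; case: ifP => Pi; last first.
  by apply: eq_Cto IHr => n; rewrite big_cons Pi.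
by apply: eq_Cto (CtoD (FL i Pi) IHr) => n; rewrite big_cons Pi.
Qed.

Lemma Cto_le u l M : Cto u l -> (forall n, cn (u n) <= M) -> cn l <= M.
Proof.
move=> ul uM; rewrite leNgt; apply/negP => lt_M.
have [N HN] := ul (cn l - M) ltac:(lra); have := HN N (leqnn N).
have : cn l <= cn (u N - l) + cn (u N) by rewrite cnC -{1}(subrK (u N) l) cnD.
by have := uM N; lra.
Qed.

Lemma Cto_ReIm u (a b : R) :
  ((fun n => complex.Re (u n)) @ \oo --> a)%classic ->
  ((fun n => complex.Im (u n)) @ \oo --> b)%classic -> Cto u (a +i* b)%C.
Proof.
move=> /cvgrPdist_lt ua /cvgrPdist_lt ub e e_gt0; have e2 : 0 < e / 2 by lra.
have [N _ HN] := ua _ e2; have [M _ HM] := ub _ e2.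
exists (maxn N M) => n; rewrite geq_max => /andP[/HN /= lt1 /HM /= lt2].
apply: le_lt_trans (cn_ReIm _) _; move: lt1 lt2.
rewrite -normrN opprB -[`|b - _|]normrN opprB.
by case: (u n) => c d /=; lra.
Qed.

Definition bsum (a : nat -> R) := exists M, forall N, \sum_(i < N) a i <= M.
Definition Csum u l := Cto (fun N => \sum_(i < N) u i) l.

(** If every tail had a block exceeding e, disjoint blocks would add up beyond the bound. *)
Lemma bsum_tail (a : nat -> R) : (forall i, 0 <= a i) -> bsum a ->
  forall e, 0 < e -> exists N, forall n, (N <= n)%N -> \sum_(i < n - N) a (N + i)%N <= e.
Proof.
move=> a_ge0 [M HM] e e_gt0; apply: contrapT => no.
have step N : exists n, (N <= n)%N /\ e < \sum_(i < n - N) a (N + i)%N.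
  apply: contrapT => noN; apply: no; exists N => n le_Nn; rewrite leNgt; apply/negP => lt_e.
  by apply: noN; exists n.
have big k : exists n, k%:R * e <= \sum_(i < n) a i.
  elim: k => [|k [n IHk]]; first by exists 0%N; rewrite big_ord0 mul0r.
  have [m [le_nm lt_e]] := step n; exists m.
  rewrite (sum_ord_split _ le_nm) -natr1 mulrDl mul1r; lra.
have [n Hn] := big (Num.bound `|M / e|).
have := HM n; have : M < (Num.bound `|M / e|)%:R * e.
  rewrite -ltr_pdivrMr //; apply: le_lt_trans (ler_norm _) _.
  by apply: archi_boundP; apply: normr_ge0.
lra.
Qed.

Lemma bsum_Csum u : bsum (fun i => cn (u i)) -> exists l, Csum u l.
Proof.
move=> [M HM].
have real (f : C R -> R) : (forall z, `|f z| <= cn z) ->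
    exists a : R, ((fun N => \sum_(i < N) f (u i)) @ \oo --> a)%classic.
  move=> fle.
  have cvn : cvgn (series (fun i => `|f (u i)|)).
    apply: nondecreasing_is_cvgn.
      by apply/nondecreasing_seqP => n; rewrite seriesSr lerDl.
    exists M => _ [n _ <-]; rewrite seriesEord /=.
    by apply: le_trans (HM n); apply: ler_sum => i _; apply: fle.
  have cv : cvgn (series (fun i => f (u i))) by apply: normed_cvg.
  exists (limn (series (fun i => f (u i)))).
  rewrite (_ : (fun N => _) = series (fun i => f (u i))) //.
  by apply/funext => N; rewrite /series /= big_mkord.
have [a Ha] := real _ cn_Re; have [b Hb] := real _ cn_Im.
exists (a +i* b)%C; apply: Cto_ReIm.
  rewrite (_ : (fun n => _) = (fun N => \sum_(i < N) complex.Re (u i))) //.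
  by apply/funext => N; elim/big_rec2: _ => //= i y x _ <-; case: (u i); case: x.
rewrite (_ : (fun n => _) = (fun N => \sum_(i < N) complex.Im (u i))) //.
by apply/funext => N; elim/big_rec2: _ => //= i y x _ <-; case: (u i); case: x.
Qed.

Lemma CsumD u v l m : Csum u l -> Csum v m -> Csum (fun i => u i + v i) (l + m).
Proof. by move=> ul vm; apply: eq_Cto (CtoD ul vm) => N; rewrite big_split. Qed.
Lemma CsumMl u l c : Csum u l -> Csum (fun i => c * u i) (c * l).
Proof. by move=> ul; apply: eq_Cto (CtoMl c ul) => N; rewrite mulr_sumr. Qed.
Lemma eq_Csum u v l : (forall n, u n = v n) -> Csum u l -> Csum v l.
Proof. by move=> uv; apply: eq_Cto => N; apply: eq_bigr. Qed.
Lemma Csum_unique u l l' : Csum u l -> Csum u l' -> l = l'.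
Proof. exact: Cto_unique. Qed.

Lemma Csum_fin u n : (forall i, (n <= i)%N -> u i = 0) -> Csum u (\sum_(i < n) u i).
Proof.
move=> u0 e e_gt0; exists n => m le_nm.
rewrite (sum_ord_split _ le_nm) [X in _ + X - _]big1 ?addr0 ?subrr ?cn0 // => i _.
by rewrite u0 // leq_addr.
Qed.

Lemma Csum_recl u l : Csum u l <-> Csum (fun i => u i.+1) (l - u 0%N).
Proof.
split=> ul.
  have := CtoB ((Cto_shift _ _ 1).2 ul) (Cto_cst (u 0%N)); apply: eq_Cto => n.
  by rewrite addn1 big_ord_recl addrC addKr.
apply/(Cto_shift _ _ 1).
rewrite -(subrK (u 0%N) l); apply: eq_Cto (CtoD ul (Cto_cst (u 0%N))) => n.
by rewrite addn1 big_ord_recl addrC.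
Qed.

Lemma Csum_le u l M : Csum u l -> (forall N, \sum_(i < N) cn (u i) <= M) -> cn l <= M.
Proof. by move=> ul uM; apply: Cto_le ul _ => N; apply: le_trans (cn_sum _ _ _) (uM N). Qed.

Lemma Csum_tail_le u l (m : nat -> R) N e : Csum u l -> (forall i, cn (u i) <= m i) ->
  (forall n, (N <= n)%N -> \sum_(i < n - N) m (N + i)%N <= e) ->
  cn (l - \sum_(i < N) u i) <= e.
Proof.
move=> ul um tail.
have : Cto (fun n => \sum_(i < n) u (N + i)%N) (l - \sum_(i < N) u i).
  have := CtoB ((Cto_shift _ _ N).2 ul) (Cto_cst (\sum_(i < N) u i)).
  apply: eq_Cto => n; by rewrite addnC big_split_ord /=; ring.
move/Cto_le; apply=> n; apply: le_trans (cn_sum _ _ _) _.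
by have := tail (N + n)%N (leq_addr _ _); rewrite addKn; apply: le_trans; apply: ler_sum.
Qed.

(** Dominated convergence for series: beyond a cut both tails are at most e/4, and the finite part
    converges termwise. *)
Lemma tannery (a : nat -> nat -> C R) (l A : nat -> C R) (m : nat -> R) L :
  (forall N i, cn (a N i) <= m i) -> bsum m ->
  (forall i, Cto (fun N => a N i) (l i)) ->
  (forall N, Csum (a N) (A N)) -> Csum l L -> Cto A L.
Proof.
move=> am bm al aA lL e e_gt0.
have m_ge0 i : 0 <= m i by apply: le_trans (am 0%N i); apply: cn_ge0.
have lm i : cn (l i) <= m i by apply: Cto_le (al i) _ => N.
have e4 : 0 < e / 4 by lra.
have [N HN] := bsum_tail m_ge0 bm e4.
have [M HM] := Cto_sum (index_enum 'I_N) (P := predT) (fun i _ => al i) e4.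
exists M => n le_Mn.
have := HM n le_Mn; have := Csum_tail_le lL lm HN; have := Csum_tail_le (aA n) (am n) HN.
set x := \sum_(i < N) a n i; set y := \sum_(i < N) l i => h1 h2 h3.
have -> : A n - L = (A n - x) + (x - y) - (L - y) by ring.
apply: le_lt_trans (cnB _ _) _; have := cnD (A n - x) (x - y); lra.
Qed.

(** Tannery's theorem for the partial sums of the rows, which [m] dominates. *)
Lemma fubini (a : nat -> nat -> C R) (r c : nat -> C R) (m : nat -> R) S :
  (forall i J, \sum_(j < J) cn (a i j) <= m i) -> bsum m ->
  (forall i, Csum (a i) (r i)) -> (forall j, Csum (a^~ j) (c j)) ->
  Csum r S -> Csum c S.
Proof.
move=> am bm ar ac rS.
apply: (@tannery (fun J i => \sum_(j < J) a i j) r _ m) => //.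
  by move=> J i; apply: le_trans (cn_sum _ _ _) _.
move=> J; have : Cto (fun N => \sum_(j < J) \sum_(i < N) a i j) (\sum_(j < J) c j).
  by apply: Cto_sum => j _; apply: ac.
by apply: eq_Cto => N; rewrite exchange_big.
Qed.

Lemma geo_bsum (r : R) : 0 <= r -> r < 1 -> forall N, \sum_(i < N) r ^+ i <= (1 - r)^-1.
Proof.
move=> r_ge0 r_lt1 N; have r1 : 0 < 1 - r by lra.
rewrite -[leRHS]mul1r ler_pdivlMr // mulrC.
have -> : (1 - r) * \sum_(i < N) r ^+ i = 1 - r ^+ N.
  by rewrite -opprB mulNr -subrX1 opprB.
by rewrite gerBl exprn_ge0.
Qed.

Lemma geo_Csum (z : C R) : cn z < 1 -> Csum (fun i => z ^+ i) (1 - z)^-1.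
Proof.
move=> z1; have z_ne : 1 - z != 0.
  rewrite subr_eq0; apply/negP => /eqP z1'; by move: z1; rewrite -z1' cn1 ltxx.
have [l Hl] : exists l, Csum (fun i => z ^+ i) l.
  apply: bsum_Csum; exists (1 - cn z)^-1 => N.
  under eq_bigr => i _ do rewrite cnX.
  by apply: geo_bsum => //; apply: cn_ge0.
suff -> : (1 - z)^-1 = l by [].
have := (Csum_recl _ _).1 Hl; rewrite expr0 => H1.
have H2 := CsumMl z Hl.
have E : l - 1 = z * l by apply: Csum_unique H1 _; apply: eq_Csum H2 => n; rewrite exprS.
apply: (mulfI z_ne); rewrite mulfV // mulrBl mul1r -E; ring.
Qed.

End Modulus.

(** * Evaluation of power series *)

Section PowerSeries.
Variable R : realType.
Notation CR := (C R).
Notation S := (fps CR).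
Implicit Types (a b : S) (r rho : R) (w h : CR).

(** Radius of convergence at least r, as a Cauchy bound on every smaller circle; such bounds are
    easy to carry through products and derivations. *)
Definition pconv r a := forall rho, 0 < rho -> rho < r ->
  exists M, forall n, cn (a n) * rho ^+ n <= M.

Definition ev a w : CR := limn (fun N => \sum_(i < N) a i * w ^+ i).

Lemma pconv_bound r a rho : pconv r a -> 0 <= rho -> rho < r ->
  exists M, forall N, \sum_(i < N) cn (a i) * rho ^+ i <= M.
Proof.
move=> ca rho_ge0 lt_rho; pose t := (rho + r) / 2.
have t_gt0 : 0 < t by rewrite /t; lra.
have [M HM] := ca t t_gt0 ltac:(rewrite /t; lra).
have q_ge0 : 0 <= rho / t by rewrite divr_ge0 // ltW.
have q_lt1 : rho / t < 1 by rewrite ltr_pdivrMr // mul1r /t; lra.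
have M_ge0 : 0 <= M by apply: le_trans (HM 0%N); rewrite mulr_ge0 ?cn_ge0.
exists (M * (1 - rho / t)^-1) => N.
apply: le_trans (ler_wpM2l M_ge0 (geo_bsum q_ge0 q_lt1 N)).
rewrite mulr_sumr; apply: ler_sum => i _; rewrite expr_div_n.
have ti : 0 < t ^+ i by rewrite exprn_gt0.
rewrite mulrA ler_pdivlMr // mulrAC ler_wpM2r ?exprn_ge0 //.
Qed.

Lemma pconv_bsum r a w : pconv r a -> cn w < r -> bsum (fun i => cn (a i * w ^+ i)).
Proof.
move=> ca lt_w; have [M HM] := pconv_bound ca (cn_ge0 w) lt_w; exists M => N.
by apply: le_trans (HM N); apply: ler_sum => i _; rewrite cnM cnX.
Qed.

Lemma evP r a w : pconv r a -> cn w < r -> Csum (fun i => a i * w ^+ i) (ev a w).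
Proof.
by move=> ca lt_w; have [l Hl] := bsum_Csum (pconv_bsum ca lt_w); rewrite /ev (Cto_lim Hl).
Qed.

Lemma ev_eq a w l : Csum (fun i => a i * w ^+ i) l -> ev a w = l.
Proof. exact: Cto_lim. Qed.

Lemma ev_bound r a rho : pconv r a -> 0 <= rho -> rho < r ->
  exists M, forall w, cn w <= rho -> cn (ev a w) <= M.
Proof.
move=> ca rho_ge0 lt_rho; have [M HM] := pconv_bound ca rho_ge0 lt_rho.
exists M => w le_w; apply: (Csum_le (evP ca (le_lt_trans le_w lt_rho))) => N.
apply: le_trans (HM N); apply: ler_sum => i _; rewrite cnM cnX ler_wpM2l ?cn_ge0 //.
by rewrite lerXn2r ?nnegrE ?cn_ge0.
Qed.

Lemma pconv_fC r (c : CR) : pconv r (fC c).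
Proof.
move=> rho _ _; exists (cn c) => n; rewrite fcoefC; case: n => [|n]; first by rewrite expr0 mulr1.
by rewrite mulr0n cn0 mul0r cn_ge0.
Qed.

Lemma pconvD r a b : pconv r a -> pconv r b -> pconv r (a + b).
Proof.
move=> ca cb rho rho_gt0 lt_rho.
have [M HM] := ca _ rho_gt0 lt_rho; have [N HN] := cb _ rho_gt0 lt_rho.
exists (M + N) => n; rewrite fcoefD; apply: le_trans (lerD (HM n) (HN n)).
by rewrite -mulrDl ler_wpM2r ?cnD // exprn_ge0 // ltW.
Qed.

Lemma pconvM r a b : pconv r a -> pconv r b -> pconv r (a * b).
Proof.
move=> ca cb rho rho_gt0 lt_rho.
have [M HM] := pconv_bound ca (ltW rho_gt0) lt_rho; have [N HN] := cb _ rho_gt0 lt_rho.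
have N_ge0 : 0 <= N by apply: le_trans (HN 0%N); rewrite mulr_ge0 ?cn_ge0 ?exprn_ge0 // ltW.
exists (M * N) => n; apply: le_trans (ler_wpM2r N_ge0 (HM n.+1)).
rewrite fcoefM mulr_suml; apply: le_trans (ler_wpM2r _ (cn_sum _ _ _)) _.
  by rewrite exprn_ge0 // ltW.
rewrite mulr_suml; apply: ler_sum => i _.
have le_in : (i <= n)%N by rewrite -ltnS.
have -> : rho ^+ n = rho ^+ i * rho ^+ (n - i) by rewrite -exprD subnKC.
rewrite cnM mulrACA.
by rewrite ler_wpM2l // mulr_ge0 ?cn_ge0 ?exprn_ge0 // ltW.
Qed.

Lemma pconv_eu r a : pconv r a -> pconv r (eu a).
Proof.
move=> ca rho rho_gt0 lt_rho; pose t := (rho + r) / 2.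
have t_gt0 : 0 < t by rewrite /t; lra.
have [M HM] := ca t t_gt0 ltac:(rewrite /t; lra).
have q_ge0 : 0 <= rho / t by rewrite divr_ge0 // ltW.
have q_lt1 : rho / t < 1 by rewrite ltr_pdivrMr // mul1r /t; lra.
exists (M * (1 - rho / t)^-1) => n; rewrite fcoef_eu -mulr_natl cnM cn_nat.
have M_ge0 : 0 <= M by apply: le_trans (HM 0%N); rewrite mulr_ge0 ?cn_ge0.
apply: le_trans (ler_wpM2l M_ge0 (geo_bsum q_ge0 q_lt1 n)).
have le1 : n%:R * (rho / t) ^+ n <= \sum_(i < n) (rho / t) ^+ i.
  rewrite -[n in n%:R]card_ord -sumr_const mulr_suml; apply: ler_sum => i _.
  by rewrite mul1r; apply: ler_wiXn2l; rewrite ?(ltW q_lt1) ?(ltnW (ltn_ord i)).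
apply: le_trans (ler_wpM2l M_ge0 le1).
have ti : 0 < t ^+ n by rewrite exprn_gt0.
rewrite expr_div_n mulrA [M * _]mulrC -mulrA -mulrA ler_wpM2l //.
by rewrite mulrA ler_pdivlMr // mulrAC ler_wpM2r ?exprn_ge0 // ltW.
Qed.

Definition tl a : S := Fps (fun n => a n.+1).
Definition fder a : S := tl (eu a).

Lemma pconv_tl r a : pconv r a -> pconv r (tl a).
Proof.
move=> ca rho rho_gt0 lt_rho; have [M HM] := ca _ rho_gt0 lt_rho.
exists (M / rho) => n; rewrite ler_pdivlMr // -mulrA -exprSr; exact: HM.
Qed.

Lemma evD r a b w : pconv r a -> pconv r b -> cn w < r -> ev (a + b) w = ev a w + ev b w.
Proof.
move=> ca cb lt_w; apply: ev_eq; have := CsumD (evP ca lt_w) (evP cb lt_w).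
by apply: eq_Csum => n; rewrite fcoefD mulrDl.
Qed.

Lemma ev_fC (c : CR) w : ev (fC c) w = c.
Proof.
apply: ev_eq; have := @Csum_fin _ (fun i => fC c i * w ^+ i) 1; rewrite big_ord1 expr0 mulr1.
by apply=> -[|i] //= _; rewrite mul0r.
Qed.

Lemma ev_tl r a w : pconv r a -> cn w < r -> ev a w = a 0%N + w * ev (tl a) w.
Proof.
move=> ca lt_w; apply: ev_eq; apply/Csum_recl; rewrite expr0 mulr1 addrC addKr.
have := CsumMl w (evP (pconv_tl ca) lt_w).
by apply: eq_Csum => n; rewrite /= exprS; ring.
Qed.

Lemma evM r a b w : pconv r a -> pconv r b -> cn w < r -> ev (a * b) w = ev a w * ev b w.
Proof.
move=> ca cb lt_w; apply: ev_eq.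
have [B HB] := pconv_bound cb (cn_ge0 w) lt_w.
(* Row i is a_i w^i times a shifted copy of the series of b; column j is the j-th Cauchy
   coefficient. *)
pose F i j := if (i <= j)%N then a i * w ^+ i * (b (j - i)%N * w ^+ (j - i)) else 0.
pose m i := cn (a i * w ^+ i) * B.
apply: (@fubini R F (fun i => a i * w ^+ i * ev b w) _ m).
- move=> i J; rewrite /m.
  have B_ge0 : 0 <= B by have := HB 0%N; rewrite big_ord0.
  have [le_iJ|lt_Ji] := leqP i J; last first.
    rewrite big1 ?mulr_ge0 ?cn_ge0 // => j _.
    by rewrite /F leqNgt (ltn_trans (ltn_ord j)) ?cn0.
  rewrite (sum_ord_split (fun j => cn (F i j)) le_iJ) big1 ?add0r => [|j _]; last first.
    by rewrite /F leqNgt ltn_ord cn0.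
  apply: le_trans (ler_wpM2l (cn_ge0 _) (HB (J - i)%N)); rewrite mulr_sumr.
  by apply: ler_sum => j _; rewrite /F leq_addr addKn cnM [cn (b j * _)]cnM cnX.
- have [M HM] := pconv_bsum ca lt_w; exists (M * B) => N.
  by rewrite -mulr_suml ler_wpM2r //; have := HB 0%N; rewrite big_ord0.
- move=> i; apply/(Cto_shift _ _ i).
  have := CsumMl (a i * w ^+ i) (evP cb lt_w); apply: eq_Cto => N.
  rewrite [RHS](sum_ord_split (F i) (leq_addl N i)) [X in _ = X + _]big1 ?add0r => [|j _]; last first.
    by rewrite /F leqNgt ltn_ord.
  by rewrite addnK; apply: eq_bigr => j _; rewrite /F leq_addr addKn.
- move=> j; have := @Csum_fin _ (F^~ j) j.+1.
  rewrite (_ : \sum_(i < j.+1) F i j = (a * b) j * w ^+ j).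
    by apply=> i lt_ji; rewrite /F leqNgt lt_ji.
  rewrite fcoefM mulr_suml; apply: eq_bigr => i _; rewrite /F -ltnS ltn_ord.
  have le_ij : (i <= j)%N by rewrite -ltnS.
  have -> : w ^+ j = w ^+ i * w ^+ (j - i) by rewrite -exprD subnKC.
  ring.
- have := CsumMl (ev b w) (evP ca lt_w); rewrite mulrC.
  by apply: eq_Csum => n; rewrite mulrC.
Qed.

(** Where the sum vanishes, a_0 is -w times a bounded function; a small real w contradicts a_0 != 0.
    Only the punctured disc is available, because the identity defining the f_{k,j} holds away from
    z = 0. *)
Lemma ev_head_eq0 r d a : 0 < r -> 0 < d -> pconv r a ->
  (forall w, 0 < cn w -> cn w < d -> ev a w = 0) -> a 0%N = 0.
Proof.
move=> r_gt0 d_gt0 ca a0.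
apply/eqP; rewrite -cn_eq0; apply/eqP/le_anti; rewrite cn_ge0 andbT.
have [M HM] := ev_bound (pconv_tl ca) (ltac:(lra) : 0 <= r / 2) (ltac:(lra) : r / 2 < r).
have M_ge0 : 0 <= M by apply: le_trans (HM 0 _); rewrite ?cn_ge0 // cn0; lra.
rewrite leNgt; apply/negP => a0_gt0.
pose m := Num.min (Num.min (r / 2) (d / 2)) (cn (a 0%N) / 2 / (M + 1)).
have m_gt0 : 0 < m.
  by rewrite !lt_min !divr_gt0 //; lra.
have [m1 m2 m3] : [/\ m <= r / 2, m <= d / 2 & m * (M + 1) <= cn (a 0%N) / 2].
  split; rewrite /m ?ge_min ?lexx ?orbT //.
  by rewrite -ler_pdivlMr; [rewrite ge_min lexx orbT | lra].
have cm : cn m%:C%C = m by rewrite cn_real gtr0_norm.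
have := a0 m%:C%C; rewrite cm => /(_ m_gt0 ltac:(lra)).
rewrite (ev_tl ca); last by rewrite cm; lra.
move=> /eqP; rewrite addr_eq0 => /eqP E.
have : cn (a 0%N) <= m * M.
  by rewrite E cnN cnM cm ler_wpM2l //; [lra | apply: HM; rewrite cm].
nra.
Qed.

Lemma ev_coef_eq0 r d a : 0 < r -> 0 < d -> pconv r a ->
  (forall w, 0 < cn w -> cn w < d -> ev a w = 0) -> forall n, a n = 0.
Proof.
move=> r_gt0 d_gt0 ca a0 n; pose d' := Num.min r d.
have d'_gt0 : 0 < d' by rewrite lt_min r_gt0.
have {}a0 w : 0 < cn w -> cn w < d' -> ev a w = 0.
  by rewrite lt_min => w_gt0 /andP[_]; apply: a0.
elim: n a ca a0 => [|n IHn] a ca a0; first exact: (ev_head_eq0 r_gt0 d'_gt0 ca).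
apply: (IHn (tl a)); first exact: pconv_tl.
move=> w w_gt0 w_lt; have := a0 w w_gt0 w_lt.
rewrite (ev_tl ca); last by move: w_lt; rewrite lt_min => /andP[].
rewrite (ev_head_eq0 r_gt0 d'_gt0 ca a0) add0r => /eqP; rewrite mulf_eq0.
by rewrite -cn_eq0 gt_eqF // => /eqP.
Qed.

(* Second order control of the remainder implies complex differentiability and,
   unlike a limit, is stable under composition by elementary estimates. *)
Definition Der (f : CR -> CR) w d := exists M e, 0 < e /\
  forall h, cn h < e -> cn (f (w + h) - f w - h * d) <= M * cn h ^+ 2.

Lemma DerE f w d : Der f w d -> derivable f w 1 /\ derive1 f w = d.
Proof.
move=> [M [e [e_gt0 Hf]]].
suff H : ((fun h => h^-1 *: (f (h *: 1 + w) - f w)) @ (0 : CR)^' --> d)%classic.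
  split; first by apply/cvg_ex; exists d.
  rewrite derive1E; apply: cvg_lim => //.
apply/cvgrPdist_lt => eps eps_gt0.
have [Ie Re_gt0] : complex.Im eps = 0 /\ 0 < complex.Re eps.
  by move: eps_gt0; rewrite ltcE /= => /andP[/eqP -> ->].
pose M' := `|M| + 1; have M'_gt0 : 0 < M' by rewrite /M'; have := normr_ge0 M; lra.
pose t := Num.min e (complex.Re eps / M').
have t_gt0 : 0 < t by rewrite lt_min e_gt0 divr_gt0.
have t_gt0C : 0 < (t%:C%C : CR) by rewrite ltcR.
exists t%:C%C => //= h /=; rewrite sub0r normrN cnE ltcR => lt_h h_neq0.
have h_gt0 : 0 < cn h by rewrite cn_gt0.
have -> : eps = (complex.Re eps)%:C%C by apply/eqP; rewrite eq_complex /= Ie !eqxx.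
rewrite cnE ltcR cnC -[_ *: 1]/(h * 1) -[_ *: (_ - _)]/(h^-1 * (_ - _)) mulr1 [h + w]addrC.
have -> : h^-1 * (f (w + h) - f w) - d = h^-1 * (f (w + h) - f w - h * d).
  by rewrite [RHS]mulrBr mulKf.
move: lt_h; rewrite lt_min => /andP[lt_he lt_hM].
rewrite cnM cnV; apply: le_lt_trans (_ : `|M| * cn h < _).
  rewrite mulrC ler_pdivrMr // -mulrA -expr2; apply: le_trans (Hf h lt_he) _.
  by rewrite ler_wpM2r ?exprn_ge0 ?cn_ge0 // ler_norm.
have := lt_hM; rewrite ltr_pdivlMr // /M'; have := normr_ge0 M; nra.
Qed.

Lemma Der_bound f w d : Der f w d -> exists M e, [/\ 0 < e, e <= 1, 0 <= M &
  forall h, cn h < e -> cn (f (w + h) - f w - h * d) <= M * cn h ^+ 2 /\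
    cn (f (w + h) - f w) <= (M + cn d) * cn h].
Proof.
move=> [M [e [e_gt0 Hf]]]; exists `|M|, (Num.min e 1).
rewrite lt_min e_gt0 ltr01 ge_min lexx orbT normr_ge0; split=> // h.
rewrite lt_min => /andP[/Hf le1 h1].
have le2 : cn (f (w + h) - f w - h * d) <= `|M| * cn h ^+ 2.
  by apply: le_trans le1 _; rewrite ler_wpM2r ?exprn_ge0 ?cn_ge0 // ler_norm.
split=> //; have := cnD (f (w + h) - f w - h * d) (h * d); rewrite subrK cnM => le3.
have : `|M| * cn h ^+ 2 <= `|M| * cn h.
  by rewrite ler_wpM2l // expr2 -[leRHS]mulr1 ler_wpM2l ?cn_ge0 // ltW.
lra.
Qed.

Lemma eq_Der f g w d : (exists2 e, 0 < e & forall h, cn h < e -> f (w + h) = g (w + h)) ->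
  Der f w d -> Der g w d.
Proof.
move=> [e e_gt0 fg] [M [e' [e'_gt0 Hf]]]; exists M, (Num.min e e').
rewrite lt_min e_gt0 e'_gt0; split=> // h; rewrite lt_min => /andP[lt1 lt2].
have := fg 0; rewrite cn0 addr0 => /(_ e_gt0) <-; rewrite -fg //; exact: Hf.
Qed.

Lemma Der_cst c w : Der (fun=> c) w 0.
Proof.
by exists 0, 1; split=> // h _; rewrite subrr mulr0 subr0 cn0 mul0r.
Qed.

Lemma Der_lin c w : Der (fun z => c * z) w c.
Proof.
exists 0, 1; split=> // h _; rewrite mul0r (_ : _ - _ = 0) ?cn0 //; ring.
Qed.

Lemma DerD f g w d d' : Der f w d -> Der g w d' -> Der (fun z => f z + g z) w (d + d').
Proof.
move=> [M [e [e_gt0 Hf]]] [M' [e' [e'_gt0 Hg]]]; exists (M + M'), (Num.min e e').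
rewrite lt_min e_gt0 e'_gt0; split=> // h; rewrite lt_min => /andP[/Hf lt1 /Hg lt2].
rewrite mulrDl; apply: le_trans (lerD lt1 lt2); apply: le_trans (cnD _ _).
by rewrite le_eqVlt; apply/orP; left; apply/eqP; congr cn; ring.
Qed.

Lemma DerM f g w d d' : Der f w d -> Der g w d' ->
  Der (fun z => f z * g z) w (d * g w + f w * d').
Proof.
move=> /Der_bound[M [e [e_gt0 e1 M_ge0 Hf]]] /Der_bound[M' [e' [e'_gt0 e'1 M'_ge0 Hg]]].
exists (M * cn (g w) + cn (f w) * M' + (M + cn d) * (M' + cn d')), (Num.min e e').
rewrite lt_min e_gt0 e'_gt0; split=> // h; rewrite lt_min => /andP[/Hf[f1 f2] /Hg[g1 g2]].
have -> : f (w + h) * g (w + h) - f w * g w - h * (d * g w + f w * d') =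
  (f (w + h) - f w - h * d) * g w + f w * (g (w + h) - g w - h * d') +
  (f (w + h) - f w) * (g (w + h) - g w) by ring.
apply: le_trans (cnD _ _) _; rewrite [leRHS]mulrDl; apply: lerD.
  apply: le_trans (cnD _ _) _; rewrite [leRHS]mulrDl !cnM; apply: lerD.
    by rewrite mulrAC ler_wpM2r ?cn_ge0.
  by rewrite -mulrA ler_wpM2l ?cn_ge0.
by rewrite cnM expr2 mulrACA ler_pM ?cn_ge0.
Qed.

Lemma Der_comp f g w d d' : Der g w d' -> Der f (g w) d -> Der (f \o g) w (d * d').
Proof.
move=> /Der_bound[M' [e' [e'_gt0 e'1 M'_ge0 Hg]]] /Der_bound[M [e [e_gt0 e1 M_ge0 Hf]]].
pose L := M' + cn d' + 1; have L_gt0 : 0 < L by rewrite /L; have := cn_ge0 d'; lra.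
exists (M * (M' + cn d') ^+ 2 + cn d * M'), (Num.min e' (e / L)).
rewrite lt_min e'_gt0 divr_gt0 //; split=> // h; rewrite lt_min => /andP[/Hg[g1 g2] lt_h] /=.
set k := g (w + h) - g w in g2.
have gk : g (w + h) = g w + k by rewrite /k [RHS]addrC subrK.
have lt_k : cn k < e.
  apply: le_lt_trans g2 _; move: lt_h; rewrite ltr_pdivlMr // /L => lt_h.
  by apply: le_lt_trans lt_h; rewrite mulrC ler_wpM2l ?cn_ge0 //; lra.
have [f1 _] := Hf k lt_k; rewrite gk.
have -> : f (g w + k) - f (g w) - h * (d * d') =
  (f (g w + k) - f (g w) - k * d) + d * (k - h * d') by ring.
apply: le_trans (cnD _ _) _; rewrite [leRHS]mulrDl; apply: lerD.
  apply: le_trans f1 _; rewrite -mulrA -exprMn ler_wpM2l // lerXn2r ?nnegrE ?cn_ge0 //.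
  by rewrite mulr_ge0 ?cn_ge0 // addr_ge0 ?cn_ge0.
by rewrite cnM -mulrA ler_wpM2l ?cn_ge0.
Qed.

(** The factor rho^2 on the left replaces rho^(n-2) on the right, so that n = 0 and n = 1 need no
    separate form. *)
Lemma expr_remainder rho w h n : 0 < rho -> cn w <= rho -> cn (w + h) <= rho ->
  rho ^+ 2 * cn ((w + h) ^+ n - w ^+ n - h * (n%:R * w ^+ n.-1)) <=
  cn h ^+ 2 * (n%:R ^+ 2 * rho ^+ n).
Proof.
move=> rho_gt0 le_w le_wh; elim: n => [|n IHn].
  by rewrite !expr0 mul0r mulr0 subrr subr0 cn0 !mulr0 expr0n mul0r mulr0.
set T := (w + h) ^+ n - _ - _ in IHn.
have -> : (w + h) ^+ n.+1 - w ^+ n.+1 - h * (n.+1%:R * w ^+ n.+1.-1) =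
   (w + h) * T + n%:R * h ^+ 2 * w ^+ n.-1.
  by rewrite /T; case: n {IHn T} => [|n]; rewrite /= ?expr0 ?expr1 -?natr1 ?exprS; ring.
apply: le_trans (ler_wpM2l _ (cnD _ _)) _; first by rewrite exprn_ge0 // ltW.
rewrite mulrDr !cnM -expr2 cnX cn_nat.
have h1 : rho ^+ 2 * (cn (w + h) * cn T) <= rho * (cn h ^+ 2 * (n%:R ^+ 2 * rho ^+ n)).
  rewrite mulrCA; apply: ler_pM => //; rewrite ?cn_ge0 // mulr_ge0 ?cn_ge0 //.
  by rewrite exprn_ge0 // ltW.
have h2 : rho ^+ 2 * (n%:R * cn h ^+ 2 * cn w ^+ n.-1) <= cn h ^+ 2 * (n%:R * rho ^+ n.+1).
  case: n {IHn T h1} => [|n]; first by rewrite !mul0r !mulr0.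
  rewrite (_ : rho ^+ 2 * _ = cn h ^+ 2 * (n.+1%:R * (rho ^+ 2 * cn w ^+ n))); last by ring.
  have -> : rho ^+ n.+2 = rho ^+ 2 * rho ^+ n by rewrite -exprD.
  rewrite ler_wpM2l ?exprn_ge0 ?cn_ge0 // ler_wpM2l // [leLHS]mulrC [leRHS]mulrC.
  by rewrite ler_wpM2r ?exprn_ge0 ?(ltW rho_gt0) // lerXn2r ?nnegrE ?cn_ge0 // ltW.
apply: le_trans (lerD h1 h2) _.
rewrite mulrCA -mulrDr ler_wpM2l ?exprn_ge0 ?cn_ge0 // mulrCA -exprS -mulrDl.
rewrite ler_wpM2r ?exprn_ge0 ?(ltW rho_gt0) // -natr1.
by have : 0 <= n%:R :> R by []; nra.
Qed.

Lemma Der_ev r a w : pconv r a -> cn w < r -> Der (ev a) w (ev (fder a) w).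
Proof.
move=> ca lt_w; pose rho := (cn w + r) / 2.
have w_ge0 := cn_ge0 w.
have rho_gt0 : 0 < rho by rewrite /rho; lra.
have lt_rho : rho < r by rewrite /rho; lra.
(* Two Euler derivations supply the factor n^2 of [expr_remainder]. *)
have [M HM] := pconv_bound (pconv_eu (pconv_eu ca)) (ltW rho_gt0) lt_rho.
exists (M / rho ^+ 2), (rho - cn w); split=> [|h lt_h]; first by rewrite /rho; lra.
have le_w : cn w <= rho by rewrite /rho; lra.
have le_wh : cn (w + h) <= rho by have := cnD w h; lra.
have H1 := evP ca (le_lt_trans le_wh lt_rho); have H2 := evP ca lt_w.
have H3 : Csum (fun i => a i *+ i * w ^+ i.-1) (ev (fder a) w).
  apply/Csum_recl; rewrite mulr0n mul0r subr0.
  exact: (evP (pconv_tl (pconv_eu ca)) lt_w).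
have H := CsumD (CsumD H1 (CsumMl (-1) H2)) (CsumMl (- h) H3).
rewrite !mulN1r in H.
have {}H : Csum (fun i => a i * ((w + h) ^+ i - w ^+ i - h * (i%:R * w ^+ i.-1)))
    (ev a (w + h) - ev a w - h * ev (fder a) w).
  by move: H; rewrite mulNr; apply: eq_Csum => n; rewrite -mulr_natr; ring.
apply: (Csum_le H) => N; rewrite mulrAC ler_pdivlMr ?exprn_gt0 // mulrC mulr_sumr.
rewrite [leRHS]mulrC; apply: le_trans (ler_wpM2l _ (HM N)); last first.
  by rewrite exprn_ge0 ?cn_ge0.
rewrite mulr_sumr; apply: ler_sum => i _.
rewrite cnM mulrCA; apply: le_trans (ler_wpM2l (cn_ge0 _) (expr_remainder i rho_gt0 le_w le_wh)) _.
rewrite !fcoef_eu -mulrnA -[_ *+ (i * i)]mulr_natl cnM cn_nat natrM.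
by rewrite le_eqVlt; apply/orP; left; apply/eqP; ring.
Qed.

End PowerSeries.

(** * The complex exponential *)

Section Exponential.
Variable R : realType.
Notation CR := (C R).
Notation S := (fps CR).
Implicit Types (u v w z : CR).

Definition expf u : S := Fps (fun n => u ^+ n / n`!%:R).

Lemma exp_partial (x : R) N : 0 <= x -> \sum_(i < N) x ^+ i / i`!%:R <= expR x.
Proof.
move=> x_ge0.
have nd : nondecreasing_seq (series (exp_coeff x)).
  by apply/nondecreasing_seqP => n; rewrite seriesSr lerDl exp_coeff_ge0.
by have := nondecreasing_cvgn_le nd (is_cvg_series_exp_coeff x) N; rewrite {1}seriesEord.
Qed.

Lemma pconv_expf r u : pconv r (expf u).
Proof.
move=> rho rho_gt0 _; exists (expR (cn u * rho)) => n.
have x_ge0 : 0 <= cn u * rho by rewrite mulr_ge0 ?cn_ge0 // ltW.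
apply: le_trans (exp_partial n.+1 x_ge0); rewrite big_ord_recr /=.
rewrite cnM cnV cnX cn_nat exprMn mulrAC lerDr.
by apply: sumr_ge0 => i _; rewrite divr_ge0 // exprn_ge0.
Qed.

Lemma expf_mul u v : expf u * expf v = expf (u + v).
Proof.
apply: fpsP => n; rewrite fcoefM /= addrC exprDn mulr_suml; apply: eq_bigr => i _.
have le_in : (i <= n)%N by rewrite -ltnS.
rewrite -mulr_natl -(bin_fact le_in) !natrM.
have h1 := fact_neq0 CR i; have h2 := fact_neq0 CR (n - i).
have h3 : 'C(n, i)%:R != 0 :> CR by rewrite pnatr_eq0 -lt0n bin_gt0.
by field; rewrite h1 h2 h3.
Qed.

Lemma expf_sum u : Csum (fun n => u ^+ n / n`!%:R) (ev (expf u) 1).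
Proof.
have := @evP R 2 (expf u) 1 (@pconv_expf _ _) ltac:(rewrite cn1; lra).
by apply: eq_Csum => n; rewrite expr1n mulr1.
Qed.

Lemma expf_real (x : R) : ev (expf x%:C%C) 1 = (expR x)%:C%C.
Proof.
apply: Csum_unique (expf_sum _) _; rewrite /Csum.
have E N : \sum_(i < N) (x%:C%C : CR) ^+ i / i`!%:R = (series (exp_coeff x) N)%:C%C.
  rewrite seriesEord /= rmorph_sum; apply: eq_bigr => i _ /=.
  by rewrite rmorphM rmorphXn fmorphV rmorph_nat.
apply: Cto_ReIm.
  rewrite (_ : (fun n => _) = series (exp_coeff x)); last by apply/funext => N; rewrite E.
  exact: is_cvg_series_exp_coeff.
rewrite (_ : (fun n => _) = cst 0); last by apply/funext => N; rewrite E.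
exact: cvg_cst.
Qed.

Lemma expf_imag (y : R) : ev (expf (0 +i* y)%C) 1 = (cos y +i* sin y)%C.
Proof.
apply: Csum_unique (expf_sum _) _; rewrite /Csum.
have En n : ((0 +i* y)%C : CR) ^+ n = ((~~ odd n)%:R * (-1) ^+ n./2 * y ^+ n +i*
    ((odd n)%:R * (-1) ^+ n.-1./2 * y ^+ n))%C.
  elim: n => [|n IHn]; first by apply/eqP; rewrite eq_complex /= !expr0 !mulr1; apply/andP; split; apply/eqP.
  rewrite exprS {}IHn; have e1 : uphalf n = (odd n + n./2)%N by rewrite uphalf_half.
  have e2 : odd n -> (n.-1./2 = n./2)%N.
    by have := odd_double_half n => + oddn; rewrite oddn => {1}<-; rewrite /= doubleK.
  apply/eqP; rewrite eq_complex /= e1 [y ^+ n.+1]exprS.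
  by case: (boolP (odd n)) e2 => [_ /(_ isT) ->|_ _];
    apply/andP; split; apply/eqP; rewrite /= ?add1n ?add0n ?exprS ?mulr0n ?mulr1n; ring.
have E n : ((0 +i* y)%C : CR) ^+ n / n`!%:R = (cos_coeff y n +i* sin_coeff y n)%C.
  rewrite En (_ : n`!%:R^-1 = (n`!%:R^-1 : R)%:C%C :> CR); last by rewrite fmorphV rmorph_nat.
  by apply/eqP; rewrite eq_complex /= /cos_coeff /sin_coeff /= !mulr0 subr0 add0r !eqxx.
have EN N : \sum_(i < N) ((0 +i* y)%C : CR) ^+ i / i`!%:R =
    (series (cos_coeff y) N +i* series (sin_coeff y) N)%C.
  rewrite !seriesEord /=; elim: N => [|N IHN]; first by rewrite !big_ord0.
  by rewrite !big_ord_recr /= IHN E.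
apply: Cto_ReIm.
  rewrite (_ : (fun n => _) = series (cos_coeff y)); last by apply/funext => N; rewrite EN.
  rewrite cosE; have := @is_cvg_series_cos_coeff R y; rewrite cos_coeffE; exact.
rewrite (_ : (fun n => _) = series (sin_coeff y)); last by apply/funext => N; rewrite EN.
rewrite sinE; have := @is_cvg_series_sin_coeff R y; rewrite sin_coeffE; exact.
Qed.

Lemma ev_expfD u v : ev (expf (u + v)) 1 = ev (expf u) 1 * ev (expf v) 1.
Proof.
have lt12 : cn (1 : CR) < 2 by rewrite cn1; lra.
rewrite -expf_mul; apply: (@evM _ 2) => //; exact: pconv_expf.
Qed.

(** The definition by [expR], [cos] and [sin] meets the power series on the real and the imaginary
    axis; the addition law of the series does the rest. *)
Lemma cexpE w : cexp w = ev (expf w) 1.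
Proof.
have -> : w = (complex.Re w)%:C%C + (0 +i* complex.Im w)%C.
  by case: w => x y; apply/eqP; rewrite eq_complex /= addr0 add0r !eqxx.
rewrite ev_expfD expf_real expf_imag /cexp /=.
by rewrite addr0 add0r.
Qed.

Lemma cexp_sum w : Csum (fun n => w ^+ n / n`!%:R) (cexp w).
Proof. by rewrite cexpE; apply: expf_sum. Qed.

Lemma cexpD u v : cexp (u + v) = cexp u * cexp v.
Proof. by rewrite !cexpE; apply: ev_expfD. Qed.

Lemma cexp_ev c w : cexp (c * w) = ev (expf c) w.
Proof.
apply: Csum_unique (cexp_sum _) _.
have := @evP R (cn w + 1) (expf c) w (@pconv_expf _ _) ltac:(lra).
by apply: eq_Csum => n; rewrite exprMn /=; ring.
Qed.

Lemma cexp0 : cexp (0 : CR) = 1.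
Proof.
have := cexp_ev 0 1; rewrite mul0r => ->; apply: ev_eq.
have := @Csum_fin _ (fun i => expf (0 : CR) i * 1 ^+ i) 1.
rewrite big_ord1 /= expr0 fact0 invr1 !mulr1; apply=> -[|i] // _.
by rewrite /= expr0n !mul0r.
Qed.

Lemma cexp_neq0 w : cexp w != 0.
Proof.
apply/eqP => E; have := cexpD w (- w); rewrite subrr cexp0 E mul0r.
by move/eqP; rewrite oner_eq0.
Qed.

Lemma cexpN w : cexp (- w) = (cexp w)^-1.
Proof.
by apply: (mulfI (cexp_neq0 w)); rewrite mulfV ?cexp_neq0 // -cexpD subrr cexp0.
Qed.

Lemma cexpMn w n : cexp (n%:R * w) = cexp w ^+ n.
Proof.
elim: n => [|n IHn]; first by rewrite mul0r cexp0 expr0.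
by rewrite -natr1 mulrDl mul1r cexpD IHn exprSr.
Qed.

Lemma cn_cexp w : cn (cexp w) = expR (complex.Re w).
Proof.
rewrite /cexp cnM cn_real ger0_norm ?expR_ge0 // /cn /=.
by rewrite cos2Dsin2 sqrtr1 mulr1.
Qed.

Lemma fder_expf c : fder (expf c) = fC c * expf c.
Proof.
apply: fpsP => n; rewrite fcoefCM /= factS natrM invfM -[LHS]mulr_natl exprS.
transitivity (n.+1%:R / n.+1%:R * (c * (c ^+ n / n`!%:R))); first by ring.
by rewrite divff ?mul1r // pnatr_eq0.
Qed.

Lemma Der_cexp c w : Der (fun z => cexp (c * z)) w (c * cexp (c * w)).
Proof.
have cw : cn w < cn w + 1 by lra.
have := Der_ev (@pconv_expf (cn w + 1) c) cw.
rewrite fder_expf (evM (@pconv_fC R _ c) (@pconv_expf _ c) cw) ev_fC -cexp_ev.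
by apply: eq_Der; exists 1 => // h _; rewrite cexp_ev.
Qed.

Lemma Der_cexp1 w : Der (@cexp R) w (cexp w).
Proof.
have := Der_cexp 1 w; rewrite !mul1r; apply: eq_Der; exists 1 => // h _.
by rewrite mul1r.
Qed.

Lemma e2pi_neq0 w : e2pi w != 0.
Proof. exact: cexp_neq0. Qed.
Lemma e2piMn w n : e2pi (n%:R * w) = e2pi w ^+ n.
Proof. by rewrite /e2pi mulrCA cexpMn. Qed.

Lemma Der_e2pi w : Der (@e2pi R) w (2 * cpi R * cI R * e2pi w).
Proof. exact: Der_cexp. Qed.

Lemma twopiIE : 2 * cpi R * cI R = (0 +i* (2 * pi))%C.
Proof.
rewrite /cpi /cI (_ : (2 : CR) = (2 : R)%:C%C); last by rewrite rmorph_nat.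
by apply/eqP; rewrite eq_complex /=; apply/andP; split; apply/eqP; ring.
Qed.

Lemma cn_e2pi_lt1 w : upper_half_plane w -> cn (e2pi w) < 1.
Proof.
move=> w_gt0; rewrite /e2pi twopiIE cn_cexp -expR0 ltr_expR.
move: w_gt0; case: w => x y; rewrite /upper_half_plane /= => y_gt0.
by rewrite mul0r sub0r oppr_lt0 !mulr_gt0 // pi_gt0.
Qed.

Lemma upper_half_plane_open w : upper_half_plane w ->
  exists2 e, 0 < e & forall h : CR, cn h < e -> upper_half_plane (w + h).
Proof.
rewrite /upper_half_plane /= => w_gt0; exists (complex.Im w) => // h lt_h.
have := cn_Im h; rewrite ler_norml => /andP[le_h _].
by move: lt_h le_h w_gt0; case: w => x y; case: h => x' y' /=; lra.
Qed.
End Exponential.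

(** * The Bailey pair of the rank generating function *)

Section Bailey.
Variable R : realType.
Notation CR := (C R).
Variable q : CR.
Hypothesis q_neq0 : q != 0.
Hypothesis q_nru : forall n, 1 - q ^+ n.+1 != 0.
Notation qp := (qpoch q q).

Lemma qpoch_recr (x : CR) n : qpoch q x n.+1 = qpoch q x n * (1 - x * q ^+ n).
Proof. by rewrite /qpoch big_ord_recr. Qed.
Lemma qpS n : qp n.+1 = qp n * (1 - q ^+ n.+1).
Proof. by rewrite /qpoch big_ord_recr /= exprS. Qed.
Lemma qp0 : qp 0 = 1. Proof. by rewrite /qpoch big_ord0. Qed.
Lemma qp_neq0 n : qp n != 0.
Proof. by elim: n => [|n IHn]; rewrite ?qp0 ?oner_eq0 // qpS mulf_neq0. Qed.

(** Induction on m through 1 - q^(m+1) = (1 - q^(m+1-i)) + q^(m+1-i) (1 - q^i): the first part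
    lowers m, the second lowers m and i and raises c. *)
Lemma q_vandermonde m c :
  \sum_(i < m.+1) q ^+ (i ^ 2 + c * i) / (qp (m - i) * qp i * qp (c + i)) =
  (qp m * qp (m + c))^-1.
Proof.
elim: m c => [|m IHm] c.
  by rewrite big_ord1 muln0 expr0 subnn addn0 qp0 !mul1r.
have nz := q_nru m; apply: (mulfI nz).
pose F i := q ^+ (i ^ 2 + c * i) / (qp (m.+1 - i) * qp i * qp (c + i)).
rewrite -[X in _ * X = _]/(\sum_(i < m.+2) F i) mulr_sumr.
transitivity (\sum_(i < m.+1) q ^+ (i ^ 2 + c * i) / (qp (m - i) * qp i * qp (c + i)) +
  q ^+ (m + c).+1 * \sum_(i < m.+1) q ^+ (i ^ 2 + c.+1 * i) / (qp (m - i) * qp i * qp (c.+1 + i))).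
  have E i : (i <= m.+1)%N -> (1 - q ^+ m.+1) * F i =
      (1 - q ^+ (m.+1 - i)) * F i + q ^+ (m.+1 - i) * (1 - q ^+ i) * F i.
    by move=> le_i; rewrite -mulrDl; congr (_ * _); rewrite mulrBr -exprD subnK //; ring.
  under eq_bigr => i _ do rewrite E -1?ltnS //.
  rewrite big_split /=; congr (_ + _).
    rewrite big_ord_recr /= subnn expr0 subrr mul0r addr0; apply: eq_bigr => i _.
    have le_i : (i <= m)%N by rewrite -ltnS.
    rewrite /F subSn // qpS; have := q_nru (m - i); have := qp_neq0 (m - i).
    have := qp_neq0 i; have := qp_neq0 (c + i) => h1 h2 h3 h4.
    by field; rewrite h1 h2 h3 h4.
  rewrite big_ord_recl expr0 subrr mulr0 mul0r add0r mulr_sumr; apply: eq_bigr => i _.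
  have le_i : (i <= m)%N by rewrite -ltnS.
  rewrite lift0 /F subSS addnS addSn !qpS.
  have E2 : q ^+ (i.+1 ^ 2 + c * i.+1) * q ^+ (m - i) =
      q ^+ (m + c).+1 * q ^+ (i ^ 2 + c.+1 * i).
    by rewrite -!exprD; congr (_ ^+ _); rewrite -!mulnn; lia.
  rewrite [RHS]mulrA -E2; have := q_nru i; have := qp_neq0 (m - i).
  have := qp_neq0 i; have := qp_neq0 (c + i); have := q_nru (c + i) => h1 h2 h3 h4 h5.
  by field; rewrite h1 h2 h3 h4 h5.
rewrite !IHm addnS addSn !qpS.
have h1 := qp_neq0 m; have h2 := qp_neq0 (m + c); have h3 := q_nru (m + c).
by field; rewrite h1 h2 h3 nz.
Qed.

Definition bailey_pair (alpha beta : nat -> CR) := forall n,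
  beta n = \sum_(s < n.+1) alpha s / (qp (n - s) * qp (n + s)).

(** Bailey's lemma at a = 1 with both of its parameters sent to infinity. *)
Definition bailey_step (beta : nat -> CR) n :=
  \sum_(r < n.+1) q ^+ (r ^ 2) * beta r / qp (n - r).

Lemma bailey_lemma alpha beta : bailey_pair alpha beta ->
  bailey_pair (fun s => q ^+ (s ^ 2) * alpha s) (bailey_step beta).
Proof.
move=> pair n; rewrite /bailey_step.
pose F r s := q ^+ (r ^ 2) * (alpha s / (qp (r - s) * qp (r + s))) / qp (n - r).
transitivity (\sum_(r < n.+1) \sum_(s < n.+1 | (s <= r)%N) F r s).
  apply: eq_bigr => r _; rewrite pair mulr_sumr mulr_suml.
  by rewrite (big_ord_widen n.+1 (F r)) ?ltn_ord //.
rewrite (exchange_big_dep predT) //=; apply: eq_bigr => s _.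
have le_sn : (s <= n)%N by rewrite -ltnS.
rewrite -(big_mkord (fun r => s <= r)%N (fun r => F r s)).
rewrite (@big_cat_nat _ _ _ s) //= ?(leqW le_sn) // big_nat_cond big_pred0 ?add0r; last first.
  by move=> r; apply/negbTE/negP => /andP[]; lia.
rewrite -{1}[s : nat]add0n big_addn subSn // big_mkord.
under eq_bigl => r do rewrite leq_addl.
have := q_vandermonde (n - s) (2 * s).
rewrite [(n - s + 2 * s)%N](_ : _ = n + s)%N; last by lia.
move=> E; rewrite -[RHS]mulrA [(qp _ * qp _)^-1](_ : _ = \sum_(i < (n - s).+1)
  q ^+ (i ^ 2 + 2 * s * i) / (qp (n - s - i) * qp i * qp (2 * s + i))) //.
rewrite mulrA mulr_sumr; apply: eq_bigr => i _; rewrite /F addnK.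
have -> : ((i + s) ^ 2 = s ^ 2 + (i ^ 2 + 2 * s * i))%N by rewrite -!mulnn; lia.
rewrite [(i + s + s)%N](_ : _ = 2 * s + i)%N; last by lia.
rewrite [(n - (i + s))%N](_ : _ = n - s - i)%N; last by lia.
rewrite exprD; have h1 := qp_neq0 i; have h2 := qp_neq0 (2 * s + i).
have h3 := qp_neq0 (n - s - i).
by field; rewrite h1 h2 h3.
Qed.

Lemma bailey_iter j alpha beta : bailey_pair alpha beta ->
  bailey_pair (fun s => q ^+ (j * s ^ 2) * alpha s) (iter j bailey_step beta).
Proof.
move=> pair; elim: j => [|j IHj] n /=.
  by rewrite pair; apply: eq_bigr => s _; rewrite mul0n expr0 mul1r.
rewrite (bailey_lemma IHj n); apply: eq_bigr => s _; rewrite mulSn exprD; ring.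
Qed.

Variable zeta : CR.
Hypothesis zeta_neq0 : zeta != 0.
Hypothesis zq_neq0 : forall n, 1 - zeta * q ^+ n.+1 != 0.
Hypothesis zVq_neq0 : forall n, 1 - zeta^-1 * q ^+ n.+1 != 0.

Definition rank_num s : CR :=
  (-1) ^+ s.-1 * q ^+ 'C(s, 2) * (1 + q ^+ s) * (1 - q ^+ s) ^+ 2.
Definition rank_den s : CR := (1 - zeta * q ^+ s) * (1 - zeta^-1 * q ^+ s).

(** The classical pair of the rank function minus the unit Bailey pair. The subtraction removes the
    term n = 0, in accordance with n_1 >= 1 in FG_k, and is the origin of the theta term beside
    FG_k. *)
Definition rank_alpha s : CR := if s is 0 then 0 else rank_num s / rank_den s.
Definition rank_beta n : CR :=
  if n is 0 then 0 else (qpoch q (zeta * q) n * qpoch q (zeta^-1 * q) n)^-1.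

Lemma rank_den_neq0 s : (0 < s)%N -> rank_den s != 0.
Proof. by case: s => // s _; rewrite mulf_neq0. Qed.

Lemma qpoch_zq_neq0 n : qpoch q (zeta * q) n != 0.
Proof. by apply/prodf_neq0 => i _; rewrite -mulrA -exprS. Qed.
Lemma qpoch_zVq_neq0 n : qpoch q (zeta^-1 * q) n != 0.
Proof. by apply/prodf_neq0 => i _; rewrite -mulrA -exprS. Qed.

Definition rank_term n i : CR := q ^+ (n - i) * rank_num i / (qp (n - i) * qp (n + i)).

(** The partial sums have a closed form with denominator q - q^(n+1). This vanishes at n = 0, which
    is why [rank_vanish] starts at index 2. *)
Lemma rank_telescope n m : (m <= n)%N ->
  (q - q ^+ n.+1) * \sum_(i < m) rank_term n.+1 i.+1 =
  - q ^+ n.+1 * ((-1) ^+ m * q ^+ 'C(m, 2) * (1 - q ^+ m) * (1 - q ^+ m.+1) /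
     (qp (n - m) * qp (n.+1 + m))).
Proof.
elim: m => [|m IHm] le_mn; first by rewrite big_ord0 expr0 subrr !(mulr0, mul0r).
rewrite big_ord_recr mulrDr IHm; last exact: ltnW.
have [d En] : exists d, n = (d + m.+1)%N by exists (n - m.+1)%N; rewrite subnK.
have E1 : (n - m = d.+1)%N by lia.
have E2 : (n - m.+1 = d)%N by lia.
have E3 : q ^+ n.+1 = q ^+ d * (q * (q * q ^+ m)) by rewrite En -!exprS -exprD; congr (_ ^+ _); lia.
have -> : rank_term n.+1 m.+1 = q ^+ d.+1 * rank_num m.+1 / (qp d.+1 * qp (n.+1 + m).+1).
  by rewrite /rank_term subSS E1 addnS.
rewrite E1 E2 (addnS n.+1); move En' : (n.+1 + m)%N => N.
have E4 : q ^+ N.+1 = q ^+ d * (q * (q * q ^+ m)) * (q * q ^+ m).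
  by rewrite -E3 -exprS -exprD -En' addnS.
have h3 := q_nru d; have h4 := q_nru N; rewrite E4 exprS in h3 h4.
have h1 := qp_neq0 d; have h2 := qp_neq0 N.
rewrite /rank_num /= !qpS E4 E3 binS bin1 exprD !exprS.
move: h1 h2 h3 h4; move: (qp d) (qp N) (q ^+ d) (q ^+ m) (q ^+ 'C(m, 2)) ((-1) ^+ m).
move=> P P' y x c e h1 h2 h3 h4.
by field; rewrite h1 h2 h3 h4.
Qed.

Lemma rank_vanish n : \sum_(i < n.+2) rank_term n.+2 i.+1 = 0.
Proof.
have nz : q - q ^+ n.+2 != 0.
  by rewrite exprS -{1}[q]mulr1 -mulrBr mulf_neq0.
apply: (mulfI nz); rewrite mulr0 big_ord_recr mulrDr rank_telescope //.
have -> : rank_term n.+2 n.+2 = rank_num n.+2 / qp (n.+2 + n.+1).+1.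
  by rewrite /rank_term subnn expr0 mul1r qp0 mul1r addnS.
rewrite subnn qp0 mul1r; move En : (n.+2 + n.+1)%N => N.
have E4 : q ^+ N.+1 = q ^+ n.+2 * q ^+ n.+2 by rewrite -exprD; congr (_ ^+ _); lia.
have h1 := qp_neq0 N; have h2 := q_nru N; rewrite E4 in h2.
rewrite /rank_num /= !qpS E4 (binS n.+1) bin1 exprD.
move: h1 h2; move: (qp N) (q ^+ 'C(n.+1, 2)) ((-1) ^+ n.+1); rewrite exprS.
move: (q ^+ n.+1) => x P c e h1 h2.
by field; rewrite h1 h2.
Qed.

(** The first summand shortens both q-factorials by one factor; the second cancels the denominator
    of [rank_alpha] and leaves a term free of zeta. *)
Lemma rank_den_split n s : (s <= n)%N ->
  rank_den n = (1 - q ^+ (n - s)) * (1 - q ^+ (n + s)) + q ^+ (n - s) * rank_den s.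
Proof.
move=> le_sn; have E : q ^+ n = q ^+ (n - s) * q ^+ s by rewrite -exprD subnK.
rewrite /rank_den exprD E; move: (q ^+ (n - s)) (q ^+ s) => x y.
by field; rewrite zeta_neq0.
Qed.

Lemma rank_alpha_split n s : (0 < s <= n.+1)%N ->
  rank_den n.+1 * (rank_alpha s / (qp (n.+1 - s) * qp (n.+1 + s))) =
  (if (s <= n)%N then rank_alpha s / (qp (n - s) * qp (n + s)) else 0) + rank_term n.+1 s.
Proof.
case/andP => s_gt0 le_sn; have d_nz := rank_den_neq0 s_gt0.
have -> : rank_alpha s = rank_num s / rank_den s by case: s s_gt0 {le_sn d_nz}.
rewrite (rank_den_split le_sn) /rank_term addSn.
have h2 := qp_neq0 (n + s); have h3 := q_nru (n + s).
case: leqP => [le_s|lt_ns].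
  rewrite (subSn le_s) !qpS; have h1 := qp_neq0 (n - s); have h4 := q_nru (n - s).
  by field; rewrite h1 h2 h3 h4 d_nz.
have -> : (n.+1 - s = 0)%N by lia.
by rewrite qp0 expr0 !qpS; field; rewrite h2 h3 d_nz.
Qed.

(** Multiplied by [rank_den n.+1], the sum for n + 1 becomes the sum for n plus a sum free of zeta,
    which equals 1 for n = 0 and 0 afterwards. *)
Lemma rank_pair : bailey_pair rank_alpha rank_beta.
Proof.
move=> n; rewrite big_ord_recl mul0r add0r.
under eq_bigr => i _ do rewrite lift0.
elim: n => [|n IHn]; first by rewrite big_ord0.
apply: (mulfI (rank_den_neq0 (ltn0Sn n))); rewrite mulr_sumr.
under eq_bigr => i _ do rewrite rank_alpha_split ?ltn_ord //.
rewrite big_split big_ord_recr /= ltnn addr0.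
have -> : \sum_(i < n) (if (i < n)%N then rank_alpha i.+1 / (qp (n - i.+1) * qp (n + i.+1)) else 0)
    = rank_beta n.
  by rewrite IHn; apply: eq_bigr => i _; rewrite ltn_ord.
case: n {IHn} => [|n].
  rewrite big_ord1 add0r /rank_term subnn qp0 expr0 !mul1r /rank_num !qpS qp0 mul1r.
  rewrite expr0 mul1r expr0 mul1r /rank_den /qpoch !big_ord1 expr0 !mulr1 expr1.
  have h1 := q_nru 0; have h2 := q_nru 1; have h3 := zq_neq0 0; have h4 := zVq_neq0 0.
  rewrite !exprS !expr0 !mulr1 in h1 h2 h3 h4 *.
  by rewrite mulfV ?mulf_neq0 //; field; rewrite h1 h2.
rewrite rank_vanish addr0 /rank_beta !(qpoch_recr _ n.+1).
have h3 := qpoch_zq_neq0 n.+1; have h4 := qpoch_zVq_neq0 n.+1.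
have h5 := zq_neq0 n.+1; have h6 := zVq_neq0 n.+1.
rewrite /rank_den !exprS in h5 h6 *.
move: h3 h4 h5 h6; move: (zeta^-1) => zi h3 h4 h5 h6.
by field; rewrite -!(mulrA _ q) h3 h4 h5 h6.
Qed.

End Bailey.

Lemma big_tuple_cons (V : nmodType) (T : finType) n (P : pred (n.+1.-tuple T))
    (F : n.+1.-tuple T -> V) :
  \sum_(t | P t) F t = \sum_(x : T) \sum_(t : n.-tuple T | P (cons_tuple x t)) F (cons_tuple x t).
Proof.
rewrite pair_big_dep /=.
rewrite (reindex (fun p : T * n.-tuple T => cons_tuple p.1 p.2)) //=.
exists (fun t => (thead t, behead_tuple t)) => [[x t] _ | t _] /=.
  by rewrite theadE; congr (_, _); apply: val_inj.
by rewrite [RHS]tuple_eta; apply: val_inj.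
Qed.

(** * The nested sum FG as iterated Bailey steps *)

Section NestedSums.
Variable R : realType.
Notation CR := (C R).
Variable q : CR.
Hypothesis q_neq0 : q != 0.
Hypothesis q_nru : forall n, 1 - q ^+ n.+1 != 0.
Notation qp := (qpoch q q).

Fixpoint chain_weight m (s : seq nat) : CR :=
  if s is n :: s' then q ^+ (n ^ 2) / qp (n - m) * chain_weight n s' else 1.

Lemma FG_term_cons zeta n (s : seq nat) :
  FG_term q zeta (n :: s) =
  q ^+ (n ^ 2) * (qpoch q (zeta * q) n * qpoch q (zeta^-1 * q) n)^-1 * chain_weight n s.
Proof.
rewrite /FG_term /= big_cons exprD.
have -> : chain_weight n s = q ^+ (\sum_(m <- s) m ^ 2)%N /
    \prod_(i < size s) qp (nth 0 s i - nth 0 (n :: s) i)%N.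
  elim: s n => [|m s IHs] n /=; first by rewrite big_nil big_ord0 expr0 divr1.
  by rewrite IHs big_cons exprD big_ord_recl /= invfM; ring.
by rewrite !invfM; ring.
Qed.

Variable N : nat.

Definition chain_sum len m : CR :=
  \sum_(t : len.-tuple 'I_N | path leq m (map val t)) chain_weight m (map val t).

Lemma chain_sum0 m : chain_sum 0 m = 1.
Proof.
rewrite /chain_sum (big_pred1 [tuple]) // => t.
by rewrite (tuple0 t) /=; apply/esym/eqP.
Qed.

Lemma chain_sumS len m : chain_sum len.+1 m =
  \sum_(n < N | (m <= n)%N) q ^+ (n ^ 2) / qp (n - m) * chain_sum len n.
Proof.
rewrite /chain_sum big_tuple_cons [RHS]big_mkcond; apply: eq_bigr => n _ /=.
case: ifP => le_mn; last by rewrite big_pred0.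
by rewrite mulr_sumr.
Qed.

(** Exchanging two neighbouring sums absorbs the smaller variable n into one Bailey step. Since n <=
    r < N, this is exact for truncated sums. *)
Lemma chain_sum_step len (beta : nat -> CR) :
  \sum_(n < N) q ^+ (n ^ 2) * beta n * chain_sum len n =
  \sum_(r < N) q ^+ (r ^ 2) * iter len (bailey_step q) beta r.
Proof.
elim: len beta => [|len IHlen] beta.
  by apply: eq_bigr => n _; rewrite chain_sum0 mulr1.
rewrite iterSr -IHlen.
under eq_bigr => n _ do rewrite chain_sumS mulr_sumr.
rewrite (exchange_big_dep predT) //=; apply: eq_bigr => r _.
rewrite /bailey_step [X in _ = X * _]mulr_sumr [RHS]mulr_suml.
rewrite [RHS](big_ord_widen N (fun n => q ^+ (r ^ 2) * (q ^+ (n ^ 2) * beta n / qp (r - n)) *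
   chain_sum len r)); last exact: ltn_ord.
by apply: eq_big => // n _; ring.
Qed.

Lemma FG_partial zeta k : (2 <= k)%N ->
  \sum_(t : (k.-1).-tuple 'I_N | path leq 1%N (map val t)) FG_term q zeta (map val t) =
  \sum_(r < N) q ^+ (r ^ 2) * iter (k - 2) (bailey_step q) (rank_beta q zeta) r.
Proof.
move=> k2; have -> : k.-1 = (k - 2).+1 by lia.
rewrite -chain_sum_step big_tuple_cons; apply: eq_bigr => n _ /=.
case: (val n) => [|m]; first by rewrite big_pred0 // mulr0 mul0r.
rewrite mulr_sumr; apply: eq_bigr => t _.
exact: FG_term_cons.
Qed.
End NestedSums.

(** * The limit of the outermost sum *)

Section FGLimit.
Variable R : realType.
Notation CR := (C R).
Variable q : CR.
Hypothesis q_neq0 : q != 0.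
Hypothesis q_lt1 : cn q < 1.
Notation qp := (qpoch q q).
Notation qpi := (qpoch_inf q q).
Notation rho := (cn q).

Let rho_ge0 : 0 <= rho. Proof. exact: cn_ge0. Qed.
Let rho1 : 0 < 1 - rho. Proof. by move: q_lt1; lra. Qed.

Lemma rho_exp_le1 n : rho ^+ n <= 1. Proof. by rewrite exprn_ile1 // ltW. Qed.
Lemma rho_exp_le m n : (m <= n)%N -> rho ^+ n <= rho ^+ m.
Proof. by move=> le_mn; rewrite ler_wiXn2l // ltW. Qed.

Lemma cn_1B_ge (x : CR) : 1 - cn x <= cn (1 - x).
Proof. by have := cnD (1 - x) x; rewrite subrK cn1; lra. Qed.

Lemma q_nru n : 1 - q ^+ n.+1 != 0.
Proof.
rewrite -cn_gt0; apply: lt_le_trans (cn_1B_ge _); rewrite cnX subr_gt0.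
by apply: le_lt_trans q_lt1; rewrite -[leRHS]expr1 rho_exp_le.
Qed.

Lemma qp_bounded : exists2 M, 0 < M & forall n, cn (qp n) <= M.
Proof.
exists (expR (1 - rho)^-1); first exact: expR_gt0.
move=> n; apply: le_trans (_ : expR (\sum_(i < n) rho ^+ i) <= _); last first.
  by rewrite ler_expR geo_bsum.
elim: n => [|n IHn]; first by rewrite qp0 cn1 big_ord0 expR0.
rewrite qpS cnM big_ord_recr /= expRD ler_pM ?cn_ge0 //.
apply: le_trans (expR_ge1Dx _); apply: le_trans (cnB _ _) _.
by rewrite cn1 lerD2l cnX rho_exp_le.
Qed.

Lemma qp_inv_bounded : exists2 M, 0 < M & forall n, cn (qp n)^-1 <= M.
Proof.
pose c := (1 - rho)^-1; have c_gt0 : 0 < c by rewrite invr_gt0.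
exists (expR (c * c)); first exact: expR_gt0.
move=> n; apply: le_trans (_ : expR (c * \sum_(i < n) rho ^+ i) <= _); last first.
  by rewrite ler_expR ler_wpM2l ?geo_bsum // ltW.
elim: n => [|n IHn]; first by rewrite qp0 invr1 cn1 big_ord0 mulr0 expR0.
rewrite qpS invfM cnM big_ord_recr /= mulrDr expRD ler_pM ?cn_ge0 //.
apply: le_trans (expR_ge1Dx _).
have xn : rho ^+ n.+1 <= rho ^+ n by rewrite rho_exp_le.
have xr : rho ^+ n.+1 <= rho by rewrite -[leRHS]expr1 rho_exp_le.
have x0 : 0 <= rho ^+ n.+1 by rewrite exprn_ge0.
have le1 : 1 - rho <= cn (1 - q ^+ n.+1).
  by apply: le_trans (cn_1B_ge _); rewrite cnX; lra.
have le2 : 1 - rho ^+ n.+1 <= cn (1 - q ^+ n.+1) by rewrite -cnX cn_1B_ge.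
have y_gt0 : 0 < cn (1 - q ^+ n.+1) by exact: lt_le_trans rho1 le1.
rewrite cnV -[X in X <= _]mul1r ler_pdivrMr // mulrDl mul1r /c.
have : rho ^+ n.+1 <= (1 - rho)^-1 * rho ^+ n * cn (1 - q ^+ n.+1).
  apply: le_trans xn _; rewrite mulrAC ler_peMl ?exprn_ge0 //.
  by rewrite mulrC ler_pdivlMr // mul1r.
lra.
Qed.

Lemma qp_cvg : Cto qp qpi /\ qpi != 0.
Proof.
have [M M_gt0 HM] := qp_bounded; have [M' M'_gt0 HM'] := qp_inv_bounded.
have [l Hl] : exists l, Csum (fun i => qp i.+1 - qp i) l.
  apply: bsum_Csum; exists (M * (1 - rho)^-1) => N.
  apply: le_trans (_ : \sum_(i < N) M * rho ^+ i <= _); last first.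
    by rewrite -mulr_sumr ler_wpM2l ?geo_bsum // ltW.
  apply: ler_sum => i _; rewrite qpS (_ : _ - _ = - (qp i * q ^+ i.+1)); last by ring.
  by rewrite cnN cnM cnX ler_pM ?cn_ge0 ?exprn_ge0 // rho_exp_le.
have H : Cto qp (l + 1).
  apply: eq_Cto (CtoD Hl (Cto_cst 1)) => n.
  by rewrite -(big_mkord predT (fun i => qp i.+1 - qp i)) telescope_sumr // qp0 subrK.
have E : qpi = l + 1 by apply: Cto_lim.
rewrite E; split=> //; rewrite -cn_eq0 gt_eqF //.
have e_gt0 : 0 < M'^-1 by rewrite invr_gt0.
have [N HN] := H _ e_gt0; have := HN N (leqnn N).
have : M'^-1 <= cn (qp N).
  rewrite -[X in _ <= X]invrK lef_pV2 ?posrE ?invr_gt0 ?cn_gt0 ?qp_neq0 //; last exact: q_nru.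
  by rewrite -cnV.
have := cnD (qp N - (l + 1)) (l + 1); rewrite subrK; lra.
Qed.

Lemma CtoV (u : nat -> CR) l : l != 0 -> (forall n, u n != 0) -> Cto u l ->
  (exists M, forall n, cn (u n)^-1 <= M) -> Cto (fun n => (u n)^-1) l^-1.
Proof.
move=> l0 u0 ul [M HM] e e_gt0.
have M_ge0 : 0 <= M by apply: le_trans (HM 0%N); apply: cn_ge0.
have M1 : 0 < M + 1 by lra.
have [N HN] := @CtoMl R u l l^-1 ul (e / (M + 1)) (divr_gt0 e_gt0 M1).
exists N => n /HN; rewrite mulVf // ltr_pdivlMr //.
move=> lt_e; apply: le_lt_trans lt_e.
have -> : (u n)^-1 - l^-1 = - ((u n)^-1 * (l^-1 * u n - 1)).
  by rewrite mulrBr mulrCA mulVf // !mulr1 opprB.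
by rewrite cnN cnM mulrC ler_wpM2l ?cn_ge0 //; have := HM n; lra.
Qed.

Lemma qp_inv_cvg : Cto (fun n => (qp n)^-1) qpi^-1.
Proof.
have [qpc qpi0] := qp_cvg; apply: CtoV => //; first by move=> n; apply/qp_neq0/q_nru.
by have [M _ HM] := qp_inv_bounded; exists M.
Qed.

Lemma Cto_sub (u : nat -> CR) l k : Cto u l ->
  Cto (fun n => if (k <= n)%N then u (n - k)%N else 0) l.
Proof.
move=> ul; apply/(Cto_shift _ _ k); apply: eq_Cto ul => n.
by rewrite leq_addl addnK.
Qed.

Lemma leq_sqr s : (s <= s ^ 2)%N. Proof. by case: s => // s; rewrite -mulnn leq_pmulr. Qed.

(** The sequence [A] is one further Bailey step. Its limit is B/(q)_oo when computed from beta, and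
    L/(q)_oo^2 when computed from alpha by Bailey's lemma. *)
Lemma bailey_limit (alpha beta : nat -> CR) L :
  bailey_pair q alpha beta -> bsum (fun s => cn (alpha s)) ->
  Csum (fun s => q ^+ (s ^ 2) * alpha s) L ->
  Cto (fun N => \sum_(r < N) q ^+ (r ^ 2) * beta r) (L / qpi).
Proof.
move=> pair [Ma HMa] aL; have [M M_gt0 HM] := qp_inv_bounded.
have [qpc qpi0] := qp_cvg; have qpVc := qp_inv_cvg.
pose Mb := Ma * (M * M).
have Hb n : cn (beta n) <= Mb.
  rewrite pair; apply: le_trans (cn_sum _ _ _) _.
  apply: le_trans (ler_wpM2r (_ : 0 <= M * M) (HMa n.+1)); last by rewrite mulr_ge0 // ltW.
  rewrite mulr_suml; apply: ler_sum => s _.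
  by rewrite cnM invfM cnM ler_wpM2l ?cn_ge0 // ler_pM ?cn_ge0.
have Mb_ge0 : 0 <= Mb by apply: le_trans (Hb 0%N); apply: cn_ge0.
have [B HB] : exists B, Csum (fun r => q ^+ (r ^ 2) * beta r) B.
  apply: bsum_Csum; exists (Mb * (1 - rho)^-1) => N.
  apply: le_trans (_ : \sum_(i < N) Mb * rho ^+ i <= _); last first.
    by rewrite -mulr_sumr ler_wpM2l ?geo_bsum.
  apply: ler_sum => i _; rewrite cnM cnX mulrC ler_pM ?cn_ge0 ?exprn_ge0 //.
  exact/rho_exp_le/leq_sqr.
suff <- : B = L / qpi by exact: HB.
pose A N := \sum_(r < N.+1) q ^+ (r ^ 2) * beta r / qp (N - r).
have lim1 : Cto A (B / qpi).
  apply: (@tannery R (fun N r => (q ^+ (r ^ 2) * beta r) *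
      (if (r <= N)%N then (qp (N - r))^-1 else 0))
    (fun r => (q ^+ (r ^ 2) * beta r) * qpi^-1) A (fun r => Mb * M * rho ^+ r)).
  - move=> N r; rewrite cnM [cn (_ * beta r)]cnM cnX [leRHS]mulrC mulrA.
    apply: ler_pM; rewrite ?mulr_ge0 ?cn_ge0 ?exprn_ge0 //.
      by rewrite ler_pM ?cn_ge0 ?exprn_ge0 // rho_exp_le // leq_sqr.
    by case: ifP => _; rewrite ?cn0 ?(ltW M_gt0).
  - exists (Mb * M * (1 - rho)^-1) => N; rewrite -mulr_sumr ler_wpM2l ?geo_bsum //.
    by rewrite mulr_ge0 // ltW.
  - move=> r; apply: CtoMl; exact: (Cto_sub r qpVc).
  - move=> N; have := @Csum_fin R (fun r => (q ^+ (r ^ 2) * beta r) *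
      (if (r <= N)%N then (qp (N - r))^-1 else 0)) N.+1.
    rewrite (_ : \sum_(i < _) _ = A N); last first.
      by apply: eq_bigr => i _; rewrite -ltnS ltn_ord.
    by apply=> i; rewrite ltnNge => /negbTE ->; rewrite mulr0.
  - by rewrite [B / _]mulrC; apply: eq_Csum (CsumMl qpi^-1 HB) => n; rewrite mulrC.
have lim2 : Cto A (L / (qpi * qpi)).
  apply: (@tannery R (fun N s => (q ^+ (s ^ 2) * alpha s) *
      ((if (s <= N)%N then (qp (N - s))^-1 else 0) * (qp (N + s))^-1))
    (fun s => (q ^+ (s ^ 2) * alpha s) * (qpi^-1 * qpi^-1)) A (fun s => cn (alpha s) * (M * M))).
  - move=> N s; rewrite cnM ler_pM ?cn_ge0 //.
      by rewrite cnM cnX ler_piMl ?cn_ge0 // rho_exp_le1.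
    rewrite cnM ler_pM ?cn_ge0 //.
    by case: ifP => _; rewrite ?cn0 ?(ltW M_gt0).
  - exists (Ma * (M * M)) => N; rewrite -mulr_suml ler_wpM2r //.
    by rewrite mulr_ge0 // ltW.
  - move=> s; apply/CtoMl/CtoM; [exact: (Cto_sub s qpVc) | exact: ((Cto_shift _ _ s).2 qpVc)].
  - move=> N; have := @Csum_fin R (fun s => (q ^+ (s ^ 2) * alpha s) *
      ((if (s <= N)%N then (qp (N - s))^-1 else 0) * (qp (N + s))^-1)) N.+1.
    rewrite (_ : \sum_(i < _) _ = A N); last first.
      rewrite /A -[RHS]/(bailey_step q beta N) (bailey_lemma q_neq0 q_nru pair).
      by apply: eq_bigr => i _; rewrite -ltnS ltn_ord invfM.
    by apply=> i; rewrite ltnNge => /negbTE ->; rewrite mul0r mulr0.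
  - by rewrite invfM [L * _]mulrC; apply: eq_Csum (CsumMl (qpi^-1 * qpi^-1) aL) => n; rewrite mulrC.
have := Cto_unique lim1 lim2; rewrite invfM mulrA => E.
by apply: (mulIf (invr_neq0 qpi0)).
Qed.

Variable zeta : CR.
Hypothesis zeta_neq0 : zeta != 0.
Hypothesis zq_lt1 : cn (zeta * q) < 1.
Hypothesis zVq_lt1 : cn (zeta^-1 * q) < 1.

Lemma cn_xq (x : CR) n : cn (x * q ^+ n.+1) <= cn (x * q).
Proof. by rewrite exprS mulrA cnM cnX ler_piMr ?cn_ge0 // rho_exp_le1. Qed.

Lemma zq_neq0 n : 1 - zeta * q ^+ n.+1 != 0.
Proof.
rewrite -cn_gt0; apply: lt_le_trans (cn_1B_ge _); rewrite subr_gt0.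
exact: le_lt_trans (cn_xq _ _) zq_lt1.
Qed.
Lemma zVq_neq0 n : 1 - zeta^-1 * q ^+ n.+1 != 0.
Proof.
rewrite -cn_gt0; apply: lt_le_trans (cn_1B_ge _); rewrite subr_gt0.
exact: le_lt_trans (cn_xq _ _) zVq_lt1.
Qed.

Lemma rank_alpha_bound : exists2 M, 0 < M & forall s, cn (rank_alpha q zeta s) <= M.
Proof.
pose a := 1 - cn (zeta * q); pose c := 1 - cn (zeta^-1 * q).
have a_gt0 : 0 < a by rewrite subr_gt0.
have c_gt0 : 0 < c by rewrite subr_gt0.
exists (8 / (a * c)); first by rewrite divr_gt0 ?mulr_gt0.
case=> [|s]; first by rewrite cn0 divr_ge0 // mulr_ge0 // ltW.
rewrite /rank_alpha cnM cnV; apply: ler_pM; rewrite ?invr_ge0 ?cn_ge0 //.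
  rewrite /rank_num !cnM !cnX cnN cn1 expr1n mul1r.
  have h1 := rho_exp_le1 'C(s.+1, 2).
  have h2 : cn (1 + q ^+ s.+1) <= 2.
    by apply: le_trans (cnD _ _) _; rewrite cn1 cnX; have := rho_exp_le1 s.+1; lra.
  have h3 : cn (1 - q ^+ s.+1) <= 2.
    by apply: le_trans (cnB _ _) _; rewrite cn1 cnX; have := rho_exp_le1 s.+1; lra.
  have -> : 8 = 1 * 2 * (2 * 2) :> R by ring.
  by rewrite !ler_pM ?mulr_ge0 ?cn_ge0 ?exprn_ge0.
rewrite lef_pV2 ?posrE ?mulr_gt0 //; last first.
  by rewrite cn_gt0 mulf_neq0 ?zq_neq0 ?zVq_neq0.
rewrite /rank_den cnM ler_pM ?(ltW a_gt0) ?(ltW c_gt0) //.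
  by apply: le_trans (cn_1B_ge _); rewrite lerD2l lerN2 cn_xq.
by apply: le_trans (cn_1B_ge _); rewrite lerD2l lerN2 cn_xq.
Qed.

(** The k - 2 inner steps contribute q^((k-2) s^2) and the limit step the last q^(s^2). *)
Lemma FG_limit k : (3 <= k)%N -> exists2 L,
  Csum (fun s => q ^+ (k.-1 * s ^ 2) * rank_alpha q zeta s) L & FG k q zeta = L / qpi.
Proof.
move=> k3; have [M M_gt0 HM] := rank_alpha_bound.
have bound j s : (0 < j)%N -> cn (q ^+ (j * s ^ 2) * rank_alpha q zeta s) <= M * rho ^+ s.
  move=> j_gt0; rewrite cnM cnX mulrC ler_pM ?cn_ge0 ?exprn_ge0 //.
  by apply: rho_exp_le; apply: leq_trans (leq_sqr s) _; rewrite leq_pmull.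
have bs j : (0 < j)%N -> bsum (fun s => cn (q ^+ (j * s ^ 2) * rank_alpha q zeta s)).
  move=> j_gt0; exists (M * (1 - rho)^-1) => N.
  apply: le_trans (_ : \sum_(i < N) M * rho ^+ i <= _); last first.
    by rewrite -mulr_sumr ler_wpM2l ?geo_bsum // ltW.
  by apply: ler_sum => i _; apply: bound.
have k1 : (0 < k.-1)%N by lia.
have k2 : (0 < k - 2)%N by lia.
have [L HL] := bsum_Csum (bs k.-1 k1); exists L => //.
have pair := bailey_iter q_neq0 q_nru (k - 2)
  (rank_pair q_neq0 q_nru zeta_neq0 zq_neq0 zVq_neq0).
have := bailey_limit pair (bs (k - 2)%N k2) (L := L).
rewrite /FG => H; apply: Cto_lim; apply: eq_Cto (H _) => [N|].
  by rewrite FG_partial //; lia.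
apply: eq_Csum HL => s; rewrite mulrA -exprD; congr (q ^+ _ * _).
by have -> : (k.-1 = (k - 2).+1)%N by lia.
Qed.
End FGLimit.

(** * Partial theta functions and the Fourier expansion of FG *)

Section PolynomialGrowth.
Variable R : realType.
Notation CR := (C R).
Notation S := (fps CR).

Lemma pconv_pow d : pconv 1 (Fps (fun n => n%:R ^+ d) : S).
Proof.
elim: d => [|d IHd].
  move=> rho rho_gt0 rho_lt1; exists 1 => n.
  have -> : (Fps (fun n => n%:R ^+ 0) : S) n = 1 by [].
  by rewrite cn1 mul1r exprn_ile1 // ltW.
have -> : Fps (fun n => n%:R ^+ d.+1) = eu (Fps (fun n => n%:R ^+ d)) :> S.
  by apply: fpsP => n /=; rewrite exprSr mulr_natr.
exact: pconv_eu.
Qed.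

Lemma pconv_growth (a : S) (M : R) d :
  (forall n, cn (a n) <= M * n.+1%:R ^+ d) -> pconv 1 a.
Proof.
move=> Ha rho rho_gt0 rho_lt1.
have [M' HM'] := pconv_tl (pconv_pow d) rho_gt0 rho_lt1.
have M_ge0 : 0 <= M by have := Ha 0%N; rewrite expr1n mulr1; apply: le_trans; apply: cn_ge0.
exists (M * M') => n; apply: le_trans (ler_wpM2l M_ge0 (HM' n)).
by rewrite /= cnX cn_nat mulrA ler_wpM2r ?exprn_ge0 // ltW.
Qed.

Lemma growth_bsum (r : R) d : 0 <= r -> r < 1 -> bsum (fun n => n.+1%:R ^+ d * r ^+ n).
Proof.
move=> r_ge0 r_lt1; have [M HM] := pconv_bound (pconv_tl (pconv_pow d)) r_ge0 r_lt1.
exists M => N; apply: le_trans (HM N); apply: ler_sum => i _.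
by rewrite /= cnX cn_nat.
Qed.

Lemma ev_lsum (g : nat -> S) (w : CR) (m : nat -> R) :
  lfin g -> (forall h J, \sum_(N < J) cn (g h N) * cn w ^+ N <= m h) -> bsum m ->
  (forall h, pconv 1 (g h)) -> pconv 1 (lsum g) -> cn w < 1 ->
  Csum (fun h => ev (g h) w) (ev (lsum g) w).
Proof.
move=> lg gm bm cg cl w1.
have [l Hl] : exists l, Csum (fun h => ev (g h) w) l.
  apply: bsum_Csum; have [M HM] := bm; exists M => N.
  apply: le_trans (HM N); apply: ler_sum => h _.
  apply: (Csum_le (evP (cg h) w1)) => J; apply: le_trans (gm h J).
  by apply: ler_sum => i _; rewrite cnM cnX.
suff <- : l = ev (lsum g) w by [].
apply: esym; apply: ev_eq.
apply: (@fubini R (fun h N => g h N * w ^+ N) (fun h => ev (g h) w) _ m) => //.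
- move=> h J; apply: le_trans (gm h J); apply: ler_sum => i _.
  by rewrite cnM cnX.
- by move=> h; apply: evP (cg h) w1.
- move=> N; have := @Csum_fin R (fun h => g h N * w ^+ N) N.+1.
  rewrite -mulr_suml; apply=> h lt_N; by rewrite lg // mul0r.
Qed.

Lemma ev_fCM (c : CR) (a : S) w : pconv 1 a -> cn w < 1 -> ev (fC c * a) w = c * ev a w.
Proof. by move=> ca w1; rewrite (evM (@pconv_fC R 1 c) ca w1) ev_fC. Qed.

Lemma ev_fXn e (w : CR) : ev (fX CR ^+ e) w = w ^+ e.
Proof.
apply: ev_eq; have := @Csum_fin R (fun i => (fX CR ^+ e) i * w ^+ i) e.+1.
rewrite big_ord_recr /= fcoefXn eqxx mul1r big1 ?add0r => [|i _]; last first.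
  by rewrite fcoefXn ltn_eqF // mul0r.
by apply=> i lt_i; rewrite fcoefXn gtn_eqF // mul0r.
Qed.

Lemma pconv_fXn r e : pconv r (fX CR ^+ e).
Proof.
move=> rho rho_gt0 _; exists (rho ^+ e) => n; rewrite fcoefXn.
by case: eqP => [->|_]; rewrite ?cn1 ?mul1r // cn0 mul0r exprn_ge0 // ltW.
Qed.

Lemma monomial_bound (c : CR) e (rho M : R) J : 0 <= rho -> cn c <= M ->
  \sum_(i < J) cn ((fC c * fX CR ^+ e) i) * rho ^+ i <= M * rho ^+ e.
Proof.
move=> rho_ge0 le_M; have M_ge0 : 0 <= M by apply: le_trans le_M; apply: cn_ge0.
have [lt_eJ|le_J] := ltnP e J.
  apply: (@le_trans _ _ (cn c * rho ^+ e)); last by apply: ler_wpM2r; rewrite ?exprn_ge0.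
  rewrite le_eqVlt; apply/orP; left; apply/eqP.
  rewrite (bigD1 (Ordinal lt_eJ)) // big1 => [|i ne_i].
    by apply: etrans (addr0 _) _; rewrite fcoefCM fcoefXn eqxx mulr1.
  rewrite fcoefCM fcoefXn (_ : (i == e :> nat) = false) ?mulr0 ?cn0 ?mul0r //.
  by apply/negbTE; apply: contra ne_i => /eqP E; apply/eqP/val_inj.
rewrite big1 => [|i _]; first by rewrite mulr_ge0 ?exprn_ge0.
by rewrite fcoefCM fcoefXn ltn_eqF ?mulr0 ?cn0 ?mul0r // (leq_trans _ le_J).
Qed.

Section Monomials.
Variables (c : nat -> CR) (e : nat -> nat) (M : R).
Hypothesis le_e : forall n, (n <= e n)%N.
Hypothesis le_M : forall n, cn (c n) <= M.
Let F n : S := fC (c n) * fX CR ^+ e n.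

Lemma lfin_monomials : lfin F.
Proof. by move=> n; apply/vgeMr/vge_Xn. Qed.

Lemma monomials_coef_bound (rho : R) J : 0 <= rho ->
  \sum_(N < J) cn (lsum F N) * rho ^+ N <= \sum_(n < J) M * rho ^+ e n.
Proof.
move=> rho_ge0.
apply: le_trans (_ : \sum_(N < J) \sum_(n < J) cn (F n N) * rho ^+ N <= _).
  apply: ler_sum => N _; rewrite -mulr_suml ler_wpM2r ?exprn_ge0 //.
  by rewrite (@lsumE _ F J) ?cn_sum //; apply: lfin_monomials.
by rewrite exchange_big; apply: ler_sum => n _; apply: monomial_bound.
Qed.

Lemma pconv_monomials : pconv 1 (lsum F).
Proof.
apply: (@pconv_growth _ M 1) => N; rewrite fcoef_lsum expr1.
apply: le_trans (cn_sum _ _ _) _.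
apply: le_trans (_ : \sum_(i < N.+1) M <= _); last by rewrite sumr_const card_ord mulr_natr.
have M_ge0 : 0 <= M by apply: le_trans (le_M 0%N); apply: cn_ge0.
apply: ler_sum => i _; rewrite fcoefCM fcoefXn cnM.
by case: eqP => _; rewrite ?cn1 ?mulr1 // cn0 mulr0.
Qed.

Lemma ev_monomials w : cn w < 1 -> Csum (fun n => c n * w ^+ e n) (ev (lsum F) w).
Proof.
move=> w1; have w_ge0 := cn_ge0 w.
have M_ge0 : 0 <= M by apply: le_trans (le_M 0%N); apply: cn_ge0.
have cF n : pconv 1 (F n) by apply: pconvM; [apply: pconv_fC | apply: pconv_fXn].
apply: eq_Csum (@ev_lsum F w (fun n => M * cn w ^+ n) lfin_monomials _ _ cF pconv_monomials w1).
- by move=> n; rewrite ev_fCM ?ev_fXn //; apply: pconv_fXn.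
- move=> h J; apply: le_trans (monomial_bound _ _ w_ge0 (le_M h)) _.
  by rewrite ler_wpM2l // ler_wiXn2l // ltW.
- exists (M * (1 - cn w)^-1) => N; rewrite -mulr_sumr ler_wpM2l //.
  exact: geo_bsum.
Qed.
End Monomials.
End PolynomialGrowth.

(** * Values of partial theta series and rank sums, and the Fourier expansion *)

Section RankAnalytic.
Variable R : realType.
Notation CR := (C R).
Notation S := (fps CR).
Variable B : nat.
Notation b := (B.+1).
Notation k := (B./2.+1).
Notation ptheta := (ptheta CR B).
Notation rsum := (rsum CR B).
Notation ctheta := (ctheta CR B).
Notation mu h := ((h%:R : CR) + 2^-1).

Lemma ptheta_sum M (q : CR) : cn q < 1 ->
  Csum (fun n => (-1) ^+ n.+1 * q ^+ (M + Gexp B M n)) (ev (ptheta M 0) q).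
Proof.
move=> q1; apply: eq_Csum (@ev_monomials R _ _ 1 _ _ q q1) => n.
- by rewrite expr0 mulr1.
- by apply: leq_trans (leq_Gexp B M n) _; rewrite leq_addl.
- by rewrite expr0 mulr1 cnX cnN cn1 expr1n.
Qed.

Lemma pconv_ptheta M : pconv 1 (ptheta M 0).
Proof.
apply: (@pconv_monomials R _ _ 1) => n.
by rewrite expr0 mulr1 cnX cnN cn1 expr1n.
Qed.

Lemma pconv_ctheta M : pconv 1 (ctheta M 0).
Proof. by apply: pconvD; [apply: pconvD; [apply: pconv_fC|]|]; apply: pconv_ptheta. Qed.

Lemma ev_ctheta M (q : CR) : cn q < 1 ->
  ev (ctheta M 0) q = 1 + ev (ptheta (b - M) 0) q + ev (ptheta M 0) q.
Proof.
move=> q1; have cC : pconv 1 (fC ((M%:R - b%:R / 2) ^+ 0) : fps CR) by apply: pconv_fC.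
rewrite (evD (pconvD cC (pconv_ptheta (b - M))) (pconv_ptheta M) q1).
by rewrite (evD cC (pconv_ptheta (b - M)) q1) ev_fC expr0.
Qed.

Lemma ptheta_coef_bound M i : cn (ptheta M 0 i) <= i.+1%:R.
Proof.
rewrite fcoef_lsum; apply: le_trans (cn_sum _ _ _) _.
apply: le_trans (_ : \sum_(j < i.+1) 1 <= _); last by rewrite sumr_const card_ord.
apply: ler_sum => j _; rewrite fcoefCM fcoefXn expr0 mulr1 cnM cnX cnN cn1 expr1n mul1r.
by case: eqP => _; rewrite ?cn1 ?cn0.
Qed.

Lemma cn_mu h : cn (mu h) = h%:R + 2^-1.
Proof.
have -> : mu h = (h%:R + 2^-1 : R)%:C%C by rewrite rmorphD rmorph_nat fmorphV rmorph_nat.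
by rewrite cn_real ger0_norm // addr_ge0 // ler0n.
Qed.

Lemma pconv_rsum j : pconv 1 (rsum j 0).
Proof.
apply: (@pconv_growth _ _ 1 (j + 2)) => N; rewrite fcoef_lsum mul1r.
apply: le_trans (cn_sum _ _ _) _.
apply: le_trans (_ : \sum_(i < N.+1) N.+1%:R ^+ j.+1 <= _); last first.
  by rewrite sumr_const card_ord -[_ *+ _]mulr_natr -exprSr addn2.
apply: ler_sum => i _; rewrite fcoefCM cnM cnX exprSr ler_pM ?exprn_ge0 ?cn_ge0 ?ptheta_coef_bound //.
rewrite lerXn2r ?nnegrE ?cn_ge0 ?ler0n // cn_mu.
have : (i%:R : R) <= N%:R by rewrite ler_nat -ltnS.
rewrite -[N.+1%:R]natr1; have h2 : (2^-1 : R) <= 1 by lra. by move=> hN; apply: lerD hN h2.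
Qed.

Variable q : CR.
Hypothesis q_lt1 : cn q < 1.
Notation rho := (cn q).
Let rho_ge0 : 0 <= rho. Proof. exact: cn_ge0. Qed.
Let rho1 : 0 < 1 - rho. Proof. by move: q_lt1; lra. Qed.

(** Equal to s/2 + b s^2/2; with h s added it is the exponent s mu + b s^2/2 of the rank sums. *)
Definition sqexp s := (k * s + b * 'C(s, 2))%N.

Lemma sqexp_exp h n : ((h + k) + Gexp B (h + k) n = h * n.+1 + sqexp n.+1)%N.
Proof. by rewrite /Gexp /sqexp; lia. Qed.

Lemma sqexp_ge h n : (h + n <= h * n.+1 + sqexp n.+1)%N.
Proof.
apply: leq_add; first exact: leq_pmulr.
by apply: leq_trans (leqnSn n) _; apply: leq_trans (leq_addr _ _); apply: leq_pmull.
Qed.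

Notation pth h := (ev (ptheta (h + k) 0) q).

Lemma pth_sum h : Csum (fun n => (-1) ^+ n.+1 * q ^+ (h * n.+1 + sqexp n.+1)) (pth h).
Proof. by apply: eq_Csum (ptheta_sum (h + k) q_lt1) => n; rewrite sqexp_exp. Qed.

Lemma pth_terms h N : \sum_(n < N) cn ((-1) ^+ n.+1 * q ^+ (h * n.+1 + sqexp n.+1)) <=
  rho ^+ h / (1 - rho).
Proof.
apply: le_trans (_ : \sum_(n < N) rho ^+ h * rho ^+ n <= _); last first.
  by rewrite -mulr_sumr ler_wpM2l ?exprn_ge0 // geo_bsum.
apply: ler_sum => n _; rewrite cnM !cnX cnN cn1 expr1n mul1r -exprD.
by rewrite ler_wiXn2l ?sqexp_ge // ltW.
Qed.

Lemma pth_bound h : cn (pth h) <= rho ^+ h / (1 - rho).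
Proof. exact: Csum_le (pth_sum h) (pth_terms h). Qed.

Lemma rsum_sum j : Csum (fun h => mu h ^+ j * pth h) (ev (rsum j 0) q).
Proof.
have cF h : pconv 1 (fC (mu h ^+ j) * ptheta (h + k) 0).
  by apply: pconvM; [apply: pconv_fC | apply: pconv_ptheta].
have c_ge0 : 0 <= (1 - rho)^-1 by rewrite invr_ge0 ltW.
apply: eq_Csum (@ev_lsum R _ q (fun h => h.+1%:R ^+ j * (rho ^+ h / (1 - rho)))
   (@lfin_rsum CR B j 0) _ _ cF (pconv_rsum j) q_lt1).
- by move=> h; rewrite ev_fCM //; apply: pconv_ptheta.
- move=> h J.
  apply: le_trans (_ : h.+1%:R ^+ j * \sum_(N < J) cn (ptheta (h + k) 0 N) * rho ^+ N <= _).
    rewrite mulr_sumr; apply: ler_sum => N _; rewrite fcoefCM cnM -mulrA cnX.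
    rewrite ler_wpM2r ?mulr_ge0 ?cn_ge0 ?exprn_ge0 //.
    rewrite lerXn2r ?nnegrE ?cn_ge0 ?ler0n // cn_mu -[h.+1%:R]natr1.
    by rewrite lerD2l; lra.
  rewrite ler_wpM2l ?exprn_ge0 ?ler0n //.
  apply: le_trans (@monomials_coef_bound R _ _ 1 _ _ rho J rho_ge0) _.
  + by move=> n; apply: leq_trans (leq_Gexp B (h + k) n) _; rewrite leq_addl.
  + by move=> n; rewrite expr0 mulr1 cnX cnN cn1 expr1n.
  apply: le_trans (_ : \sum_(n < J) rho ^+ h * rho ^+ n <= _); last first.
    by rewrite -mulr_sumr ler_wpM2l ?exprn_ge0 // geo_bsum.
  apply: ler_sum => n _; rewrite mul1r sqexp_exp -exprD.
  by rewrite ler_wiXn2l ?sqexp_ge // ltW.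
- have [M HM] := growth_bsum j rho_ge0 q_lt1; exists (M * (1 - rho)^-1) => N.
  apply: le_trans (ler_wpM2r c_ge0 (HM N)); rewrite mulr_suml.
  by apply: ler_sum => h _; rewrite mulrA.
Qed.

Variable x : CR.
Hypothesis x_small : rho * expR (cn x) < 1.
Let w := cexp (x / 2).
Let v h : CR := w ^+ h.*2.+1 - w^-1 ^+ h.*2.+1.

Lemma w_pow h : w ^+ h.*2.+1 = cexp (mu h * x).
Proof.
rewrite -cexpMn; congr cexp; rewrite -addn1 natrD -muln2 natrM; by field.
Qed.

Lemma v_sum h : Csum (fun j => x ^+ j / j`!%:R * (1 - (-1) ^+ j) * mu h ^+ j) (v h).
Proof.
have H1 := cexp_sum (mu h * x); have H2 := CsumMl (-1) (cexp_sum (- (mu h * x))).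
have -> : v h = cexp (mu h * x) + -1 * cexp (- (mu h * x)).
  by rewrite /v exprVn w_pow cexpN mulN1r.
apply: eq_Csum (CsumD H1 H2) => j; rewrite [(- (mu h * x)) ^+ j]exprNn exprMn; ring.
Qed.

Lemma mu_expR h : expR (cn (mu h * x)) <= expR (cn x) * expR (cn x) ^+ h.
Proof.
rewrite -expRM_natl -expRD ler_expR cnM cn_mu mulrDl addrC lerD2r.
by have := cn_ge0 x; lra.
Qed.

Lemma v_terms h J :
  \sum_(j < J) cn (x ^+ j / j`!%:R * (1 - (-1) ^+ j) * mu h ^+ j) <=
  2 * (expR (cn x) * expR (cn x) ^+ h).
Proof.
apply: le_trans (_ : 2 * expR (cn (mu h * x)) <= _); last by rewrite ler_wpM2l // mu_expR.
apply: le_trans (ler_wpM2l _ (exp_partial J (cn_ge0 (mu h * x)))) => //.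
rewrite mulr_sumr; apply: ler_sum => j _.
have -> : cn (x ^+ j / j`!%:R * (1 - (-1) ^+ j) * mu h ^+ j) =
    cn (1 - (-1) ^+ j) * (cn (mu h * x) ^+ j / j`!%:R).
  rewrite !cnM cnV cn_nat !cnX exprMn; ring.
apply: ler_wpM2r; first by rewrite divr_ge0 ?exprn_ge0 ?cn_ge0 ?ler0n.
apply: le_trans (cnB _ _) _; rewrite cn1 cnX cnN cn1 expr1n; lra.
Qed.

Lemma v_bound h : cn (v h) <= 2 * (expR (cn x) * expR (cn x) ^+ h).
Proof. exact: Csum_le (v_sum h) (v_terms h). Qed.

Let bsum_vg : bsum (fun h => 2 * (expR (cn x) * expR (cn x) ^+ h) * (rho ^+ h / (1 - rho))).
Proof.
exists (2 * expR (cn x) / (1 - rho) * (1 - rho * expR (cn x))^-1) => N.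
have e_ge0 := expR_ge0 (cn x).
have c_ge0 : 0 <= 2 * expR (cn x) / (1 - rho).
  by rewrite mulr_ge0 ?invr_ge0 ?mulr_ge0 // ltW.
have re_ge0 : 0 <= rho * expR (cn x) by rewrite mulr_ge0.
apply: le_trans (ler_wpM2l c_ge0 (geo_bsum re_ge0 x_small N)).
rewrite mulr_sumr; apply: ler_sum => h _; rewrite exprMn le_eqVlt; apply/orP; left.
by apply/eqP; ring.
Qed.

(** Both series equal the sum over h of [v h] times [pth h]. Expanding [pth] and summing geometric
    series in h gives the first, expanding v h = 2 sinh(mu_h x) in powers of x the second. The
    condition |q| e^|x| < 1 lets |q|^h beat the growth of [v h]. *)
Lemma rank_fourier : exists2 V,
  Csum (fun n => (-1) ^+ n.+1 * q ^+ sqexp n.+1 *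
    (w / (1 - w ^+ 2 * q ^+ n.+1) - w^-1 / (1 - w^-1 ^+ 2 * q ^+ n.+1))) V &
  Csum (fun j => x ^+ j / j`!%:R * (1 - (-1) ^+ j) * ev (rsum j 0) q) V.
Proof.
have vg_ge0 h : 0 <= 2 * (expR (cn x) * expR (cn x) ^+ h).
  by rewrite mulr_ge0 ?mulr_ge0 ?exprn_ge0 ?expR_ge0.
have [V HV] : exists V, Csum (fun h => v h * pth h) V.
  apply: bsum_Csum; have [M HM] := bsum_vg; exists M => N; apply: le_trans (HM N).
  by apply: ler_sum => h _; rewrite cnM ler_pM ?cn_ge0 ?v_bound ?pth_bound.
exists V.
- apply: (@fubini R (fun h n => v h * ((-1) ^+ n.+1 * q ^+ (h * n.+1 + sqexp n.+1)))
    (fun h => v h * pth h) _ _ _ _ bsum_vg _ _ HV).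
  + move=> h J; under eq_bigr => n _ do rewrite cnM.
    by rewrite -mulr_sumr ler_pM ?cn_ge0 ?v_bound ?pth_terms // sumr_ge0 // => n _; apply: cn_ge0.
  + by move=> h; apply: CsumMl; apply: pth_sum.
  + have geo_w u n : cn (u ^+ 2) <= expR (cn x) ->
      Csum (fun h => u ^+ h.*2.+1 * ((-1) ^+ n.+1 * q ^+ (h * n.+1 + sqexp n.+1)))
      ((-1) ^+ n.+1 * q ^+ sqexp n.+1 * (u / (1 - u ^+ 2 * q ^+ n.+1))).
      move=> le_u.
      have u1 : cn (u ^+ 2 * q ^+ n.+1) < 1.
        apply: le_lt_trans x_small; rewrite cnM mulrC ler_pM ?cn_ge0 //.
        by rewrite cnX exprS ler_piMr // exprn_ile1 // ltW.
      have H := CsumMl ((-1) ^+ n.+1 * q ^+ sqexp n.+1 * u) (geo_Csum u1).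
      rewrite mulrA; apply: eq_Csum H => h.
      rewrite exprMn -!exprM [(2 * h)%N]mul2n [(n.+1 * h)%N]mulnC exprD [u ^+ _.+1]exprS; ring.
    move=> n; have w2 (u : CR) : cn (cexp u) <= expR (cn u).
      by rewrite cn_cexp ler_expR; apply: le_trans (cn_Re u); apply: ler_norm.
    have E2 : w ^+ 2 = cexp x by rewrite -cexpMn; congr cexp; field.
    have H1 : cn (w ^+ 2) <= expR (cn x) by rewrite E2 w2.
    have H2 : cn (w^-1 ^+ 2) <= expR (cn x).
      by rewrite exprVn E2 -cexpN -(cnN x) w2.
    have := CsumD (geo_w w n H1) (CsumMl (-1) (geo_w w^-1 n H2)).
    rewrite mulN1r -mulrBr; apply: eq_Csum => h.
    by rewrite /v [RHS]mulrBl mulN1r.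
- apply: (@fubini R (fun h j => x ^+ j / j`!%:R * (1 - (-1) ^+ j) * mu h ^+ j * pth h)
    (fun h => v h * pth h) _ _ _ _ bsum_vg _ _ HV).
  + move=> h J; under eq_bigr => n _ do rewrite cnM.
    by rewrite -mulr_suml ler_pM ?cn_ge0 ?v_terms ?pth_bound // sumr_ge0 // => n _; apply: cn_ge0.
  + move=> h; have := CsumMl (pth h) (v_sum h); rewrite mulrC; apply: eq_Csum => j; ring.
  + move=> j; have := CsumMl (x ^+ j / j`!%:R * (1 - (-1) ^+ j)) (rsum_sum j).
    by apply: eq_Csum => h; rewrite mulrA.
Qed.
End RankAnalytic.

(** * Theta functions as values of formal theta series *)

Section ThetaExpansion.
Variable R : realType.
Notation CR := (C R).
Variable B : nat.
Notation b := (B.+1).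
Notation ptheta := (ptheta CR B).
Notation ctheta := (ctheta CR B).
Implicit Types tau : CR.

Lemma bin2_double n : ('C(n.+1, 2) * 2 = n.+1 * n)%N.
Proof. by rewrite -[2%N in LHS]/(2`!)%N bin_ffact !ffactnS ffactn0 muln1. Qed.

Lemma theta_termE a tau (z : int) N : (b%:Z * z ^+ 2 + a%:Z * z = (2 * N)%N%:Z) ->
  theta_term a b tau z = (-1) ^ z * e2pi tau ^+ N.
Proof.
move=> E; rewrite /theta_term E.
have -> : (2 * N)%N%:Z%:~R / 2 = N%:R :> CR.
  by rewrite -[(2 * N)%N%:Z%:~R]/((2 * N)%N%:R : CR) natrM mulrC mulKf // pnatr_eq0.
by rewrite e2piMn.
Qed.

(** Positive indices give the partial theta series at b - M, negative ones that at M. *)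
Lemma theta_ev a M tau : (a + M.*2 = b)%N -> upper_half_plane tau ->
  theta a b tau = ev (ctheta M 0) (e2pi tau).
Proof.
move=> Eb /cn_e2pi_lt1 q1; set q := e2pi tau in q1 *.
have le_Mb : (M <= b)%N by lia.
have E1 n : theta_term a b tau n.+1%:Z = (-1) ^+ n.+1 * q ^+ (b - M + Gexp B (b - M) n).
  apply: theta_termE.
  have E : (b * (n.+1 * n.+1) + a * n.+1 = 2 * (b - M + Gexp B (b - M) n))%N.
    rewrite /Gexp [RHS]mulnDr [(2 * (n * _ + _))%N]mulnDr (_ : 2 * (b * 'C(n.+1, 2)) = b * (n.+1 * n))%N; last first.
      by rewrite -bin2_double; ring.
    have -> : (b - M = a + M)%N by lia.
    by rewrite -[in RHS]Eb -[in LHS]Eb -muln2; ring.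
  by rewrite -E PoszD !PoszM expr2.
have E2 n : theta_term a b tau (- n.+1%:Z) = (-1) ^+ n.+1 * q ^+ (M + Gexp B M n).
  rewrite (@theta_termE _ _ _ (M + Gexp B M n)); last first.
    have E : (b * (n.+1 * n.+1) = 2 * (M + Gexp B M n) + a * n.+1)%N.
      rewrite /Gexp [(2 * (M + _))%N]mulnDr [(2 * (n * _ + _))%N]mulnDr (_ : 2 * (b * 'C(n.+1, 2)) = b * (n.+1 * n))%N; last first.
        by rewrite -bin2_double; ring.
      by rewrite -[in RHS]Eb -[in LHS]Eb -muln2; ring.
    rewrite sqrrN expr2 mulrN -!PoszM E PoszD PoszM; ring.
  by rewrite -exprnN invr_sign.
have H0 : theta_term a b tau 0 = 1.
  by rewrite (@theta_termE _ _ _ 0) ?expr0 ?mulr1 // expr0n /= !mulr0.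
apply: Cto_lim; rewrite ev_ctheta //.
have := CtoD (CtoD (Cto_cst 1) (ptheta_sum B (b - M) q1)) (ptheta_sum B M q1).
apply: eq_Cto => N; rewrite big_ord_recl H0; congr (1 + _ + _).
  by apply: eq_bigr => i _; rewrite E1.
by apply: eq_bigr => i _; rewrite E2.
Qed.
End ThetaExpansion.

(** * The defining identity rewritten in x = 2 pi i z *)

Section FGIdentity.
Variable R : realType.
Notation CR := (C R).
Variable n0 : nat.
Notation B := (n0.+1.*2).
Notation b := (B.+1).
Notation k := (n0.+2).
Notation ptheta := (ptheta CR B).
Notation ctheta := (ctheta CR B).
Notation rsum := (rsum CR B).
Notation M := (n0.+1).

(** The identity is termwise, with Q = q^(n+1). Since (1 - Q)^2 = (1 - zeta Q)(1 - Q/zeta) - Q (1 -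
    zeta)(1 - 1/zeta), the first part of each Bailey term cancels the two theta terms, and (1 -
    zeta)(1 - 1/zeta) = -(w - 1/w)^2 produces the rank terms. *)
Lemma rank_theta_sum (q x : CR) L : q != 0 -> cn q < 1 -> cn q * expR (cn x) < 1 ->
  let w := cexp (x / 2) in
  Csum (fun s => q ^+ (k.-1 * s ^ 2) * rank_alpha q (cexp x) s) L ->
  exists2 V, Csum (fun j => x ^+ j / j`!%:R * (1 - (-1) ^+ j) * ev (rsum j 0) q) V &
    L + ev (ctheta M 0) q = 1 - (w - w^-1) * V.
Proof.
move=> q_neq0 q1 qx1 w HL; have [V HV1 HV2] := @rank_fourier R B q q1 x qx1.
exists V => //.
rewrite ev_ctheta //.
rewrite -/w in HV1.
have w0 : w != 0 by apply: cexp_neq0.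
have E2 : w ^+ 2 = cexp x by rewrite -cexpMn; congr cexp; field.
have wq_lt (u : CR) n : cn u <= expR (cn x) -> 1 - u * q ^+ n.+1 != 0.
  move=> le_u; rewrite -cn_gt0; apply: lt_le_trans (cn_1B_ge _); rewrite subr_gt0.
  apply: le_lt_trans qx1; rewrite cnM mulrC ler_pM ?cn_ge0 //.
  by rewrite cnX exprS ler_piMr ?cn_ge0 // exprn_ile1 ?cn_ge0 // ltW.
have d1 n : 1 - w ^+ 2 * q ^+ n.+1 != 0.
  by apply: wq_lt; rewrite E2 cn_cexp ler_expR; apply: le_trans (cn_Re x); apply: ler_norm.
have d2 n : 1 - w^-1 ^+ 2 * q ^+ n.+1 != 0.
  apply: wq_lt; rewrite exprVn E2 -cexpN cn_cexp ler_expR -cnN.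
  by apply: le_trans (cn_Re (- x)); apply: ler_norm.
have H1 := (Csum_recl _ _).1 HL; rewrite [rank_alpha _ _ 0]/= mulr0 subr0 in H1.
have H := CsumD (CsumD H1 (ptheta_sum B (b - M) q1)) (ptheta_sum B M q1).
have E : L + ev (ptheta (b - M) 0) q + ev (ptheta M 0) q = - (w - w^-1) * V.
  apply: Csum_unique H _; apply: eq_Csum (CsumMl (- (w - w^-1)) HV1) => n.
  have e1 : (b - M + Gexp B (b - M) n = M + Gexp B M n + n.+1)%N.
    have -> : (b - M = M.+1)%N by lia.
    by rewrite /Gexp; lia.
  have e2 : (k.-1 * n.+1 ^ 2 + 'C(n.+1, 2) = M + Gexp B M n)%N.
    have E : (B * 'C(n.+1, 2) = M * (n.+1 * n))%N by rewrite -bin2_double -mul2n; ring.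
    rewrite /Gexp -mulnn [(b * _)%N]mulSn E [k.-1]/=; ring.
  have e3 : sqexp B n.+1 = (M + Gexp B M n + n.+1)%N.
    by rewrite -e1 /sqexp /Gexp doubleK; lia.
  rewrite /rank_alpha /rank_num /rank_den -E2 -exprVn e1 e3 [n.+1.-1]/=.
  have -> : q ^+ (k.-1 * n.+1 ^ 2) * ((-1) ^+ n * q ^+ 'C(n.+1, 2) *
     (1 + q ^+ n.+1) * (1 - q ^+ n.+1) ^+ 2 /
     ((1 - w ^+ 2 * q ^+ n.+1) * (1 - w^-1 ^+ 2 * q ^+ n.+1))) =
     (-1) ^+ n * q ^+ (M + Gexp B M n) * (1 + q ^+ n.+1) * (1 - q ^+ n.+1) ^+ 2 /
     ((1 - w ^+ 2 * q ^+ n.+1) * (1 - w^-1 ^+ 2 * q ^+ n.+1)).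
    by rewrite -e2 exprD; ring.
  rewrite exprD exprS; move: (d1 n) (d2 n); set Q := q ^+ n.+1; set P := q ^+ (M + _).
  set s := (-1) ^+ n; have -> : w^-1 ^+ 2 = (w ^+ 2)^-1 by rewrite exprVn.
  move=> h1 h2; have h3 : w ^+ 2 - Q != 0.
    have -> : w ^+ 2 - Q = w ^+ 2 * (1 - (w ^+ 2)^-1 * Q) by field.
    by rewrite mulf_neq0 // expf_neq0.
  by field; rewrite h1 h3 w0.
have -> : (w - w^-1) * V = - (L + ev (ptheta (b - M) 0) q + ev (ptheta M 0) q) by rewrite E mulNr opprK.
ring.
Qed.

Lemma punctured_nbhs (P : CR -> Prop) : (\forall z \near (0 : CR)^'%classic, P z) ->
  exists2 e : R, 0 < e & forall z, 0 < cn z < e -> P z.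
Proof.
rewrite /dnbhs /within => /nbhs_ballP[e /= e_gt0 He].
have /andP[/eqP Ie Re_gt0] : (complex.Im e == 0) && (0 < complex.Re e).
  by move: e_gt0; rewrite ltcE /= => /andP[-> ->].
exists (complex.Re e) => // z /andP[z_gt0 z_lt]; apply: He; last by rewrite -cn_gt0.
rewrite -ball_normE /= cnE sub0r cnN.
have -> : e = (complex.Re e)%:C%C by apply/eqP; rewrite eq_complex /= Ie !eqxx.
by rewrite ltcR.
Qed.

Lemma twopiI_neq0 : 2 * cpi R * cI R != 0.
Proof.
rewrite -cn_gt0 twopiIE; apply: lt_le_trans (cn_Im _).
by rewrite /= normr_gt0 mulf_neq0 // gt_eqF // pi_gt0.
Qed.

Lemma FG_identity (f : nat -> CR -> CR) tau : (0 < n0)%N -> FG_coefficients k f ->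
  upper_half_plane tau -> exists2 eps : R, 0 < eps & forall x, 0 < cn x < eps ->
  let w := cexp (x / 2) in exists G V,
  [/\ Csum (fun j => (if j is 0 then 0 else f j tau / j`!%:R) * x ^+ j) G,
      Csum (fun j => x ^+ j / j`!%:R * (1 - (-1) ^+ j) * ev (rsum j 0) (e2pi tau)) V &
      x * (1 - (w - w^-1) * V) = (w - w^-1) * cexp (2 * G)].
Proof.
move=> n0_gt0 Hf tau_up; have q1 := cn_e2pi_lt1 tau_up.
have [e e_gt0 He] := punctured_nbhs (Hf tau tau_up).
set q := e2pi tau in q1 He *; have q_neq0 : q != 0 by apply: e2pi_neq0.
have q_gt0 : 0 < cn q by rewrite cn_gt0.
set T := 2 * cpi R * cI R in He; have T0 : T != 0 by apply: twopiI_neq0.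
have T_gt0 : 0 < cn T by rewrite cn_gt0.
have l_gt0 : 0 < - ln (cn q) by rewrite oppr_gt0 ln_lt0 // q_gt0.
(* The first bound keeps z = x/T in the given punctured neighbourhood, the second means |q| e^|x| <
   1. *)
exists (Num.min (e * cn T) (- ln (cn q))); first by rewrite lt_min l_gt0 mulr_gt0.
move=> x /andP[x_gt0]; rewrite lt_min => /andP[x_lt1 x_lt2] w.
have x_neq0 : x != 0 by rewrite -cn_gt0.
have qx1 : cn q * expR (cn x) < 1.
  have : expR (cn x) < (cn q)^-1 by rewrite -(lnK (x := (cn q)^-1)) ?posrE ?invr_gt0 // lnV ?posrE // ltr_expR.
  by rewrite -(ltr_pM2l q_gt0) mulfV // gt_eqF.
pose z := x / T; have [] := He z.
  by rewrite cnM cnV divr_gt0 //= ltr_pdivrMr.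
have Tz : T * z = x by rewrite /z mulrCA mulfV // mulr1.
have Ez : e2pi z = cexp x by rewrite /e2pi -/T Tz.
have le_cn u : cn (cexp u) <= expR (cn u).
  by rewrite cn_cexp ler_expR; apply: le_trans (cn_Re u); apply: ler_norm.
have zq u : cn u = cn x -> cn (cexp u * q) < 1.
  move=> eu; apply: le_lt_trans qx1; rewrite cnM mulrC ler_pM ?cn_ge0 //.
  by rewrite -eu le_cn.
have zVq : cn ((cexp x)^-1 * q) < 1 by rewrite -cexpN; apply: zq; rewrite cnN.
have k3 : (3 <= k)%N by rewrite !ltnS.
have [L HL FGE] := @FG_limit R q q_neq0 q1 (cexp x) (cexp_neq0 x) (zq x erefl) zVq k k3.
have [V HV EV] := rank_theta_sum q_neq0 q1 qx1 HL.
rewrite Ez FGE => cv FE.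
pose u j := (if j is 0 then 0 else f j tau / j`!%:R) * x ^+ j.
have uE N : \sum_(i < N.+1) u i = \sum_(1 <= j < N.+1) FG_exponent_term f tau z j.
  rewrite big_ord_recl (_ : u ord0 = 0) ?add0r ?big_add1 /= ?big_mkord; last by rewrite /u mul0r.
   apply: eq_bigr => i _.
  by rewrite /FG_exponent_term /u -/T Tz mulrAC.
have := cvg_Cto cv; set G := limn _ => HG.
have {}HG : Csum u G.
  apply/(Cto_shift _ _ 1); apply: eq_Cto ((Cto_shift _ _ 1).2 HG) => N.
  by rewrite addn1 uE.
have b_eq : (2 * k - 1)%N = b by rewrite -addnn; lia.
move: FE; rewrite -/G b_eq.
rewrite (@theta_ev R B 1 M tau) //.
rewrite -mulrDl EV -/w => E; exists G, V; split=> //.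
have [_ qpi0] := qp_cvg q1.
have cpi0 : cpi R != 0 by apply: contra_neq T0 => p0; rewrite /T p0 mulr0 mul0r.
have cI0 : cI R != 0 by apply: contra_neq T0 => p0; rewrite /T p0 mulr0.
have z0 : z != 0 by rewrite /z mulf_neq0 ?invr_neq0.
have sE : csin (cpi R * z) = (w - w^-1) / (2 * cI R).
  have e1 : cI R * (cpi R * z) = x / 2 by rewrite -Tz /T; field.
  by rewrite /csin e1 cexpN.
rewrite sE in E; have := congr1 (fun t => t * qpoch_inf q q * x) E.
rewrite [_ / _ * qpoch_inf q q]divfK // mulrC => ->.
have w0 : w != 0 by apply: cexp_neq0.
rewrite -[in LHS]Tz /T; move: (cpi R) cpi0 => p p0.
by field; rewrite w0 qpi0 z0 cI0 p0.
Qed.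
End FGIdentity.

(** * The exponents f_{k,j} as power series in q *)

Section FpsInverse.
Variable A : comNzRingType.
Implicit Types f : fps A.

Definition finv f : fps A := lsum (fun i => (1 - f) ^+ i).

Lemma finvP f : f 0%N = 1 -> f * finv f = 1.
Proof.
move=> f0; pose z := 1 - f; have z1 : vge 1 z.
  by case=> // _; rewrite fcoefB f0 fcoef1 subrr.
have lz : lfin (fun i => z ^+ i).
  elim=> [|i IHi]; first exact: vge0.
  by rewrite exprS -add1n; apply: vgeM.
have E : finv f = 1 + z * finv f.
  by rewrite {1}/finv lsum_recl // -lsumMl // expr0; congr (_ + _); apply: eq_lsum => i; rewrite exprS.
have {1}-> : f = 1 - z by rewrite /z subKr.
by rewrite mulrBl mul1r {1}E addrK.
Qed.

Lemma fX_reg f : fX A * f = 0 -> f = 0.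
Proof.
move=> fX0; apply: fpsP => n; have := congr1 (fun h : fps A => h n.+1) fX0.
by rewrite -[fX A]expr1 fcoefXnM subn1.
Qed.
End FpsInverse.

(** * From the analytic identity in x to a formal exponential *)

Section ExponentialIdentity.
Variable R : realType.
Notation CR := (C R).
Notation S := (fps CR).

(** The series of 2 sinh(x/2); accordingly [sinhV] is x / (2 sinh(x/2)). *)
Definition sinh2 : S := expf 2^-1 + fC (-1) * expf (- 2^-1).
Definition sinhV : S := finv (tl sinh2).

Lemma sinh2E : sinh2 = fX CR * tl sinh2.
Proof.
apply: fpsP => -[|n]; rewrite -[fX CR]expr1 fcoefXnM ?subn1 //.
by rewrite fcoefD fcoefCM /= !expr0 mulN1r subrr.
Qed.

Lemma tl_sinh2_coef n : tl sinh2 n = (2^-1 ^+ n.+1 - (- 2^-1) ^+ n.+1) / n.+1`!%:R.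
Proof. by rewrite /tl -[LHS]/(sinh2 n.+1) fcoefD fcoefCM mulN1r mulrBl. Qed.

Lemma tl_sinh2_0 : tl sinh2 0%N = 1.
Proof. by rewrite tl_sinh2_coef !expr1 opprK (_ : 1`! = 1)%N // divr1; field. Qed.

Lemma sinhVP : tl sinh2 * sinhV = 1.
Proof. exact: finvP tl_sinh2_0. Qed.

Lemma sinhV0 : sinhV 0%N = 1.
Proof.
have := congr1 (fun f : S => f 0%N) sinhVP.
by rewrite fcoefM big_ord1 subnn tl_sinh2_0 mul1r fcoef1.
Qed.

Lemma sinhV_odd n : odd n -> sinhV n = 0.
Proof.
move=> oddn; have E : sc (-1) (tl sinh2) = tl sinh2.
  apply: fpsP => m; rewrite fcoef_sc tl_sinh2_coef [(- 2^-1) ^+ _]exprNn -[(-1) ^+ m]signr_odd -[(-1) ^+ m.+1]signr_odd /=.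
  by case: (odd m); rewrite ?expr1 ?expr0 ?mul1r // subrr mul0r mulr0.
have E2 : sc (-1) sinhV = sinhV.
  by apply: (fps_regI tl_sinh2_0); rewrite sinhVP -{1}E -rmorphM sinhVP rmorph1.
have := congr1 (fun f : S => f n) E2; rewrite fcoef_sc -signr_odd oddn expr1 mulN1r.
by move=> /eqP; rewrite eq_sym -subr_eq0 opprK -mulr2n mulrn_eq0 => /eqP.
Qed.

Lemma eu_fder (a : S) : eu a = fX CR * fder a.
Proof.
by apply: fpsP => -[|n]; rewrite -[fX CR]expr1 fcoefXnM ?subn1.
Qed.

Lemma pconvN r (a : S) : pconv r a -> pconv r (- a).
Proof. by move=> ca; rewrite -mulN1r -(rmorph1 fC) -rmorphN; apply/pconvM/ca/pconv_fC. Qed.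

Lemma evB r (a c : S) x : pconv r a -> pconv r c -> cn x < r -> ev (a - c) x = ev a x - ev c x.
Proof.
move=> ca cc xr; rewrite (evD ca (pconvN cc) xr) -mulN1r -(rmorph1 fC) -rmorphN.
by rewrite (evM (@pconv_fC R r _) cc xr) ev_fC mulN1r.
Qed.

Lemma ev_1 (x : CR) : ev 1 x = 1.
Proof. by rewrite -(rmorph1 fC) ev_fC. Qed.

Lemma pconv_1 r : pconv r (1 : S).
Proof. by rewrite -(rmorph1 fC); apply: pconv_fC. Qed.

Lemma pconv_sinh2 r : pconv r sinh2.
Proof.
by apply: pconvD; [|apply: pconvM; first exact: pconv_fC]; apply: pconv_expf.
Qed.

Lemma ev_sinh2 (x : CR) : ev sinh2 x = cexp (x / 2) - (cexp (x / 2))^-1.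
Proof.
have x1 : cn x < cn x + 1 by rewrite ltrDl.
have cE u : pconv (cn x + 1) (expf u : S) by apply: pconv_expf.
have cC := @pconv_fC R (cn x + 1) (-1).
rewrite (evD (cE _) (pconvM cC (cE _)) x1) (evM cC (cE _) x1) ev_fC -!cexp_ev.
by rewrite mulN1r mulNr cexpN [2^-1 * x]mulrC.
Qed.

Variables (eps : R) (g y : S).
Hypothesis eps_gt0 : 0 < eps.
Hypotheses (cg : pconv eps g) (cy : pconv eps y).
Hypothesis Hx : forall x, 0 < cn x < eps ->
  x * (1 - ev sinh2 x * ev y x) = ev sinh2 x * cexp (2 * ev g x).

Let t : S := fX CR * (1 - sinh2 * y).

Let cSy : pconv eps (1 - sinh2 * y).
Proof.
apply: pconvD; first exact: pconv_1.
by apply/pconvN/pconvM => //; apply: pconv_sinh2.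
Qed.

Let ct : pconv eps t. Proof. by apply: pconvM => //; rewrite -[fX CR]expr1; apply: pconv_fXn. Qed.

Lemma ev_fX (x : CR) : ev (fX CR) x = x.
Proof. by rewrite -[fX CR]expr1 ev_fXn expr1. Qed.

Lemma pconv_fX r : pconv r (fX CR).
Proof. by rewrite -[fX CR]expr1; apply: pconv_fXn. Qed.

Lemma pconv_fder r (a : S) : pconv r a -> pconv r (fder a).
Proof. by move=> ca; apply/pconv_tl/pconv_eu. Qed.

Let ev_t x : 0 < cn x < eps -> ev t x = ev sinh2 x * cexp (2 * ev g x).
Proof.
move=> /[dup] /Hx <- /andP[_ xe]; have cs := @pconv_sinh2 eps.
rewrite (evM (@pconv_fX eps) cSy xe) ev_fX.
by rewrite (evB (@pconv_1 eps) (pconvM cs cy) xe) ev_1 (evM cs cy xe).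
Qed.

(** The logarithmic derivative of t = 2 sinh(x/2) exp(2 g) with denominators cleared. The
    exponential is gone, so the identity theorem makes the equation formal. *)
Lemma der_identity : sinh2 * fder t = fder sinh2 * t + fC 2 * (sinh2 * (fder g * t)).
Proof.
have cs := @pconv_sinh2 eps; have cds := pconv_fder cs.
have cdg := pconv_fder cg; have cdt := pconv_fder ct.
have cC := @pconv_fC R eps.
have c2 := pconvM (cC 2) (pconvM cs (pconvM cdg ct)).
have c3 := pconvD (pconvM cds ct) c2.
have c4 := pconvD (pconvM cs cdt) (pconvN c3).
apply/subr0_eq/fpsP; apply: (@ev_coef_eq0 R eps eps) => //.
move=> x x_gt0 xe; have x_ok : 0 < cn x < eps by rewrite x_gt0.
rewrite (evB (pconvM cs cdt) c3 xe) (evM cs cdt xe).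
rewrite (evD (pconvM cds ct) c2 xe) (evM cds ct xe) (evM (cC 2) (pconvM cs (pconvM cdg ct)) xe).
rewrite (evM cs (pconvM cdg ct) xe) (evM cdg ct xe) !ev_fC ev_t //.
pose E := cexp (2 * ev g x).
have -> : ev (fder t) x = ev (fder sinh2) x * E + ev sinh2 x * (E * (2 * ev (fder g) x)).
  have [_ <-] := DerE (Der_ev ct xe).
  have De : Der (@cexp R \o ((fun z => 2 * z) \o ev g)) x (E * (2 * ev (fder g) x)).
    apply: Der_comp; last exact: Der_cexp1.
    by apply: Der_comp; [exact: Der_ev cg xe | exact: Der_lin].
  have := DerM (Der_ev cs xe) De => D1.
  suff /DerE[_] : Der (ev t) x (ev (fder sinh2) x * E + ev sinh2 x * (E * (2 * ev (fder g) x))).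
    by [].
  apply: eq_Der D1; exists (Num.min (cn x) (eps - cn x)).
    by rewrite lt_min x_gt0 subr_gt0.
  move=> h; rewrite lt_min => /andP[h1 h2]; rewrite ev_t //.
  have := cnD x h; have := cnB (x + h) h; rewrite addrK => e1 e2.
  by apply/andP; split; lra.
rewrite -/E; ring.
Qed.

(** With t = [sinh2 * h], the equation [der_identity] contains [sinh2] twice as a factor; each copy
    is cancelled as x times a series with constant term 1. *)
Lemma exponential_identity : let h := sinhV - fX CR * y in eu h = eu g * h *+ 2.
Proof.
move=> h.
have th : t = sinh2 * h.
  by rewrite /t /h mulrBr mulrBr {2}sinh2E -[fX CR * tl _ * sinhV]mulrA sinhVP; ring.
have := der_identity; rewrite th => /(congr1 (fun a => fX CR * (fX CR * a))).
have -> : fX CR * (fX CR * (sinh2 * fder (sinh2 * h))) = fX CR * (sinh2 * eu (sinh2 * h)).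
  by rewrite [eu (sinh2 * h)]eu_fder; ring.
have -> : fX CR * (fX CR * (fder sinh2 * (sinh2 * h) + fC 2 * (sinh2 * (fder g * (sinh2 * h))))) =
   fX CR * (eu sinh2 * (sinh2 * h) + (sinh2 * (eu g * (sinh2 * h))) *+ 2).
  by rewrite [eu sinh2]eu_fder [eu g]eu_fder rmorph_nat; ring.
move=> /eqP; rewrite -subr_eq0 -mulrBr => /eqP/fX_reg.
rewrite euM => /eqP.
have -> : sinh2 * (eu sinh2 * h + sinh2 * eu h) -
    (eu sinh2 * (sinh2 * h) + sinh2 * (eu g * (sinh2 * h)) *+ 2) =
    fX CR * (tl sinh2 * (fX CR * (tl sinh2 * (eu h - eu g * h *+ 2)))).
  have sE (D : S) : fX CR * (tl sinh2 * D) = sinh2 * D by rewrite mulrA -sinh2E.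
  by rewrite !sE; ring.
move=> /eqP/fX_reg/(fps_reg tl_sinh2_0)/fX_reg/(fps_reg tl_sinh2_0).
exact: subr0_eq.
Qed.
End ExponentialIdentity.

(** * The functions f_{k,j} identified with convergent q-series *)

Section FGExponent.
Variable R : realType.
Notation CR := (C R).
Notation S := (fps CR).

Lemma Csum_pconv eps (a : S) :
  (forall x, 0 < cn x < eps -> exists l, Csum (fun j => a j * x ^+ j) l) -> pconv eps a.
Proof.
move=> H rho rho_gt0 rho_lt; have cr : cn (rho%:C%C : CR) = rho by rewrite cn_real gtr0_norm.
have [|l Hl] := H rho%:C%C; first by rewrite cr rho_gt0.
have [M HM] := Cto_bounded Hl; exists (M + M) => n.
have -> : cn (a n) * rho ^+ n = cn (a n * rho%:C%C ^+ n) by rewrite cnM cnX cr.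
have -> : a n * rho%:C%C ^+ n =
  \sum_(i < n.+1) a i * rho%:C%C ^+ i - \sum_(i < n) a i * rho%:C%C ^+ i.
  by rewrite big_ord_recr /= addrAC subrr add0r.
by apply: le_trans (cnB _ _) _; apply: lerD.
Qed.

Lemma fsubalg_pconv r : fsubalg (pconv r : S -> Prop).
Proof.
split; [exact: pconv_fC | exact: pconvD | exact: pconvM].
Qed.

Lemma ev_sum r (I : Type) (s : seq I) (F : I -> S) x : (forall i, pconv r (F i)) -> cn x < r ->
  ev (\sum_(i <- s) F i) x = \sum_(i <- s) ev (F i) x.
Proof.
move=> cF xr; elim: s => [|i s IHs]; first by rewrite !big_nil -(rmorph0 fC) ev_fC.
rewrite !big_cons (evD (cF i) _ xr) ?IHs //.
by apply: fsubalg_sum => //; apply: fsubalg_pconv.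
Qed.

Lemma evMn r (a : S) n x : pconv r a -> cn x < r -> ev (a *+ n) x = ev a x *+ n.
Proof.
move=> ca xr; rewrite -[a *+ n]mulr_natl -(rmorph_nat fC).
by rewrite (evM (@pconv_fC R r _) ca xr) ev_fC mulr_natl.
Qed.

Variable n0 : nat.
Hypothesis n0_gt0 : (0 < n0)%N.
Notation B := (n0.+1.*2).
Notation k := (n0.+2).
Notation rsum := (rsum CR B).

Definition rank_egf_part (n : nat) : S :=
  if n is m.+1 then fC ((1 - (-1) ^+ m) / m`!%:R) * rsum m 0 else 0.
(** The series h = exp(2 g) in x, its coefficients being q-series; [rank_log] is half its formal
    logarithm, whose constant term is 0 because the inverse of 0 is 0. *)
Definition rank_egf : fps S := Fps (fun n => fC (sinhV R n) - rank_egf_part n).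
Definition rank_log : fps S := Fps (fun n => fC ((2 * n)%N%:R^-1) * (eu rank_egf * finv rank_egf) n).

Lemma rank_egfE n : rank_egf n = fC (sinhV R n) - rank_egf_part n. Proof. by []. Qed.
Lemma rank_logE n : rank_log n = fC ((2 * n)%N%:R^-1) * (eu rank_egf * finv rank_egf) n. Proof. by []. Qed.

Lemma rank_egf_0 : rank_egf 0%N = 1.
Proof. by rewrite rank_egfE /rank_egf_part subr0 sinhV0 rmorph1. Qed.

Lemma rank_egf_odd n : odd n -> rank_egf n = 0.
Proof.
case: n => // n oddn; rewrite rank_egfE /rank_egf_part sinhV_odd // rmorph0 sub0r -signr_odd.
by move: oddn => /= /negbTE ->; rewrite expr0 subrr mul0r rmorph0 mul0r oppr0.
Qed.

Lemma rank_egf_even n : rank_egf n.*2.+2 = fC (sinhV R n.*2.+2) - fC (2 / (n.*2.+1)`!%:R) * rsum n.*2.+1 0.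
Proof.
by rewrite rank_egfE /rank_egf_part -signr_odd /= odd_double expr1 opprK.
Qed.

Lemma rank_log_0 : rank_log 0%N = 0.
Proof. by rewrite rank_logE muln0 invr0 rmorph0 mul0r. Qed.

Lemma eu_rank_egf : eu rank_egf = eu rank_log * rank_egf *+ 2.
Proof.
have E : eu rank_log *+ 2 = eu rank_egf * finv rank_egf.
  apply: fpsP => -[|n].
    by rewrite fcoefMn fcoef_eu fcoefM big_ord1 fcoef_eu !mulr0n mul0rn mul0r.
  rewrite fcoefMn fcoef_eu -mulrnA rank_logE -[LHS]mulr_natl mulrA -(rmorph_nat fC) -rmorphM.
  by rewrite mulnC mulfV ?rmorph1 ?mul1r // pnatr_eq0.
by rewrite mulrC -mulrnAr E mulrCA finvP ?mulr1 // rank_egf_0.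
Qed.

Lemma pconv_rank_egf n : pconv 1 (rank_egf n).
Proof.
apply: pconvD; first exact: pconv_fC.
case: n => [|n]; apply: pconvN; first by rewrite /rank_egf_part -(rmorph0 fC); apply: pconv_fC.
by apply: pconvM; [apply: pconv_fC | apply: pconv_rsum].
Qed.

Lemma pconv_rank_log n : pconv 1 (rank_log n).
Proof.
by have [_ H] := exp_closed n0 rank_egf_0 rank_log_0 eu_rank_egf (fsubalg_pconv 1); apply: H; apply: pconv_rank_egf.
Qed.

Variable f : nat -> CR -> CR.
Hypothesis Hf : FG_coefficients k f.

(** At fixed tau, [g] and the values of [rank_log] obey the recursion [exp_fps_coef] with the same
    h, hence agree. *)
Lemma f_rank_log tau n : upper_half_plane tau -> (0 < n)%N ->
  f n tau = n`!%:R * ev (rank_log n) (e2pi tau).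
Proof.
move=> tau_up; have q1 := cn_e2pi_lt1 tau_up; set q := e2pi tau in q1 *.
have [eps eps_gt0 H] := FG_identity n0_gt0 Hf tau_up; rewrite -/q in H.
pose g : S := Fps (fun j => if j is 0 then 0 else f j tau / j`!%:R).
pose y : S := Fps (fun j => (1 - (-1) ^+ j) / j`!%:R * ev (rsum j 0) q).
have Ey (x : CR) V : Csum (fun j => x ^+ j / j`!%:R * (1 - (-1) ^+ j) * ev (rsum j 0) q) V ->
  Csum (fun j => y j * x ^+ j) V.
  by apply: eq_Csum => j; rewrite /y [Fps _ _]/=; ring.
have cg : pconv eps g by apply: Csum_pconv => x /H[G [V [HG _ _]]]; exists G.
have cy : pconv eps y by apply: Csum_pconv => x /H[G [V [_ /Ey HV _]]]; exists V.
have dh := exponential_identity eps_gt0 cg cy.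
have {}dh : eu (sinhV R - fX CR * y) = eu g * (sinhV R - fX CR * y) *+ 2.
  apply: dh => x /H[G [V [HG /Ey HV E]]].
  by rewrite ev_sinh2 (@ev_eq _ g x G HG) (ev_eq HV).
set h := sinhV R - fX CR * y in dh.
have hE m : ev (rank_egf m) q = h m.
  rewrite fcoefB -[fX CR]expr1 fcoefXnM.
  rewrite (evB (@pconv_fC R 1 (sinhV R m)) _ q1) ?ev_fC; last first.
    case: m => [|m]; first by rewrite /rank_egf_part -(rmorph0 fC); apply: pconv_fC.
    by apply: pconvM; [apply: pconv_fC | apply: pconv_rsum].
  congr (_ - _); case: m => [|m]; first by rewrite /rank_egf_part -(rmorph0 fC) ev_fC.
  rewrite subn1 /rank_egf_part (evM (@pconv_fC R 1 _) (@pconv_rsum R B m) q1) ev_fC.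
  by [].
have h0 : h 0%N = 1 by rewrite -hE rank_egf_0 ev_1.
suff gE m : ev (rank_log m) q = g m.
  by case: n => // n _; rewrite gE /g [Fps _ _]/= mulrCA mulfV ?mulr1 // fact_neq0.
elim/ltn_ind: m => m IHm.
have [->|m_gt0] := posnP m; first by rewrite rank_log_0 -(rmorph0 fC) ev_fC.
have E1 := exp_fps_coef m h0 dh; have E2 := exp_fps_coef m rank_egf_0 eu_rank_egf.
have PA := fsubalg_pconv 1.
have cs i : pconv 1 (rank_log i *+ i * rank_egf (m - i)%N).
  by apply: pconvM; [apply: (fsubalgMn PA); apply: pconv_rank_log | apply: pconv_rank_egf].
have cS : pconv 1 (\sum_(i < m) rank_log i *+ i * rank_egf (m - i)%N) by apply: (fsubalg_sum PA).
have cG : pconv 1 (rank_log m *+ m) by apply: (fsubalgMn PA); apply: pconv_rank_log.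
have := congr1 (fun a => ev a q) E2.
rewrite (evMn _ (pconv_rank_egf m) q1) hE E1.
rewrite (evD (fsubalgMn PA 2 cS) (fsubalgMn PA 2 cG) q1) (evMn _ cS q1) (evMn _ cG q1).
rewrite (evMn _ (pconv_rank_log m) q1) (ev_sum _ (fun i : 'I_m => cs i) q1).
have -> : \sum_(i < m) ev (rank_log i *+ i * rank_egf (m - i)%N) q = \sum_(i < m) g i *+ i * h (m - i)%N.
  apply: eq_bigr => i _.
  rewrite (evM (fsubalgMn PA i (pconv_rank_log i)) (pconv_rank_egf _) q1) (evMn _ (pconv_rank_log i) q1).
  by rewrite hE IHm.
move=> /addrI /eqP; rewrite -!mulrnA -[g m *+ _]mulr_natl -[ev _ _ *+ _]mulr_natl => /eqP E.
by apply/esym; apply: mulfI E; rewrite pnatr_eq0 muln_eq0 negb_or -lt0n m_gt0.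
Qed.
End FGExponent.

(** * The generated algebra *)

Section Eisenstein.
Variable R : realType.
Notation CR := (C R).
Notation S := (fps CR).

Lemma mom_Lambert_coef e N : mom (Lambert CR) e N = if (0 < N)%N then (sigma e N)%:R else 0.
Proof.
rewrite fcoef_lsum.
under eq_bigr => s _ do rewrite fcoefCM [Lambert CR s]/(lambert CR s) fcoef_lambert.
have [->|N_gt0] := posnP N; first by rewrite big1 // => s _; rewrite andbF mulr0.
rewrite -(big_mkord xpredT (fun s => s%:R ^+ e * ((s %| N)%N && true && (0 < s)%N)%:R)).
rewrite /sigma natr_sum.
have -> : \sum_(d <- divisors N) (d ^ e)%:R =
    \sum_(d <- [seq d <- index_iota 0 N.+1 | (d %| N)%N]) (d ^ e)%:R :> CR.
  apply: perm_big; apply: uniq_perm; rewrite ?divisors_uniq ?filter_uniq ?iota_uniq //.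
  move=> d; rewrite mem_filter mem_index_iota -dvdn_divisors // ltnS /=.
  by case: (boolP (d %| N)%N) => // /(dvdn_leq N_gt0) ->.
rewrite big_filter [RHS]big_mkcond; apply: eq_bigr => d _; rewrite andbT natrX.
case: (boolP (d %| N)%N) => [dN|_]; last by rewrite mulr0.
by rewrite (dvdn_gt0 N_gt0 dN) mulr1.
Qed.

Lemma pconv_mom_Lambert e : pconv 1 (mom (Lambert CR) e).
Proof.
apply: (@pconv_growth _ _ 1 e.+1) => N; rewrite fcoef_lsum mul1r.
apply: le_trans (cn_sum _ _ _) _.
apply: le_trans (_ : \sum_(i < N.+1) N.+1%:R ^+ e <= _); last first.
  by rewrite sumr_const card_ord -[_ *+ _]mulr_natr -exprSr.
apply: ler_sum => s _; rewrite fcoefCM [Lambert CR s]/(lambert CR s) fcoef_lambert cnM cnX cn_nat.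
rewrite -[leRHS]mulr1 ler_pM ?exprn_ge0 ?cn_ge0 ?ler0n //.
  by rewrite lerXn2r ?nnegrE ?ler0n // ler_nat ltnW.
by rewrite cn_nat lern1 leq_b1.
Qed.

Lemma eisenstein_ev n tau : upper_half_plane tau ->
  eisenstein n tau = - ratr (bernoulli n) / (2 * n)%:R + ev (mom (Lambert CR) n.-1) (e2pi tau).
Proof.
move=> /cn_e2pi_lt1 q1; congr (_ + _); apply: Cto_lim.
have HS : Csum (fun i => (if (0 < i)%N then (sigma n.-1 i)%:R else 0) * e2pi tau ^+ i)
    (ev (mom (Lambert CR) n.-1) (e2pi tau)).
  apply: eq_Csum (evP (pconv_mom_Lambert n.-1) q1) => i; congr (_ * _).
  exact: mom_Lambert_coef.
apply/(Cto_shift _ _ 1); apply: eq_Cto ((Cto_shift _ _ 1).2 HS) => N.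
by rewrite addn1 big_ord_recl mul0r add0r big_add1 /= big_mkord.
Qed.
End Eisenstein.

(** * Transfer to functions on the upper half plane *)

Section Assembly.
Variable R : realType.
Notation CR := (C R).
Notation S := (fps CR).
Notation T := (2 * cpi R * cI R).
Notation H := (@upper_half_plane R).

Lemma eq_Der_H (g h : CR -> CR) tau d : (forall t, H t -> g t = h t) -> H tau ->
  Der g tau d -> Der h tau d.
Proof.
move=> pth Ht; apply: eq_Der; have [e e_gt0 He] := upper_half_plane_open Ht.
by exists e => // t /He/pth.
Qed.

Lemma Der_ev_e2pi (a : S) tau : pconv 1 a -> H tau ->
  Der (fun t => ev a (e2pi t)) tau (T * ev (eu a) (e2pi tau)).
Proof.
move=> ca /cn_e2pi_lt1 q1; have := Der_comp (Der_e2pi tau) (Der_ev ca q1).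
by rewrite eu_fder (evM (@pconv_fX R 1) (pconv_fder ca) q1) ev_fX mulrC mulrA.
Qed.

Lemma derive1n_ev (a : S) (g : CR -> CR) c j : pconv 1 a ->
  (forall t, H t -> g t = c * ev a (e2pi t)) ->
  forall t, H t -> derive1n j g t = c * T ^+ j * ev (iter j (@eu CR) a) (e2pi t).
Proof.
move=> ca ga; have cj i : pconv 1 (iter i (@eu CR) a).
  by elim: i => // i IHi; apply: pconv_eu.
elim: j => [|j IHj] t Ht; first by rewrite expr0 mulr1 -ga.
rewrite derive1nS.
have D1 := DerM (Der_cst (c * T ^+ j) t) (Der_ev_e2pi (cj j) Ht).
rewrite mul0r add0r in D1.
have {}D1 := eq_Der_H (fun s s_up => esym (IHj s s_up)) Ht D1.
by have [_ ->] := DerE D1; rewrite exprSr !mulrA.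
Qed.

Variable (n0 : nat) (f : nat -> CR -> CR).
Hypothesis n0_gt0 : (0 < n0)%N.
Notation B := (n0.+1.*2).
Notation k := (n0.+2).
Hypothesis Hf : FG_coefficients k f.
Notation A := (generated_algebra (generators k f)).

Lemma generated_subalgebra (G : set (CR -> CR)) : is_subalgebra (generated_algebra G).
Proof.
split.
- by move=> c M [[MC _ _ _] _]; apply: MC.
- by move=> g h Ag Ah M HM; have [[_ MD _ _] _] := HM; apply: MD; [apply: Ag | apply: Ah].
- by move=> g h Ag Ah M HM; have [[_ _ MM _] _] := HM; apply: MM; [apply: Ag | apply: Ah].
- by move=> g h pth Ag M HM; have [[_ _ _ ME] _] := HM; apply: ME pth _; apply: Ag.
Qed.

Let AC c : A (cst c). Proof. by have [] := generated_subalgebra (generators k f). Qed.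
Let AD g h : A g -> A h -> A (g \+ h).
Proof. by have [_ + _ _] := generated_subalgebra (generators k f); apply. Qed.
Let AM g h : A g -> A h -> A (g \* h).
Proof. by have [_ _ + _] := generated_subalgebra (generators k f); apply. Qed.
Let AE g h : (forall t, H t -> g t = h t) -> A g -> A h.
Proof. by have [_ _ _ +] := generated_subalgebra (generators k f); apply. Qed.

(** The subalgebra of q-series to which the formal closure results are applied. *)
Let P (a : S) := pconv 1 a /\ A (fun t => ev a (e2pi t)).

Lemma fsubalg_P : fsubalg P.
Proof.
split.
- move=> c; split; first exact: pconv_fC.
  by apply: AE (AC c) => t _; rewrite ev_fC.
- move=> a b [ca Aa] [cb A_b]; split; first exact: pconvD.
  by apply: AE (AD Aa A_b) => t /cn_e2pi_lt1 q1; rewrite (evD ca cb q1).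
- move=> a b [ca Aa] [cb A_b]; split; first exact: pconvM.
  by apply: AE (AM Aa A_b) => t /cn_e2pi_lt1 q1; rewrite (evM ca cb q1).
Qed.

Lemma P_of_A (a : S) g c d : c != 0 -> pconv 1 a -> A g ->
  (forall t, H t -> g t = d + c * ev a (e2pi t)) -> P a.
Proof.
move=> c0 ca Ag ga; split=> //.
apply: AE (AM (AC c^-1) (AD Ag (AC (- d)))) => t Ht /=.
by rewrite ga // [d + _]addrC addrK mulKf.
Qed.

Lemma P_mom_Lambert i : odd i -> P (mom (Lambert CR) i).
Proof.
move=> oddi; pose n := (i./2).+1.
have Ei : i = (2 * n).-1 by have := odd_double_half i; rewrite oddi /n; lia.
apply: (@P_of_A _ (eisenstein (2 * n)) 1 (- ratr (bernoulli (2 * n)) / (2 * (2 * n))%:R)).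
- exact: oner_neq0.
- exact: pconv_mom_Lambert.
- by apply: sub_gen_smallest; left; right; exists n.
- by move=> t Ht; rewrite mul1r Ei eisenstein_ev.
Qed.

Lemma f_ev n : (0 < n)%N -> forall t, H t ->
  f (2 * n)%N t = (2 * n)`!%:R * ev (rank_log R n0 n.*2) (e2pi t).
Proof. by move=> n_gt0 t Ht; rewrite mul2n (f_rank_log n0_gt0 Hf) // double_gt0. Qed.

Lemma T_exp_neq0 c j : c != 0 -> c * T ^+ j != 0.
Proof. by move=> c0; rewrite mulf_neq0 // expf_neq0 // twopiI_neq0. Qed.

(** Orders up to n0 come from the generators; [g_closed] adds order n0 + 1. *)
Lemma P_rank_log n i : (i <= n0.+1)%N -> P (iter i (@eu CR) (rank_log R n0 n)).
Proof.
move: i; apply/DclosedP; move: n.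
apply: (g_closed fsubalg_P P_mom_Lambert (@rank_egf_0 R n0) (@rank_log_0 R n0) (@rank_egf_odd R n0) (@rank_egf_even R n0) _ (@eu_rank_egf R n0)).
  by move=> n; rewrite mulf_neq0 ?invr_neq0 ?fact_neq0 ?pnatr_eq0.
move=> n n_gt0; apply/DclosedP => i le_i.
apply: (@P_of_A _ (derive1n i (f (2 * n))) ((2 * n)`!%:R * T ^+ i) 0).
- exact/T_exp_neq0/fact_neq0.
- by elim: i {le_i} => [|i IHi]; [apply: pconv_rank_log | apply: pconv_eu].
- apply: sub_gen_smallest; left; left; exists (n, i) => //.
  by split=> //=; rewrite subn2.
- by move=> t Ht; rewrite add0r (derive1n_ev i (@pconv_rank_log R n0 _) (f_ev n_gt0)).
Qed.

(** The index M = n0 + 1 - l solves 2l + 1 = b - 2M; the order n0 + 1 is supplied by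
    [ctheta_closed]. *)
Lemma P_ctheta l i : (l <= n0)%N -> (i <= n0.+1)%N -> P (iter i (@eu CR) (ctheta CR B (n0.+1 - l) 0)).
Proof.
move=> le_l; move: i; apply/DclosedP; apply: (ctheta_closed fsubalg_P P_mom_Lambert); first by lia.
apply/DclosedP => i le_i.
apply: (@P_of_A _ (theta_derivative (2 * l + 1) (2 * k - 1) i) ((cpi R * cI R) ^- i * T ^+ i) 0).
- rewrite T_exp_neq0 // invr_neq0 // expf_neq0 //.
  by apply: contra_neq (twopiI_neq0 R) => E; rewrite -mulrA E mulr0.
- by elim: i {le_i} => [|i IHi]; [apply: pconv_ctheta | apply: pconv_eu].
- apply: sub_gen_smallest; right; exists (l, i) => //.
  by rewrite /= subn2.
move=> t Ht; rewrite add0r /theta_derivative.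
rewrite (@derive1n_ev (ctheta CR B (n0.+1 - l) 0) _ 1) ?mul1r ?mulrA //; first exact: pconv_ctheta.
move=> s s_up; rewrite mul1r (_ : (2 * k - 1)%N = B.+1) ?(@theta_ev R B _ (n0.+1 - l)) //; lia.
Qed.

(** A subalgebra by the sum and product rules, so containing the generators is enough for it to
    contain all of [A]. *)
Let der_in g := A g /\ exists g', (forall t, H t -> Der g t (g' t)) /\ A g'.

Lemma der_in_subalgebra : is_subalgebra der_in.
Proof.
split.
- move=> c; split; first exact: AC.
  by exists (cst 0); split; [move=> t _; apply: Der_cst | apply: AC].
- move=> g h [Ag [g' [Dg Ag']]] [Ah [h' [Dh Ah']]]; split; first exact: AD.
  exists (g' \+ h'); split; last exact: AD.
  by move=> t Ht; apply: DerD; [apply: Dg | apply: Dh].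
- move=> g h [Ag [g' [Dg Ag']]] [Ah [h' [Dh Ah']]]; split; first exact: AM.
  exists ((g' \* h) \+ (g \* h')); split; last by apply: AD; apply: AM.
  by move=> t Ht; apply: DerM; [apply: Dg | apply: Dh].
- move=> g h gh [Ag [g' [Dg Ag']]]; split; first exact: AE gh Ag.
  by exists g'; split=> // t Ht; apply: (eq_Der_H gh Ht); apply: Dg.
Qed.

Lemma der_in_ev (a : S) g c d : P a -> P (eu a) ->
  (forall t, H t -> g t = d + c * ev a (e2pi t)) -> der_in g.
Proof.
move=> [ca Aa] [_ Aea] ga; have [_ _ _ dE] := der_in_subalgebra.
apply: (dE (cst d \+ (cst c \* (fun t => ev a (e2pi t))))); first by move=> t Ht; rewrite ga.
have [dC dD dM _] := der_in_subalgebra; apply: dD; [exact: dC | apply: dM; first exact: dC].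
split=> //; exists (cst T \* (fun t => ev (eu a) (e2pi t))); split; last exact: AM.
by move=> t Ht; apply: Der_ev_e2pi.
Qed.

Lemma generators_der_in : (generators k f `<=` der_in)%classic.
Proof.
move=> g [[|]|].
- case=> -[n i] [/= n_gt0]; rewrite subn2 => le_i <-.
  have [Pi PSi] := (@P_rank_log n.*2 i (leqW le_i), @P_rank_log n.*2 i.+1 le_i).
  apply: (der_in_ev (c := (2 * n)`!%:R * T ^+ i) (d := 0) Pi PSi) => t Ht.
  by rewrite add0r (derive1n_ev i (@pconv_rank_log R n0 _) (f_ev n_gt0)).
- case=> n /= n_gt0 <-.
  have oddn : odd (2 * n).-1 by rewrite mul2n; case: n n_gt0 => // n _; rewrite doubleS /= odd_double.
  have PS := P_eu_Lambert fsubalg_P P_mom_Lambert oddn.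
  apply: (der_in_ev (c := 1) (P_mom_Lambert oddn) PS) => t Ht.
  by rewrite mul1r eisenstein_ev.
- case=> -[l i] [/=]; rewrite subn2 => le_l le_i <-.
  have [Pi PSi] := (P_ctheta le_l (leqW le_i), @P_ctheta l i.+1 le_l le_i).
  apply: (der_in_ev (c := (cpi R * cI R) ^- i * T ^+ i) (d := 0) Pi PSi) => t Ht.
  rewrite add0r /theta_derivative.
  rewrite (@derive1n_ev (ctheta CR B (n0.+1 - l) 0) _ 1) ?mul1r ?mulrA //; first exact: pconv_ctheta.
  move=> s s_up; rewrite mul1r (_ : (2 * k - 1)%N = B.+1) ?(@theta_ev R B _ (n0.+1 - l)) //; lia.
Qed.

Lemma generated_closed_under_D : closed_under_D A.
Proof.
move=> g Ag; have [_ [g' [Dg Ag']]] := smallest_sub der_in_subalgebra generators_der_in Ag.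
split=> [t Ht|]; first by have [] := DerE (Dg t Ht).
by apply: AE (AM (AC T^-1) Ag') => t Ht; rewrite /D; have [_ ->] := DerE (Dg t Ht).
Qed.
End Assembly.

Theorem theorem4p2 (R : realType) (k : nat) (f : nat -> C R -> C R) :
  (3 <= k)%N ->
  FG_coefficients k f ->
  closed_under_D (generated_algebra (generators k f)).
Proof.
by case: k => [|[|n0]] //; rewrite !ltnS => n0_gt0; apply: generated_closed_under_D.
Qed.
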